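(* If a unitary fusion category $\mathcal C$ contains an object with a non-integral (Frobenius–Perron) dimension, then there is no action of $\mathcal C$ on any unital continuous trace $C^*$-algebra with connected spectrum.
   Context: A unitary fusion category is a semisimple rigid $C^*$-tensor category with simple unit and finitely many isomorphism classes of simple objects; $\mathrm{FPdim}$ denotes Frobenius–Perron dimension. For a unital $C^*$-algebra $A$, $\mathsf{C^*Alg}(A\to A)$ is the $C^*$ tensor category of right $A$-$A$ correspondences (right Hilbert $C^*$ $A$-modules with a unital left action of $A$ by adjointable operators), with adjointable bimodule maps and the relative (interior) tensor product $\boxtimes_A$. An action of $\mathcal C$ on $A$ is a unitary tensor functor $F:\mathcal C\to\mathsf{C^*Alg}(A\to A)$. *)

(* Defs.v *)
From HB Require Import structures.
From mathcomp Require Import all_boot all_order all_algebra.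
From mathcomp Require Import complex.
From mathcomp Require Import all_classical all_reals all_analysis.
Set Implicit Arguments.
Unset Strict Implicit.
Unset Printing Implicit Defensive.
Import Order.TTheory GRing.Theory Num.Theory.
Import numFieldNormedType.Exports.
Local Open Scope classical_set_scope.
Local Open Scope ring_scope.
Local Open Scope complex_scope.

(* The scalars are the complex numbers R[i] over R : realType. Norms take     *)
(* values in R[i], in its nonnegative real part; 0 <= z there says that z is  *)
(* real and nonnegative.                                                      *)

(** * Unital C*-algebras *)

(* A record over the Banach space and not an HB structure: MathComp's         *)
(* hierarchy has no join of rings and normed modules outside numDomainType.   *)
(* The zero algebra (one = 0) is allowed here.                                *)
Record cstar_algebra (R : realType) := CStarAlgebra {
  cstar_sort :> completeNormedModType R[i] ;
  mul : cstar_sort -> cstar_sort -> cstar_sort ;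
  one : cstar_sort ;
  star : cstar_sort -> cstar_sort ;
  mulA : forall a b c, mul a (mul b c) = mul (mul a b) c ;
  mul1x : forall a, mul one a = a ;
  mulx1 : forall a, mul a one = a ;
  mulDl : forall a b c, mul (a + b) c = mul a c + mul b c ;
  mulDr : forall a b c, mul a (b + c) = mul a b + mul a c ;
  mulZl : forall (z : R[i]) a b, mul (z *: a) b = z *: mul a b ;
  mulZr : forall (z : R[i]) a b, mul a (z *: b) = z *: mul a b ;
  starD : forall a b, star (a + b) = star a + star b ;
  starZ : forall (z : R[i]) a, star (z *: a) = Num.conj z *: star a ;
  starM : forall a b, star (mul a b) = mul (star b) (star a) ;
  starK : forall a, star (star a) = a ;
  cstar_norm_mul : forall a b, `|mul a b| <= `|a| * `|b| ;
  cstar_norm_star : forall a, `|mul (star a) a| = `|a| ^+ 2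
}.
Arguments one {R} {c} : rename.

(** * Right Hilbert modules and correspondences *)

Section Correspondences.
Context {R : realType} (A : cstar_algebra R).

Record hilbert_module := HilbertModule {
  hm_sort :> completeNormedModType R[i] ;
  ract : hm_sort -> A -> hm_sort ;
  inner : hm_sort -> hm_sort -> A ;
  ractDl : forall x y a, ract (x + y) a = ract x a + ract y a ;
  ractDr : forall x a b, ract x (a + b) = ract x a + ract x b ;
  ractM : forall x a b, ract x (mul a b) = ract (ract x a) b ;
  ract1 : forall x, ract x one = x ;
  ractZl : forall (z : R[i]) x a, ract (z *: x) a = z *: ract x a ;
  ractZr : forall (z : R[i]) x a, ract x (z *: a) = z *: ract x a ;
  innerD : forall x y z, inner x (y + z) = inner x y + inner x z ;
  innerZ : forall (z : R[i]) x y, inner x (z *: y) = z *: inner x y ;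
  inner_ract : forall x y a, inner x (ract y a) = mul (inner x y) a ;
  inner_star : forall x y, star (inner x y) = inner y x ;
  inner_ge0 : forall x, exists a : A, inner x x = mul (star a) a ;
  hm_norm : forall x : hm_sort, `|x| ^+ 2 = `|inner x x|
}.

Definition adjoint_pair (E F : hilbert_module) (T : E -> F) (S : F -> E) :=
  forall x y, inner (T x) y = inner x (S y).

(* lact_adj: each a acts by an adjointable operator, with adjoint star a.     *)
Record correspondence := Correspondence {
  corr_hm :> hilbert_module ;
  lact : A -> corr_hm -> corr_hm ;
  lactDl : forall a b x, lact (a + b) x = lact a x + lact b x ;
  lactZl : forall (z : R[i]) a x, lact (z *: a) x = z *: lact a x ;
  lactM : forall a b x, lact (mul a b) x = lact a (lact b x) ;
  lact1 : forall x, lact one x = x ;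
  lact_adj : forall a, adjoint_pair (lact a) (lact (star a))
}.

(* Additivity, C-linearity and right A-linearity of the underlying map follow *)
(* from the existence of an adjoint.                                          *)
Record intertwiner (E F : correspondence) := Intertwiner {
  ifun :> E -> F ;
  iadj : F -> E ;
  ifun_adj : adjoint_pair ifun iadj ;
  ifun_lact : forall a x, ifun (lact a x) = lact a (ifun x)
}.

Definition unitary_intertwiner (E F : correspondence) (U : intertwiner E F) :=
  cancel U (iadj U) /\ cancel (iadj U) U.

(* A model of the interior tensor product E \boxtimes_A F: a correspondence   *)
(* generated by elementary tensors with the interior inner product, that is,  *)
(* the completion of the algebraic tensor product over A modulo the vectors   *)
(* of length zero. It is unique up to a unique unitary intertwiner that       *)
(* preserves elementary tensors.                                              *)
Record interior_tensor (E F : correspondence) := InteriorTensor {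
  it_corr :> correspondence ;
  tens : E -> F -> it_corr ;
  tensDl : forall x x' y, tens (x + x') y = tens x y + tens x' y ;
  tensDr : forall x y y', tens x (y + y') = tens x y + tens x y' ;
  tens_balanced : forall x a y, tens (ract x a) y = tens x (lact a y) ;
  tens_ract : forall x y a, ract (tens x y) a = tens x (ract y a) ;
  tens_lact : forall a x y, lact a (tens x y) = tens (lact a x) y ;
  tens_inner : forall x y x' y',
    inner (tens x y) (tens x' y') = inner y (lact (inner x x') y') ;
  tens_dense : closure [set t : it_corr |
    exists s : seq (E * F), t = \sum_(p <- s) tens p.1 p.2] = setT
}.

Definition trivial_hilbert_module : hilbert_module.
Proof.
refine (@HilbertModule A (fun x a => mul x a) (fun x y => mul (star x) y)
  _ _ _ _ _ _ _ _ _ _ _ _).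
- by move=> x y a; rewrite mulDl.
- by move=> x a b; rewrite mulDr.
- by move=> x a b; rewrite mulA.
- by move=> x; rewrite mulx1.
- by move=> z x a; rewrite mulZl.
- by move=> z x a; rewrite mulZr.
- by move=> x y z; rewrite mulDr.
- by move=> z x y; rewrite mulZr.
- by move=> x y a; rewrite mulA.
- by move=> x y; rewrite starM starK.
- by move=> x; exists x.
- by move=> x; rewrite cstar_norm_star.
Defined.

Definition trivial_correspondence : correspondence.
Proof.
refine (@Correspondence trivial_hilbert_module (fun a x => @mul _ A a x)
  _ _ _ _ _).
- by move=> a b x; rewrite mulDl.
- by move=> z a x; rewrite mulZl.
- by move=> a b x; rewrite mulA.
- by move=> x; rewrite mul1x.
- by move=> a x y; rewrite /= starM mulA.
Defined.

End Correspondences.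

(** * The spectrum and continuous trace C*-algebras *)

Record hilbert_space (R : realType) := HilbertSpace {
  hs_sort :> completeNormedModType R[i] ;
  dot : hs_sort -> hs_sort -> R[i] ;
  dotD : forall x y z, dot x (y + z) = dot x y + dot x z ;
  dotZ : forall (c : R[i]) x y, dot x (c *: y) = c * dot x y ;
  dotC : forall x y, dot y x = Num.conj (dot x y) ;
  dot_norm : forall x : hs_sort, dot x x = `|x| ^+ 2
}.

Section Spectrum.
Context {R : realType} (A : cstar_algebra R).

Record representation := Representation {
  rep_space :> hilbert_space R ;
  rep : A -> rep_space -> rep_space ;
  repDl : forall a b x, rep (a + b) x = rep a x + rep b x ;
  repZl : forall (z : R[i]) a x, rep (z *: a) x = z *: rep a x ;
  repDr : forall a x y, rep a (x + y) = rep a x + rep a y ;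
  repZr : forall a (z : R[i]) x, rep a (z *: x) = z *: rep a x ;
  repM : forall a b x, rep (mul a b) x = rep a (rep b x) ;
  rep1 : forall x, rep one x = x ;
  rep_star : forall a x y, dot (rep a x) y = dot x (rep (star a) y)
}.

Definition irreducible (pi : representation) :=
  (exists x : pi, x != 0) /\
  forall K : set pi, closed K -> K 0 ->
    (forall (z : R[i]) x y, K x -> K y -> K (z *: x + y)) ->
    (forall a x, K x -> K (rep a x)) ->
    K = [set 0] \/ K = setT.

Definition unitarily_equivalent (pi rho : representation) :=
  exists U : pi -> rho,
    [/\ forall (z : R[i]) x y, U (z *: x + y) = z *: U x + U y,
        forall x y, dot (U x) (U y) = dot x y,
        forall y, exists x, U x = y &
        forall a x, U (rep a x) = rep a (U x)].

Record irrep := Irrep {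
  irrep_rep :> representation ;
  irrepP : irreducible irrep_rep
}.

(* The spectrum is the set of unitary equivalence classes of irreducible      *)
(* representations. The class of all irreducible representations is too large *)
(* to carry a topologicalType, so subsets of the spectrum are presented as    *)
(* predicates on irrep; hull-kernel closed and open ones are automatically    *)
(* unions of classes (hk_open_equiv), i.e. subsets of the spectrum.           *)
Definition rep_ker (pi : representation) (a : A) := forall x : pi, rep a x = 0.

Definition hk_closure (S : irrep -> Prop) : irrep -> Prop :=
  fun t => forall a, (forall s, S s -> rep_ker s a) -> rep_ker t a.

Definition hk_closed (S : irrep -> Prop) := forall t, hk_closure S t -> S t.

Definition hk_open (U : irrep -> Prop) := hk_closed (fun s => ~ U s).

Lemma hk_open_equiv (U : irrep -> Prop) (s t : irrep) :
  hk_open U -> unitarily_equivalent s t -> U s -> U t.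
Proof.
move=> oU [f [flin fdot _ frep]] Us; apply: contrapT => nUt.
apply: (oU s) Us => a /(_ _ nUt) ka x.
have f0 : f 0 = 0.
  by have := flin (-1) 0 0; rewrite scaler0 addr0 scaleN1r addNr.
have : dot (rep a x) (rep a x) = 0.
  by rewrite -fdot frep ka -[X in dot _ X](scale0r 0) dotZ mul0r.
by rewrite dot_norm => /eqP; rewrite sqrf_eq0 normr_eq0 => /eqP.
Qed.

Lemma hk_closed_equiv (S : irrep -> Prop) (s t : irrep) :
  hk_closed S -> unitarily_equivalent s t -> S t -> S s.
Proof.
move=> cS est St; apply: contrapT => nSs.
apply: (@hk_open_equiv (fun r => ~ S r) s t) => // r hr.
by move/(_ (cS r _)); apply=> a ha; apply: hr => u /contrapT; apply: ha.
Qed.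

(* Connected spaces are nonempty; for the spectrum this excludes exactly the  *)
(* zero algebra.                                                              *)
Definition spectrum_connected : Prop :=
  inhabited irrep /\
  forall U : irrep -> Prop, hk_open U -> hk_closed U ->
    (forall s, U s) \/ (forall s, ~ U s).

Definition spectrum_hausdorff : Prop :=
  forall s t : irrep, ~ unitarily_equivalent s t ->
    exists U V : irrep -> Prop,
      [/\ hk_open U, hk_open V, U s, V t & forall r, U r -> ~ V r].

Definition rank_one_projection (H : hilbert_space R) (p : H -> H) :=
  exists x : H, `|x| = 1 /\ forall y, p y = dot x y *: x.

(* Hausdorff spectrum together with Fell's condition. *)
Definition continuous_trace :=
  spectrum_hausdorff /\
  forall t : irrep, exists (U : irrep -> Prop) (a : A),
    [/\ hk_open U, U t &
        forall s, U s -> rank_one_projection (fun x : s => rep a x)].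

End Spectrum.

(** * Unitary fusion categories *)

Record cstar_category (R : realType) := CStarCategory {
  obj :> Type ;
  hom : obj -> obj -> completeNormedModType R[i] ;
  idm : forall X, hom X X ;
  comp : forall X Y Z, hom Y Z -> hom X Y -> hom X Z ;
  dag : forall X Y, hom X Y -> hom Y X ;
  compA : forall X Y Z W (h : hom Z W) (g : hom Y Z) (f : hom X Y),
    comp h (comp g f) = comp (comp h g) f ;
  comp1m : forall X Y (f : hom X Y), comp (idm Y) f = f ;
  compm1 : forall X Y (f : hom X Y), comp f (idm X) = f ;
  compDl : forall X Y Z (g g' : hom Y Z) (f : hom X Y),
    comp (g + g') f = comp g f + comp g' f ;
  compDr : forall X Y Z (g : hom Y Z) (f f' : hom X Y),
    comp g (f + f') = comp g f + comp g f' ;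
  compZl : forall X Y Z (z : R[i]) (g : hom Y Z) (f : hom X Y),
    comp (z *: g) f = z *: comp g f ;
  compZr : forall X Y Z (z : R[i]) (g : hom Y Z) (f : hom X Y),
    comp g (z *: f) = z *: comp g f ;
  dagD : forall X Y (f g : hom X Y), dag (f + g) = dag f + dag g ;
  dagZ : forall X Y (z : R[i]) (f : hom X Y),
    dag (z *: f) = Num.conj z *: dag f ;
  dagM : forall X Y Z (g : hom Y Z) (f : hom X Y),
    dag (comp g f) = comp (dag f) (dag g) ;
  dagK : forall X Y (f : hom X Y), dag (dag f) = f ;
  hom_norm_comp : forall X Y Z (g : hom Y Z) (f : hom X Y),
    `|comp g f| <= `|g| * `|f| ;
  hom_norm_dag : forall X Y (f : hom X Y), `|comp (dag f) f| = `|f| ^+ 2 ;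
  hom_dag_ge0 : forall X Y (f : hom X Y),
    exists g : hom X X, comp (dag f) f = comp (dag g) g
}.
Arguments hom {R} {c} X Y : rename.
Arguments idm {R} {c} X : rename.
Arguments comp {R} {c} {X Y Z} g f : rename.
Arguments dag {R} {c} {X Y} f : rename.

Section CategoryNotions.
Context {R : realType} (C : cstar_category R).

Definition isometry (X Y : C) (v : hom X Y) := comp (dag v) v = idm X.

Definition unitary (X Y : C) (u : hom X Y) := isometry u /\ isometry (dag u).

Definition isomorphic (X Y : C) := exists (f : hom X Y) (g : hom Y X),
  comp g f = idm X /\ comp f g = idm Y.

Definition simple (X : C) :=
  idm X <> 0 /\ forall f : hom X X, exists z : R[i], f = z *: idm X.

(* Finite orthogonal direct sums; n = 0 is a zero object. *)
Definition is_direct_sum (n : nat) (S : 'I_n -> C) (X : C) :=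
  exists v : forall i, hom (S i) X,
    (forall i, isometry (v i)) /\
    (forall i j, i <> j -> comp (dag (v i)) (v j) = 0) /\
    \sum_(i < n) comp (v i) (dag (v i)) = idm X.

Record semisimple : Prop := Semisimple {
  has_direct_sums : forall n (S : 'I_n -> C), exists X, is_direct_sum S X ;
  has_subobjects : forall (X : C) (p : hom X X), comp p p = p -> dag p = p ->
    exists (Y : C) (v : hom Y X), isometry v /\ comp v (dag v) = p ;
  decomposes : forall X : C, exists n (S : 'I_n -> C),
    (forall i, simple (S i)) /\ is_direct_sum S X
}.

End CategoryNotions.

Record cstar_tensor_category (R : realType) := CStarTensorCategory {
  tc_cat :> cstar_category R ;
  ot : tc_cat -> tc_cat -> tc_cat ;
  un : tc_cat ;
  otm : forall X Y X' Y' : tc_cat,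
    hom X X' -> hom Y Y' -> hom (ot X Y) (ot X' Y') ;
  assoc : forall X Y Z, hom (ot (ot X Y) Z) (ot X (ot Y Z)) ;
  lun : forall X, hom (ot un X) X ;
  run : forall X, hom (ot X un) X ;
  otm1 : forall X Y, otm (idm X) (idm Y) = idm (ot X Y) ;
  otmM : forall X Y X' Y' X'' Y'' (f' : hom X' X'') (f : hom X X')
      (g' : hom Y' Y'') (g : hom Y Y'),
    otm (comp f' f) (comp g' g) = comp (otm f' g') (otm f g) ;
  otmDl : forall X Y X' Y' (f f' : hom X X') (g : hom Y Y'),
    otm (f + f') g = otm f g + otm f' g ;
  otmDr : forall X Y X' Y' (f : hom X X') (g g' : hom Y Y'),
    otm f (g + g') = otm f g + otm f g' ;
  otmZl : forall X Y X' Y' (z : R[i]) (f : hom X X') (g : hom Y Y'),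
    otm (z *: f) g = z *: otm f g ;
  otmZr : forall X Y X' Y' (z : R[i]) (f : hom X X') (g : hom Y Y'),
    otm f (z *: g) = z *: otm f g ;
  otm_dag : forall X Y X' Y' (f : hom X X') (g : hom Y Y'),
    dag (otm f g) = otm (dag f) (dag g) ;
  assoc_unitary : forall X Y Z, unitary (assoc X Y Z) ;
  lun_unitary : forall X, unitary (lun X) ;
  run_unitary : forall X, unitary (run X) ;
  assoc_nat : forall X Y Z X' Y' Z'
      (f : hom X X') (g : hom Y Y') (h : hom Z Z'),
    comp (assoc X' Y' Z') (otm (otm f g) h) =
    comp (otm f (otm g h)) (assoc X Y Z) ;
  lun_nat : forall X X' (f : hom X X'),
    comp (lun X') (otm (idm un) f) = comp f (lun X) ;
  run_nat : forall X X' (f : hom X X'),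
    comp (run X') (otm f (idm un)) = comp f (run X) ;
  pentagon : forall X Y Z W,
    comp (assoc X Y (ot Z W)) (assoc (ot X Y) Z W) =
    comp (otm (idm X) (assoc Y Z W))
      (comp (assoc X (ot Y Z) W) (otm (assoc X Y Z) (idm W))) ;
  triangle : forall X Y,
    comp (otm (idm X) (lun Y)) (assoc X un Y) = otm (run X) (idm Y)
}.
Arguments ot {R} {c} X Y : rename.
Arguments un {R} {c} : rename.
Arguments otm {R} {c} {X Y X' Y'} f g : rename.
Arguments assoc {R} {c} X Y Z : rename.
Arguments lun {R} {c} X : rename.
Arguments run {R} {c} X : rename.

(* X' is a left dual of X (and X a right dual of X').                         *)
Definition dual_pair (R : realType) (C : cstar_tensor_category R) (X' X : C) :=
  exists (ev : hom (ot X' X) un) (coev : hom un (ot X X')),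
    comp (run X) (comp (otm (idm X) ev) (comp (assoc X X' X)
      (comp (otm coev (idm X)) (dag (lun X))))) = idm X /\
    comp (lun X') (comp (otm ev (idm X')) (comp (dag (assoc X' X X'))
      (comp (otm (idm X') coev) (dag (run X'))))) = idm X'.

Definition rigid (R : realType) (C : cstar_tensor_category R) :=
  forall X : C, (exists X', dual_pair X' X) /\ (exists X', dual_pair X X').

(* The isomorphism classes of simple objects come with chosen representatives *)
(* irr i; nothing below depends on the choice.                                *)
Record unitary_fusion_category (R : realType) := UnitaryFusionCategory {
  ufc_cat :> cstar_tensor_category R ;
  ufc_semisimple : semisimple ufc_cat ;
  ufc_rigid : rigid ufc_cat ;
  ufc_unit : simple (un : ufc_cat) ;
  irr_rank : nat ;
  irr : 'I_irr_rank -> ufc_cat ;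
  irr_simple : forall i, simple (irr i) ;
  irr_inj : forall i j, isomorphic (irr i) (irr j) -> i = j ;
  irr_all : forall X : ufc_cat, simple X -> exists i, isomorphic (irr i) X
}.
Arguments irr_rank {R} u.
Arguments irr {R} {u} i : rename.

(** * Frobenius-Perron dimension *)

Definition is_basis (K : nzRingType) (V : lmodType K) (n : nat) (e : 'I_n -> V) :=
  forall v : V, exists! c : {ffun 'I_n -> K}, v = \sum_(i < n) c i *: e i.

(* Equal to 0 when V is not finite-dimensional. *)
Definition dimension (K : nzRingType) (V : lmodType K) : nat :=
  xget 0%N [set n | exists e : 'I_n -> V, is_basis e].

Section FPdim.
Context {R : realType} {C : unitary_fusion_category R}.

(* multiplicity of irr k in X, by semisimplicity *)
Definition mult (k : 'I_(irr_rank C)) (X : C) : nat := dimension (hom (irr k) X).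

(* left multiplication by X on the Grothendieck ring, in the basis irr *)
Definition fusion_matrix (X : C) : 'M[R]_(irr_rank C) :=
  \matrix_(j, k) (mult k (ot X (irr j)))%:R.

Definition perron_eigenvalue (n : nat) (M : 'M[R]_n) : R :=
  sup [set x : R | 0 <= x /\ eigenvalue M x].

(* Largest nonnegative eigenvalue of the fusion matrix on simple objects,     *)
(* extended additively.                                                       *)
Definition FPdim (X : C) : R :=
  \sum_(k < irr_rank C) (mult k X)%:R * perron_eigenvalue (fusion_matrix (irr k)).

End FPdim.

(** * Actions on C*-algebras *)

(* A unitary tensor functor from C to the correspondences over A. The object  *)
(* act_obj X \boxtimes_A act_obj Y is act_box X Y, any model of the interior  *)
(* tensor product; act_J and act_J0 are the tensorator and the unit map.      *)
(* The axioms on act_J need only be stated on elementary tensors, which span  *)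
(* a dense subspace; the associator and unitors of correspondences are        *)
(* (x (x) y) (x) z |-> x (x) (y (x) z), a (x) x |-> a x and x (x) a |-> x a.  *)
Record action (R : realType) (C : unitary_fusion_category R)
    (A : cstar_algebra R) := Action {
  act_obj : C -> correspondence A ;
  act_mor : forall X Y : C, hom X Y -> intertwiner (act_obj X) (act_obj Y) ;
  act_morD : forall X Y (f g : hom X Y) x,
    act_mor (f + g) x = act_mor f x + act_mor g x ;
  act_morZ : forall X Y (z : R[i]) (f : hom X Y) x,
    act_mor (z *: f) x = z *: act_mor f x ;
  act_mor1 : forall X x, act_mor (idm X) x = x ;
  act_morM : forall X Y Z (g : hom Y Z) (f : hom X Y) x,
    act_mor (comp g f) x = act_mor g (act_mor f x) ;
  act_mor_dag : forall X Y (f : hom X Y) y,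
    act_mor (dag f) y = iadj (act_mor f) y ;
  act_box : forall X Y : C, interior_tensor (act_obj X) (act_obj Y) ;
  act_J : forall X Y : C, intertwiner (act_box X Y) (act_obj (ot X Y)) ;
  act_J_unitary : forall X Y, unitary_intertwiner (act_J X Y) ;
  act_J_nat : forall X Y X' Y' (f : hom X X') (g : hom Y Y') x y,
    act_mor (otm f g) (act_J X Y (tens (act_box X Y) x y)) =
    act_J X' Y' (tens (act_box X' Y') (act_mor f x) (act_mor g y)) ;
  act_J0 : intertwiner (trivial_correspondence A) (act_obj un) ;
  act_J0_unitary : unitary_intertwiner act_J0 ;
  act_assoc : forall X Y Z x y z,
    act_mor (assoc X Y Z) (act_J (ot X Y) Z
      (tens (act_box (ot X Y) Z) (act_J X Y (tens (act_box X Y) x y)) z)) =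
    act_J X (ot Y Z)
      (tens (act_box X (ot Y Z)) x (act_J Y Z (tens (act_box Y Z) y z))) ;
  act_lun : forall X a x,
    act_mor (lun X) (act_J un X (tens (act_box un X) (act_J0 a) x)) = lact a x ;
  act_run : forall X x a,
    act_mor (run X) (act_J X un (tens (act_box X un) x (act_J0 a))) = ract x a
}.

(* Main.v *)
Require Import Defs.
From HB Require Import structures.
From mathcomp Require Import all_boot all_order all_algebra.
From mathcomp Require Import complex.
From mathcomp Require Import all_classical all_reals all_analysis.
From mathcomp Require Import ring lra.
Set Implicit Arguments.
Unset Strict Implicit.
Unset Printing Implicit Defensive.
Import Order.TTheory GRing.Theory Num.Theory.
Import numFieldNormedType.Exports.
Local Open Scope ring_scope.
Local Open Scope complex_scope.
(* Restores mul, which the fractions of integral domains shadow. *)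
Require Import Defs.

(** Let F be an action of C on A. For an irreducible representation t of A and
    an object X, the interior tensor product of F X with t is a representation
    of A. It is finite dimensional, hence a sum of irreducible representations,
    and all of these have the same dimension n. Their number does not depend on
    t; call it rk X. Then rk is additive, rk of the unit is 1, and rk is
    multiplicative: F Y (x) t is a sum of rk Y irreducible representations, and
    F X (x) - turns each of them into rk X many (rk_un, rk_tensor,
    rk_direct_sum). A character of the fusion ring with positive integer values
    on the simple objects is a positive eigenvector of every fusion matrix, so by
    the Perron-Frobenius argument it is FPdim (FPdim_character). Hence an
    action forces every dimension to be an integer.

    The number rk X is read off traces. If x_i and y_i form a dual frame, that
    is z = sum_i x_i <y_i, z> for all z in F X, then an operator T on F X has
    trace sum_i tr_t <y_i, T x_i> on F X (x) t. Taking T = 1 and T the left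
    action of b gives respectively n rk X and the trace of b on F X (x) t, a sum
    of irreducible traces (induced_trace). Dual frames exist because X has a dual:
    the image of the coevaluation at 1 is a limit of finite sums of elementary
    tensors, and a good finite approximation is an approximate dual frame, which
    a Neumann series corrects (dual_pair_frame, approximate_frame). The element
    b = sum_i <y_i, x_i> of A thus has the integral traces n rk X.

    Integral traces are constant because A is locally a matrix algebra over its
    spectrum (local_chart). Fell's condition provides a in A acting as rank one
    projections near t. It must be shown that near t the ideal generated by a is
    all of A (local_unit). Otherwise there is an irreducible representation
    killing a and every element of A that vanishes near t: it comes from an
    extreme point of the states vanishing on those elements (extremal_state, a
    form of the Krein-Milman theorem proved by enlarging cones with Zorn's lemma)
    through the GNS construction (irrep_killing). It differs from t, since a does
    not vanish at t, but cannot be separated from t, against the Hausdorff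
    property. Consequently irreducible representations are finite dimensional, and
    near t the trace of b is the factor by which an element of A acts on the range
    of a. Positivity of a self-adjoint element at some vector is a hull-kernel
    open condition (hk_open_quad), so an integral trace is locally constant
    (trace_locally_constant), and constant by connectedness.

    The functional calculus needed for this consists of the square root of
    1 - x for norm at most 1 and of the Neumann series; from them one gets an
    absolute value of small self-adjoint elements (abs_calculus). *)

(** * Real-valued norms and sequences *)

Section RealNorm.
Context {R : realType}.
Implicit Types z w : R[i].

Lemma conjE z : Num.conj z = z^*%C. Proof. by []. Qed.

Lemma ReD z w : complex.Re (z + w) = complex.Re z + complex.Re w.
Proof. by case: z; case: w. Qed.

Lemma ReN z : complex.Re (- z) = - complex.Re z.
Proof. by case: z. Qed.

Lemma ReB z w : complex.Re (z - w) = complex.Re z - complex.Re w.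
Proof. by rewrite ReD ReN. Qed.

Lemma ReRM (r : R) z : complex.Re (r%:C * z) = r * complex.Re z.
Proof. by case: z => a b /=; rewrite mul0r subr0. Qed.

Lemma ReconjE z : complex.Re (Num.conj z) = complex.Re z.
Proof. by case: z. Qed.

Lemma conjR (r : R) : Num.conj (r%:C) = r%:C.
Proof. by rewrite conjE /= oppr0. Qed.

Lemma imaginary_unit : exists i : R[i], Num.conj i = - i /\ i * i = -1.
Proof.
exists 'i%C; rewrite conjE -expr2 sqr_i; split=> //.
by apply/eqP; rewrite eq_complex /= oppr0 !eqxx.
Qed.

Lemma ge0_RRe z : 0 <= z -> z = (complex.Re z)%:C.
Proof. by move=> z0; rewrite RRe_real// ger0_real. Qed.

Section Norm.
Variable V : normedZmodType R[i].
Implicit Types x y : V.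

(** Norms take values in R[i]; their real parts allow linear arithmetic over R. *)
Definition rn x : R := complex.Re `|x|.

Lemma rnE x : `|x| = (rn x)%:C.
Proof. by rewrite /rn -ge0_RRe. Qed.

Lemma rn_ge0 x : 0 <= rn x.
Proof. by rewrite -ler0c -rnE. Qed.

Lemma rn0 : rn (0 : V) = 0. Proof. by rewrite /rn normr0. Qed.

Lemma rn_eq0 x : rn x = 0 -> x = 0.
Proof. by move=> h; apply/eqP; rewrite -normr_eq0 rnE h. Qed.

Lemma rnN x : rn (- x) = rn x. Proof. by rewrite /rn normrN. Qed.

Lemma rnB x y : rn (x - y) = rn (y - x). Proof. by rewrite /rn distrC. Qed.

Lemma rnD x y : rn (x + y) <= rn x + rn y.
Proof. by rewrite -lecR rmorphD/= -!rnE ler_normD. Qed.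

Lemma rn_sum (I : Type) (s : seq I) (P : pred I) (F : I -> V) :
  rn (\sum_(i <- s | P i) F i) <= \sum_(i <- s | P i) rn (F i).
Proof.
elim/big_rec2 : _ => [|i y1 y2 _ h]; first by rewrite rn0.
by apply: le_trans (rnD _ _) _; rewrite lerD2l.
Qed.

Lemma rn_le0 x : (forall e : R, 0 < e -> rn x <= e) -> x = 0.
Proof.
move=> h; apply/rn_eq0/eqP; rewrite eq_le rn_ge0 andbT.
by apply/ler_addgt0Pr => e /h; rewrite add0r.
Qed.

(** Elementary limits of sequences, used uniformly for scalars, algebra
    elements, module elements and vectors. *)
Definition tends (u : nat -> V) (l : V) :=
  forall e : R, 0 < e -> exists N, forall n, (N <= n)%N -> rn (u n - l) <= e.

Definition cauchy_seq (u : nat -> V) :=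
  forall e : R, 0 < e -> exists N, forall n m, (N <= n)%N -> (N <= m)%N ->
    rn (u n - u m) <= e.

Lemma tends_uniq u l l' : tends u l -> tends u l' -> l = l'.
Proof.
move=> h h'; apply/eqP; rewrite -subr_eq0; apply/eqP/rn_le0 => e e0.
have e2 : 0 < e / 2 by rewrite divr_gt0.
have [N hN] := h _ e2; have [M hM] := h' _ e2.
have := hN (maxn N M) (leq_maxl _ _); have := hM (maxn N M) (leq_maxr _ _).
rewrite [rn (_ - l)]rnB; set n := maxn _ _ => h1 h2.
rewrite (_ : l - l' = (l - u n) + (u n - l')); last by rewrite addrA subrK.
by apply: le_trans (rnD _ _) _; lra.
Qed.

Lemma tends_cst l : tends (fun=> l) l.
Proof. by move=> e e0; exists 0%N => n _; rewrite subrr rn0 ltW. Qed.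

Lemma tendsD u v l m : tends u l -> tends v m ->
  tends (fun n => u n + v n) (l + m).
Proof.
move=> h h' e e0; have e2 : 0 < e / 2 by rewrite divr_gt0.
have [N hN] := h _ e2; have [M hM] := h' _ e2.
exists (maxn N M) => n; rewrite geq_max => /andP[/hN h1 /hM h2].
rewrite opprD addrACA; apply: le_trans (rnD _ _) _; lra.
Qed.

Lemma tendsN u l : tends u l -> tends (fun n => - u n) (- l).
Proof.
by move=> h e /h [N hN]; exists N => n /hN; rewrite -opprD rnN.
Qed.

Lemma tendsB u v l m : tends u l -> tends v m ->
  tends (fun n => u n - v n) (l - m).
Proof. by move=> h h'; apply: tendsD => //; exact: tendsN. Qed.

Lemma eq_tends u v l : u =1 v -> tends u l -> tends v l.
Proof. by move=> uv h e /h[N hN]; exists N => n /hN; rewrite uv. Qed.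

Lemma tendsS u l : tends u l -> tends (fun n => u n.+1) l.
Proof. by move=> h e /h[N hN]; exists N => n Nn; apply/hN/leqW. Qed.

Lemma tail_bounded (f : nat -> R) (M : R) N : (forall n, 0 <= f n) ->
  (forall n, (N <= n)%N -> f n <= M) -> exists2 M', 0 <= M' & forall n, f n <= M'.
Proof.
move=> f0 hM; have M0 := le_trans (f0 N) (hM N (leqnn N)).
have S0 (P : pred 'I_N) : 0 <= \sum_(i < N | P i) f i by apply: sumr_ge0.
exists (\sum_(i < N) f i + M) => [|n]; first exact: addr_ge0.
have [nN|/hM] := ltnP n N; last by have := S0 xpredT; lra.
by rewrite (bigD1 (Ordinal nN))//=; have := S0 (fun i => i != Ordinal nN); lra.
Qed.

Lemma cauchy_bounded u : cauchy_seq u -> exists M : R, forall n, rn (u n) <= M.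
Proof.
move=> h; have [N hN] := h 1 ltr01.
have [||M _ hM] := @tail_bounded (fun n => rn (u n)) (1 + rn (u N)) N.
- by move=> n; exact: rn_ge0.
- move=> n Nn; have := rnD (u n - u N) (u N); rewrite subrK => /le_trans; apply.
  by rewrite lerD2r; exact: hN.
by exists M.
Qed.

(** A limit is transferred along an estimate by another sequence, whose norm is
    spelled out so that the two sequences may live in different spaces. *)
Lemma tends_le (W : normedZmodType R[i]) (C : R) (u : nat -> V) l
    (v : nat -> W) m : 0 <= C ->
  (forall n, rn (u n - l) <= C * complex.Re `|v n - m|) ->
  (forall e : R, 0 < e -> exists N, forall n, (N <= n)%N ->
    complex.Re `|v n - m| <= e) -> tends u l.
Proof.
move=> C0 hu hv e e0; have C1 : 0 < C + 1 by lra.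
have [N hN] := hv (e / (C + 1)) (divr_gt0 e0 C1).
exists N => n /hN; rewrite ler_pdivlMr// => h; apply: le_trans (hu n) _.
have := rn_ge0 (u n - l); have := hu n; set w := complex.Re _ in h *.
have : 0 <= w by rewrite -ler0c -ge0_RRe.
nra.
Qed.

End Norm.

Lemma rn_scale (V : normedModType R[i]) (z : R[i]) (x : V) :
  rn (z *: x) = rn z * rn x.
Proof. by rewrite {1}/rn normrZ (rnE z) ReRM. Qed.

(** Norm estimates along the inheritance path of complete normed modules, so
   that they apply to C*-algebras, Hilbert modules and Hilbert spaces. *)
Section CompleteNorm.
Variable V : completeNormedModType R[i].
Implicit Types x y : V.

Lemma crnD x y : rn (x + y) <= rn x + rn y. Proof. exact: rnD. Qed.

Lemma crnBC x y : rn (x - y) = rn (y - x). Proof. exact: rnB. Qed.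

Lemma crnB x y : rn (x - y) <= rn x + rn y.
Proof. by have := rnD x (- y); rewrite rnN. Qed.

Lemma crn_tri (x y z : V) : rn (x - z) <= rn (x - y) + rn (y - z).
Proof. by have := rnD (x - y) (y - z); rewrite addrA subrK. Qed.

Lemma rnZ (z : R[i]) x : rn (z *: x) = rn z * rn x.
Proof. exact: rn_scale. Qed.

Lemma rnZR (r : R) x : rn (r%:C *: x) = `|r| * rn x.
Proof. by rewrite rnZ {1}/rn normc_def /= expr0n addr0 sqrtr_sqr. Qed.

End CompleteNorm.

Lemma rnM z w : rn (z * w) = rn z * rn w.
Proof. by rewrite {1}/rn normrM (rnE z) ReRM. Qed.

Lemma rn_real (r : R) : rn (r%:C) = `|r|.
Proof. by rewrite /rn normc_def /= expr0n addr0 sqrtr_sqr. Qed.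

Lemma rn_conj z : rn (Num.conj z) = rn z.
Proof. by rewrite /rn norm_conjC. Qed.

Lemma rn_Re z : `|complex.Re z| <= rn z.
Proof. by rewrite -lecR -rnE normc_ge_Re. Qed.

Lemma Re_le_rn z : complex.Re z <= rn z.
Proof. exact: le_trans (ler_norm _) (rn_Re z). Qed.

Lemma rn_i : rn ('i%C : R[i]) = 1.
Proof. by rewrite /rn normc_def /= expr0n add0r expr1n sqrtr1. Qed.

Lemma rn_Im z : `|complex.Im z| <= rn z.
Proof.
have := rn_Re (z * - 'i%C); rewrite rnM [rn (- _)]rnN.
by rewrite rn_i mulr1 mulrN ReN ReiNIm opprK.
Qed.

Lemma rn_ReIm z : rn z <= `|complex.Re z| + `|complex.Im z|.
Proof.
rewrite [X in rn X]complexE; apply: le_trans (rnD _ _) _.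
by rewrite rnM !rn_real rn_i mul1r.
Qed.

Lemma conjM_rn z : Num.conj z * z = ((rn z) ^+ 2)%:C.
Proof. by rewrite mulrC -normCK rnE rmorphXn. Qed.

Lemma tendsZ (V : normedModType R[i]) (z : R[i]) (u : nat -> V) l :
  tends u l -> tends (fun n => z *: u n) (z *: l).
Proof.
move=> h; apply: (tends_le (rn_ge0 z) _ h) => n.
by rewrite -scalerBr rn_scale.
Qed.

Lemma tends_conj (u : nat -> R[i]) l :
  tends u l -> tends (fun n => Num.conj (u n)) (Num.conj l).
Proof.
by move=> h e /h[N hN]; exists N => n /hN; rewrite -rmorphB rn_conj.
Qed.

Lemma ball_rn (V : normedModType R[i]) (x y : V) (e : R) :
  ball x e%:C y <-> rn (x - y) < e.
Proof. by rewrite -ball_normE /ball_ /= rnE ltcR. Qed.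

Lemma cauchy_tends (V : completeNormedModType R[i]) (u : nat -> V) :
  cauchy_seq u -> exists l, tends u l.
Proof.
move=> h; have /cauchy_cvg /cvg_ex[l ul] : cauchy (u n @[n --> \oo])%classic.
  apply/cauchy_exP => e e0; have e0' := ge0_RRe (ltW e0).
  have ep : 0 < complex.Re e by rewrite -ltcR -e0'.
  have [N hN] := h _ (divr_gt0 ep (ltr0n _ 2)).
  exists (u N); exists N => // n /= Nn; rewrite -ball_normE /ball_ /= rnE e0' ltcR.
  by apply: le_lt_trans (hN _ _ (leqnn N) Nn) _; rewrite ltr_pdivrMr//; lra.
exists l => e e0; have e1 : 0 < e%:C :> R[i] by rewrite ltcR.
have /cvgrPdist_lt/(_ _ e1) [N _ hN] := ul.
by exists N => n /hN /=; rewrite rnE ltcR rnB => /ltW.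
Qed.

Lemma cauchy_tends_real (u : nat -> R) :
  (forall e : R, 0 < e -> exists N, forall n m, (N <= n)%N -> (N <= m)%N ->
    `|u n - u m| <= e) ->
  exists l, forall e : R, 0 < e -> exists N, forall n, (N <= n)%N ->
    `|u n - l| <= e.
Proof.
move=> h; have /cauchy_cvg /cvg_ex[l ul] : cauchy (u n @[n --> \oo])%classic.
  apply/cauchy_exP => e e0; have [N hN] := h _ (divr_gt0 e0 (ltr0n _ 2)).
  exists (u N); exists N => // n /= Nn; rewrite /ball /=.
  by apply: le_lt_trans (hN _ _ (leqnn N) Nn) _; rewrite ltr_pdivrMr//; lra.
exists l => e e0; have /cvgrPdist_lt/(_ _ e0) [N _ hN] := ul.
by exists N => n /hN /=; rewrite distrC => /ltW.
Qed.

Lemma cauchy_tendsC (u : nat -> R[i]) : cauchy_seq u -> exists l, tends u l.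
Proof.
move=> h.
have [a ha] : exists l, forall e : R, 0 < e -> exists N, forall n, (N <= n)%N ->
    `|complex.Re (u n) - l| <= e.
  apply: cauchy_tends_real => e /h[N hN]; exists N => n m Nn Nm.
  by rewrite -ReB; apply: le_trans (rn_Re _) (hN _ _ Nn Nm).
have [b hb] : exists l, forall e : R, 0 < e -> exists N, forall n, (N <= n)%N ->
    `|complex.Im (u n) - l| <= e.
  apply: cauchy_tends_real => e /h[N hN]; exists N => n m Nn Nm.
  have := le_trans (rn_Im _) (hN _ _ Nn Nm).
  by case: (u n); case: (u m).
exists (a +i* b) => e e0; have e2 : 0 < e / 2 by rewrite divr_gt0.
have [N hN] := ha _ e2; have [M hM] := hb _ e2.
exists (maxn N M) => n; rewrite geq_max => /andP[/hN h1 /hM h2].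
apply: le_trans (rn_ReIm _) _.
by move: h1 h2; case: (u n) => x y /=; lra.
Qed.

Lemma tends_ge0 (u : nat -> R[i]) l :
  tends u l -> (forall n, 0 <= u n) -> 0 <= l.
Proof.
move=> h u0.
suff : l = `|l| by move=> ->.
apply: (tends_uniq h) => e e0; have [N hN] := h _ e0; exists N => n /hN.
apply: le_trans; have := ler_dist_dist (u n) l; rewrite (ger0_norm (u0 n)).
by rewrite -lecR -!rnE.
Qed.

Definition invS (n : nat) : R := n.+1%:R^-1.

Lemma invS_gt0 n : 0 < invS n. Proof. by rewrite invr_gt0. Qed.

Lemma invS_le1 n : invS n <= 1. Proof. by rewrite invf_le1// ler1n. Qed.

Lemma invS_null (e : R) : 0 < e -> exists N, forall n, (N <= n)%N -> invS n <= e.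
Proof.
move=> e0; exists (Num.truncn e^-1).+1 => n Nn.
rewrite -[e]invrK lef_pV2 ?posrE ?invr_gt0//.
apply/ltW/(lt_le_trans (truncnS_gt _)); rewrite ler_nat.
exact: leqW.
Qed.

End RealNorm.

(** * Semi-inner products *)

Record semi_inner (R : realType) (V : lmodType R[i]) := SemiInner {
  sip :> V -> V -> R[i] ;
  sipD : forall x y z, sip x (y + z) = sip x y + sip x z ;
  sipZ : forall (c : R[i]) x y, sip x (c *: y) = c * sip x y ;
  sipC : forall x y, sip y x = Num.conj (sip x y) ;
  sip_ge0 : forall x, 0 <= sip x x
}.

Section SemiInnerTheory.
Context {R : realType} {V : lmodType R[i]} (B : semi_inner V).
Implicit Types x y z : V.

Lemma sip0 x : B x 0 = 0.
Proof. by rewrite -(scale0r 0) sipZ mul0r. Qed.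

Lemma sip0l x : B 0 x = 0.
Proof. by rewrite sipC sip0 rmorph0. Qed.

Lemma sipN x y : B x (- y) = - B x y.
Proof. by rewrite -scaleN1r sipZ mulN1r. Qed.

Lemma sipB x y z : B x (y - z) = B x y - B x z.
Proof. by rewrite sipD sipN. Qed.

Lemma sipDl x y z : B (x + y) z = B x z + B y z.
Proof. by rewrite sipC sipD rmorphD /= -!sipC. Qed.

Lemma sipZl (c : R[i]) x y : B (c *: x) y = Num.conj c * B x y.
Proof. by rewrite sipC sipZ rmorphM /= -sipC. Qed.

Lemma sipNl x y : B (- x) y = - B x y.
Proof. by rewrite sipC sipN rmorphN /= -sipC. Qed.

Lemma sipBl x y z : B (x - y) z = B x z - B y z.
Proof. by rewrite sipDl sipNl. Qed.

Lemma sip_sum x (I : Type) (s : seq I) (P : pred I) (F : I -> V) :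
  B x (\sum_(i <- s | P i) F i) = \sum_(i <- s | P i) B x (F i).
Proof.
elim/big_rec2 : _ => [|i y1 y2 _ <-]; first by rewrite sip0.
by rewrite sipD.
Qed.

Definition sq x : R := complex.Re (B x x).

Definition sn x : R := Num.sqrt (sq x).

Lemma sqE x : B x x = (sq x)%:C.
Proof. by rewrite /sq -ge0_RRe// sip_ge0. Qed.

Lemma sq_ge0 x : 0 <= sq x.
Proof. by rewrite -ler0c -sqE sip_ge0. Qed.

Lemma sn_ge0 x : 0 <= sn x. Proof. exact: sqrtr_ge0. Qed.

Lemma sn2 x : sn x ^+ 2 = sq x.
Proof. by rewrite sqr_sqrtr// sq_ge0. Qed.

Lemma sqZ (c : R[i]) x : sq (c *: x) = rn c ^+ 2 * sq x.
Proof.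
by rewrite /sq sipZ sipZl mulrA [c * _]mulrC conjM_rn ReRM.
Qed.

Lemma sqN x : sq (- x) = sq x.
Proof. by rewrite /sq sipN sipNl opprK. Qed.

Lemma sqD x y : sq (x + y) = sq x + sq y + 2 * complex.Re (B x y).
Proof.
rewrite /sq sipD !sipDl !ReD [B y x]sipC ReconjE; ring.
Qed.

(** The discriminant argument for the quadratic t |-> |x - t <y,x> y|^2; for a
    null vector y its linear part must vanish. *)
Lemma cauchy_schwarz x y : rn (B x y) ^+ 2 <= sq x * sq y.
Proof.
set s := rn (B x y) ^+ 2; have s0 : 0 <= s by exact: sqr_ge0.
(* the square of x - t <y,x> y *)
have key (t : R) : 0 <= sq x - 2 * t * s + t ^+ 2 * s * sq y.
  have := sq_ge0 (x + (- t%:C * Num.conj (B x y)) *: y).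
  rewrite sqD sqZ sipZ.
  rewrite -(mulrA _ (Num.conj _)) conjM_rn rnM rnN rn_real rn_conj exprMn.
  rewrite real_normK ?num_real// mulNr ReN -/s ReRM /=.
  by move=> h; apply: le_trans h _; rewrite le_eqVlt; apply/orP; left; apply/eqP; ring.
have [y0|y0] := ltP 0 (sq y).
  have := key (sq y)^-1.
  have -> : sq x - 2 * (sq y)^-1 * s + (sq y)^-1 ^+ 2 * s * sq y = sq x - s / sq y.
    by field; rewrite gt_eqF.
  by rewrite subr_ge0 ler_pdivrMr.
have -> : sq y = 0 by apply/eqP; rewrite eq_le y0 sq_ge0.
rewrite mulr0 leNgt; apply/negP => sp.
have := key ((sq x + 1) / s).
have -> : sq y = 0 by apply/eqP; rewrite eq_le y0 sq_ge0.
rewrite mulr0 addr0 -mulrA -[_ / s * s]mulrA mulVf ?gt_eqF// mulr1.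
by have := sq_ge0 x; lra.
Qed.

Lemma cauchy_schwarz_sn x y : rn (B x y) <= sn x * sn y.
Proof.
rewrite -(@ler_pXn2r _ 2)// ?nnegrE ?rn_ge0 ?mulr_ge0 ?sn_ge0//.
by rewrite exprMn !sn2 cauchy_schwarz.
Qed.

Lemma snD x y : sn (x + y) <= sn x + sn y.
Proof.
rewrite -(@ler_pXn2r _ 2)// ?nnegrE ?addr_ge0 ?sn_ge0//.
rewrite sqrrD !sn2 sqD -mulr_natl.
have := Re_le_rn (B x y); have := cauchy_schwarz_sn x y.
lra.
Qed.

Lemma snZ (c : R[i]) x : sn (c *: x) = rn c * sn x.
Proof. by rewrite /sn sqZ sqrtrM ?sqr_ge0// sqrtr_sqr ger0_norm// rn_ge0. Qed.

Lemma sn0 : sn 0 = 0.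
Proof. by rewrite /sn /sq sip0 /= sqrtr0. Qed.

Lemma sip_close x x' y y' (M M' d : R) : sn x <= M -> sn y' <= M' ->
  sn (x - x') <= d -> sn (y - y') <= d -> rn (B x y - B x' y') <= (M + M') * d.
Proof.
move=> hx hy' dx dy.
rewrite (_ : _ - _ = B x (y - y') + B (x - x') y'); last first.
  by rewrite sipB sipBl addrA subrK.
rewrite mulrDl [M' * d]mulrC; apply: le_trans (rnD _ _) (lerD _ _);
  by apply: le_trans (cauchy_schwarz_sn _ _) _; rewrite ler_pM ?sn_ge0.
Qed.

Lemma sn_eq0P x : sn x = 0 -> forall y, B y x = 0.
Proof.
move=> x0 y; apply/rn_eq0/eqP; rewrite eq_le rn_ge0 andbT.
by apply: le_trans (cauchy_schwarz_sn _ _) _; rewrite x0 mulr0.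
Qed.

End SemiInnerTheory.

(** * Completion of a semi-inner product space *)

Section Completion.
Context {R : realType} {V : lmodType R[i]} (B : semi_inner V).

Definition cauchyB (u : nat -> V) :=
  forall e : R, 0 < e -> exists N, forall n m, (N <= n)%N -> (N <= m)%N ->
    sn B (u n - u m) <= e.

(** A point of the completion is the functional x |-> lim B x (u n) of a Cauchy
    sequence u. Equivalent sequences, and vectors that differ by a null vector,
    give the same functional, which takes the place of a quotient. *)
Definition represents (u : nat -> V) (f : V -> R[i]^o) :=
  cauchyB u /\ forall x, tends (fun n => B x (u n) : R[i]) (f x).

Definition compl_pred : pred (V -> R[i]^o) := fun f => `[< exists u, represents u f >].

Lemma cauchyB_lin (c : R[i]) u v : cauchyB u -> cauchyB v ->
  cauchyB (fun n => c *: u n + v n).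
Proof.
move=> hu hv e e0; have c1 : 0 < rn c + 1 by have := rn_ge0 c; lra.
have [N hN] := hu (e / 2 / (rn c + 1)) (divr_gt0 (divr_gt0 e0 (ltr0n _ 2)) c1).
have [M hM] := hv (e / 2) (divr_gt0 e0 (ltr0n _ 2)).
exists (maxn N M) => n m; rewrite !geq_max => /andP[n1 n2] /andP[m1 m2].
rewrite opprD addrACA -scalerBr; apply: le_trans (snD _ _ _) _; rewrite snZ.
have := hM n m n2 m2; have := hN n m n1 m1; rewrite ler_pdivlMr//.
have := sn_ge0 B (u n - u m); lra.
Qed.

Lemma represents_lin (c : R[i]) u v f g : represents u f -> represents v g ->
  represents (fun n => c *: u n + v n) (c *: f + g).
Proof.
move=> [cu uf] [cv vg]; split; first exact: cauchyB_lin.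
move=> x; have := tendsD (@tendsZ _ R[i]^o c _ _ (uf x)) (vg x).
by apply: eq_tends => n; rewrite sipD sipZ.
Qed.

Lemma compl_submod : submod_closed compl_pred.
Proof.
split.
  apply/asboolP; exists (fun=> 0); split.
    by move=> e e0; exists 0%N => n m _ _; rewrite subrr sn0 ltW.
  by move=> x; rewrite sip0; exact: tends_cst.
move=> c f g /asboolP[u hu] /asboolP[v hv]; apply/asboolP.
by exists (fun n => c *: u n + v n); exact: represents_lin.
Qed.

HB.instance Definition _ := GRing.isSubmodClosed.Build R[i] (V -> R[i]^o)
  compl_pred compl_submod.

Record completion := Compl { cfun : V -> R[i]^o ; cfunP : compl_pred cfun }.
HB.instance Definition _ := [isSub for cfun].
HB.instance Definition _ := [Choice of completion by <:].
HB.instance Definition _ := [SubChoice_isSubLmodule of completion by <:].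

End Completion.

Section CompletionInner.
Context {R : realType} {V : lmodType R[i]} (B : semi_inner V).
Local Notation completion := (completion B).
Implicit Types (u v : nat -> V) (f g : completion).

Lemma cauchyB_bounded u : cauchyB B u ->
  exists2 M : R, 0 <= M & forall n, sn B (u n) <= M.
Proof.
move=> h; have [N hN] := h 1 ltr01.
apply: (@tail_bounded _ _ (1 + sn B (u N)) N) => [n|n Nn]; first exact: sn_ge0.
have := snD B (u n - u N) (u N); rewrite subrK => /le_trans; apply.
by rewrite lerD2r; exact: hN.
Qed.

(** |u n|^2 = <u n, u n - u m> + <u n, u m>: the first term is small because u is
    Cauchy, and for fixed n the second tends to 0 in m. *)
Lemma null_represents u : cauchyB B u ->
  (forall x, tends (fun n => B x (u n)) 0) ->
  forall e : R, 0 < e -> exists N, forall n, (N <= n)%N -> sn B (u n) <= e.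
Proof.
move=> cu u0 e e0; have e2 : 0 < e / 2 by rewrite divr_gt0.
have [N hN] := cu _ e2; exists N => n Nn.
have [M hM] := u0 (u n) _ (mulr_gt0 e2 e2).
have h1 := hN n (maxn N M) Nn (leq_maxl _ _).
have h2 := hM (maxn N M) (leq_maxr _ _); move: (maxn N M) h1 h2 => m h1 h2.
have : sq B (u n) <= sn B (u n) * (e / 2) + e / 2 * (e / 2).
  rewrite /sq -[X in B _ X](subrK (u m)) sipD ReD; apply: lerD.
    apply: le_trans (Re_le_rn _) _; apply: le_trans (cauchy_schwarz_sn _ _ _) _.
    by rewrite ler_wpM2l ?sn_ge0.
  by apply: le_trans (Re_le_rn _) _; rewrite subr0 in h2.
rewrite -sn2; have := sn_ge0 B (u n); set s := sn B _; nra.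
Qed.

Lemma repr_cvg u v : cauchyB B u -> cauchyB B v ->
  exists l, tends (fun n => B (u n) (v n)) l.
Proof.
move=> cu cv; have [M M0 hM] := cauchyB_bounded cu.
have [M' M'0 hM'] := cauchyB_bounded cv.
apply: cauchy_tendsC => e e0.
have Mp : 0 < M + M' + 1 by lra.
have e2 : 0 < e / (M + M' + 1) by rewrite divr_gt0.
have [N hN] := cu _ e2; have [N' hN'] := cv _ e2.
exists (maxn N N') => n m; rewrite !geq_max => /andP[n1 n2] /andP[m1 m2].
apply: le_trans (sip_close (hM n) (hM' m) (hN _ _ n1 m1) (hN' _ _ n2 m2)) _.
have E : e = (M + M' + 1) * (e / (M + M' + 1)) by rewrite mulrC divfK ?gt_eqF.
rewrite [X in _ <= X]E; lra.
Qed.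

Definition rseq f : nat -> V := sval (cid (asboolP _ (cfunP f))).

Lemma rseqP f : represents B (rseq f) (cfun f).
Proof. exact: svalP (cid (asboolP _ (cfunP f))). Qed.

Definition cdot f g : R[i] := sval (cid (repr_cvg (rseqP f).1 (rseqP g).1)).

Lemma represents_diff u v f : represents B u (cfun f) ->
  represents B v (cfun f) -> forall e : R, 0 < e ->
  exists N, forall n, (N <= n)%N -> sn B (u n - v n) <= e.
Proof.
move=> [cu hu] [cv hv]; apply: null_represents.
  have := cauchyB_lin (-1) cv cu.
  by rewrite (_ : (fun n => _) = (fun n => u n - v n))//; apply/funext => n;
     rewrite scaleN1r addrC.
move=> x; rewrite -(subrr (cfun f x : R[i])).
by apply: eq_tends (tendsB (hu x) (hv x)) => n; rewrite sipB.
Qed.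

Lemma cdotE u v f g : represents B u (cfun f) -> represents B v (cfun g) ->
  tends (fun n => B (u n) (v n)) (cdot f g).
Proof.
move=> hu hv.
have hl : tends (fun n => B (rseq f n) (rseq g n)) (cdot f g).
  exact: svalP (cid (repr_cvg (rseqP f).1 (rseqP g).1)).
have du := represents_diff hu (rseqP f).
have dv := represents_diff hv (rseqP g).
have [M M0 hM] := cauchyB_bounded hu.1.
have [M' M'0 hM'] := cauchyB_bounded (rseqP g).1.
have null : tends (fun n => B (u n) (v n) - B (rseq f n) (rseq g n)) 0.
  move=> e e0; have Mp : 0 < M + M' + 1 by lra.
  have e2 : 0 < e / (M + M' + 1) by rewrite divr_gt0.
  have [N hN] := du _ e2; have [N' hN'] := dv _ e2.
  exists (maxn N N') => n; rewrite !geq_max => /andP[/hN n1 /hN' n2].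
  rewrite subr0; apply: le_trans (sip_close (hM n) (hM' n) n1 n2) _.
  have E : e = (M + M' + 1) * (e / (M + M' + 1)) by rewrite mulrC divfK ?gt_eqF.
  rewrite [X in _ <= X]E; lra.
have := tendsD null hl; rewrite add0r.
by apply: eq_tends => n; rewrite subrK.
Qed.

Lemma cdotD f g h : cdot f (g + h) = cdot f g + cdot f h.
Proof.
have hf := rseqP f; have hg := rseqP g; have hh := rseqP h.
have hgh : represents B (fun n => 1 *: rseq g n + rseq h n) (cfun (g + h)).
  have := represents_lin 1 hg hh.
  by rewrite (_ : 1 *: cfun g + cfun h = cfun (g + h))// scale1r.
apply: (tends_uniq (cdotE hf hgh)).
apply: eq_tends (tendsD (cdotE hf hg) (cdotE hf hh)) => n.
by rewrite scale1r sipD.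
Qed.

Lemma cdotZ (c : R[i]) f g : cdot f (c *: g) = c * cdot f g.
Proof.
have hf := rseqP f; have hg := rseqP g.
have hcg : represents B (fun n => (c - 1) *: rseq g n + rseq g n) (cfun (c *: g)).
  have := represents_lin (c - 1) hg hg.
  rewrite (_ : (c - 1) *: cfun g + cfun g = cfun (c *: g))//.
  by rewrite -{2}[cfun g]scale1r -scalerDl subrK.
apply: (tends_uniq (cdotE hf hcg)).
apply: eq_tends (@tendsZ _ R[i]^o c _ _ (cdotE hf hg)) => n.
by rewrite -{3}[rseq g n]scale1r -scalerDl subrK sipZ.
Qed.

Lemma cdotC f g : cdot g f = Num.conj (cdot f g).
Proof.
apply: (tends_uniq (cdotE (rseqP g) (rseqP f))).
by apply: eq_tends (tends_conj (cdotE (rseqP f) (rseqP g))) => n; rewrite -sipC.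
Qed.

Lemma cdot_ge0 f : 0 <= cdot f f.
Proof.
by apply: (tends_ge0 (cdotE (rseqP f) (rseqP f))) => n; exact: sip_ge0.
Qed.

Definition csip : semi_inner completion := SemiInner cdotD cdotZ cdotC cdot_ge0.

Lemma iota_represents x : represents B (fun=> x) (fun y => B y x).
Proof.
split; last by move=> y; exact: tends_cst.
by move=> e e0; exists 0%N => n m _ _; rewrite subrr sn0 ltW.
Qed.

Lemma represents_compl u (f : V -> R[i]^o) : represents B u f -> compl_pred B f.
Proof. by move=> h; apply/asboolP; exists u. Qed.

Definition ciota x : completion :=
  @Compl _ _ B (fun y => B y x) (represents_compl (iota_represents x)).

Lemma cdot_iota x y : cdot (ciota x) (ciota y) = B x y.
Proof.
apply: (tends_uniq (@cdotE _ _ (ciota x) (ciota y) (iota_represents x) (iota_represents y))).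
exact: tends_cst.
Qed.

Lemma cdot_iotal x f : cdot (ciota x) f = cfun f x.
Proof.
apply: (tends_uniq (@cdotE _ _ (ciota x) f (iota_represents x) (rseqP f))).
exact: (rseqP f).2.
Qed.

Lemma compl_eqP f g : (forall x, cfun f x = cfun g x) -> f = g.
Proof. by move=> h; apply: val_inj; apply/funext. Qed.

Definition cnorm f : R[i] := (sn csip f)%:C.

Lemma cnorm_triangle f g : cnorm (f + g) <= cnorm f + cnorm g.
Proof. by rewrite -rmorphD lecR snD. Qed.

Lemma cnormZ (c : R[i]) f : cnorm (c *: f) = `|c| * cnorm f.
Proof. by rewrite /cnorm snZ rmorphM /= rnE. Qed.

Lemma cnorm_eq0 f : cnorm f = 0 -> f = 0.
Proof.
move=> [/sn_eq0P f0]; apply: compl_eqP => x.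
by rewrite -cdot_iotal; exact: f0.
Qed.

HB.instance Definition _ := Lmodule_isNormed.Build R[i] completion
  cnorm_triangle cnormZ cnorm_eq0.

Lemma rn_compl f : rn f = sn csip f. Proof. by []. Qed.

Lemma rn_iota x : rn (ciota x) = sn B x.
Proof. by rewrite rn_compl /sn /sq /= cdot_iota. Qed.

Lemma ciotaB x y : ciota x - ciota y = ciota (x - y).
Proof. by apply: compl_eqP => z /=; rewrite sipB. Qed.

Lemma ciota_tends u f : represents B u (cfun f) ->
  tends (fun n => ciota (u n)) f.
Proof.
move=> hu e e0; have [N hN] := hu.1 _ e0; exists N => n Nn.
rewrite rn_compl -(@ler_pXn2r _ 2)// ?nnegrE ?sn_ge0 ?(ltW e0)// sn2.
have hr : represents B (fun m => (-1) *: u m + u n) (cfun (ciota (u n) - f)).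
  have := represents_lin (-1) hu (iota_represents (u n)).
  by rewrite scaleN1r addrC.
have hl := cdotE hr hr; rewrite -lecR -sqE -subr_ge0.
apply: (@tends_ge0 _
   (fun m => ((e ^+ 2)%:C - (sn B (u n - u (m + N)%N) ^+ 2)%:C))).
  apply: tendsB; first exact: tends_cst.
  move=> d /hl[M hM]; exists M => m Mm; have := hM (m + N)%N (leq_trans Mm (leq_addr _ _)).
  by rewrite scaleN1r [- u _ + _]addrC sn2 -sqE.
move=> m; rewrite -rmorphB ler0c subr_ge0 ler_pXn2r ?nnegrE ?sn_ge0 ?(ltW e0)//.
by rewrite hN// leq_addl.
Qed.

Lemma ciota_dense f (e : R) : 0 < e -> exists x, rn (f - ciota x) <= e.
Proof.
move=> /(ciota_tends (rseqP f))[N hN]; exists (rseq f N).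
by rewrite rnB hN.
Qed.

Lemma cauchy_represents u : cauchyB B u ->
  exists f : completion, represents B u (cfun f).
Proof.
move=> cu.
have h x : exists l, tends (fun n => B x (u n)) l.
  by apply: repr_cvg => //; exact: (iota_represents x).1.
have [F hF] := choice h.
have rF : represents B u F by [].
by exists (@Compl _ _ B F (represents_compl rF)).
Qed.

(** A Cauchy filter is shadowed by a Cauchy sequence from the dense image of V;
    the functional of that sequence is the limit. *)
Lemma completion_complete (F : set_system completion) :
  ProperFilter F -> cauchy F -> cvg F.
Proof.
move=> PF /cauchyP cF.
(* f n is within 1/(n+1) of the filter, v n within 1/(n+1) of f n *)
pose e := @invS R; have e0 n : 0 < e n := invS_gt0 n.
have ec n : 0 < (e n)%:C :> R[i] by rewrite ltcR.
have [f hf] := choice (fun n => cF _ (ec n)).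
have [v hv] := choice (fun n => ciota_dense (f n) (e0 n)).
have tri (a b c : completion) : rn (a - c) <= rn (a - b) + rn (b - c).
  by have := rnD (a - b) (b - c); rewrite addrA subrK.
have ff n m : rn (f n - f m) <= e n + e m.
  have [g [gn gm]] := filter_ex (filterI (hf n) (hf m)).
  move/ball_rn: gn => gn; move/ball_rn: gm => gm.
  apply: le_trans (tri _ g _) (lerD (ltW gn) _).
  by rewrite (rnB g (f m)) ltW.
have ev (d : R) : 0 < d -> exists N, forall n, (N <= n)%N -> e n <= d.
  exact: invS_null.
have cv : cauchyB B v.
  move=> d d0; have [N hN] := ev (d / 4) (divr_gt0 d0 (ltr0n _ 4)).
  exists N => n m /hN en /hN em; rewrite -rn_iota -ciotaB.
  have h1 := tri (ciota (v n)) (f n) (ciota (v m)).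
  have h2 := tri (f n) (f m) (ciota (v m)).
  have h3 := hv n; rewrite (rnB (f n) (ciota (v n))) in h3.
  have h4 := hv m; have h5 := ff n m.
  move: (rn _) (rn _) (rn _) (rn _) (rn _) h1 h2 h3 h4 h5 => r1 r2 r3 r4 r5.
  move=> h1 h2 h3 h4 h5; lra.
have [g hg] := cauchy_represents cv; apply/cvg_ex; exists g.
apply/cvgrPdist_lt => d d0; have dE := ge0_RRe (ltW d0).
have dp : 0 < complex.Re d by rewrite -ltcR -dE.
have d4 : 0 < complex.Re d / 4 by rewrite divr_gt0.
have [N hN] := ev _ d4; have [M hM] := ciota_tends hg d4.
pose n := maxn N M; have := hf n; apply: filterS => h.
move=> /ball_rn fh; rewrite dE rnE ltcR.
have h1 := tri g (ciota (v n)) h; have h2 := tri (ciota (v n)) (f n) h.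
have h3 := hM n (leq_maxr _ _); have h4 := hN n (leq_maxl _ _).
rewrite (rnB (ciota (v n)) g) in h3.
have h5 := hv n; rewrite (rnB (f n) (ciota (v n))) in h5.
move: (rn _) (rn _) (rn _) (rn _) (rn _) fh h1 h2 h3 h5 => r1 r2 r3 r4 r5.
move=> fh h1 h2 h3 h5; lra.
Qed.

HB.instance Definition _ := Uniform_isComplete.Build completion completion_complete.

Definition completion_hilbert : hilbert_space R.
Proof.
refine (@HilbertSpace R completion cdot cdotD cdotZ cdotC _).
by move=> x; rewrite rnE rn_compl -rmorphXn sn2; exact: (sqE csip x).
Defined.

End CompletionInner.

(** * Elementary functional calculus in a C*-algebra *)

Section Cstar.
Context {R : realType} (A : cstar_algebra R).
Implicit Types a b c d x y z : A.
Local Notation "a ** b" := (mul a b) (at level 40, left associativity).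

Lemma mul0x a : 0 ** a = 0.
Proof. by rewrite -(scale0r 0) mulZl !scale0r. Qed.

Lemma mulx0 a : a ** 0 = 0.
Proof. by rewrite -(scale0r 0) mulZr !scale0r. Qed.

Lemma mulNx a b : (- a) ** b = - (a ** b).
Proof. by rewrite -(scaleN1r a) mulZl scaleN1r. Qed.

Lemma mulxN a b : a ** (- b) = - (a ** b).
Proof. by rewrite -(scaleN1r b) mulZr scaleN1r. Qed.

Lemma mulBl a b c : (a - b) ** c = a ** c - b ** c.
Proof. by rewrite mulDl mulNx. Qed.

Lemma mulBr a b c : a ** (b - c) = a ** b - a ** c.
Proof. by rewrite mulDr mulxN. Qed.

Lemma star0 : star (0 : A) = 0.
Proof. by rewrite -(scale0r 0) starZ rmorph0 !scale0r. Qed.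

Lemma starN a : star (- a) = - star a.
Proof. by rewrite -(scaleN1r a) starZ rmorphN rmorph1 scaleN1r. Qed.

Lemma starB a b : star (a - b) = star a - star b.
Proof. by rewrite starD starN. Qed.

Lemma starZR (r : R) a : star (r%:C *: a) = r%:C *: star a.
Proof. by rewrite starZ conjR. Qed.

Lemma star1 : star (one : A) = one.
Proof.
have h : star (mul (star one) one : A) = mul (star one) one.
  by rewrite starM starK.
by move: h; rewrite !mulx1 starK => <-.
Qed.

Lemma star_sum (I : Type) (s : seq I) (P : pred I) (F : I -> A) :
  star (\sum_(i <- s | P i) F i) = \sum_(i <- s | P i) star (F i).
Proof.
by elim/big_rec2 : _ => [|i y1 y2 _ <-]; rewrite ?star0 ?starD.
Qed.

Lemma rn_mul a b : rn (a ** b) <= rn a * rn b.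
Proof. by rewrite -lecR rmorphM /= -!rnE cstar_norm_mul. Qed.

Lemma rn_starM a : rn (star a ** a) = rn a ^+ 2.
Proof. by apply: complexI; rewrite rmorphXn /= -!rnE cstar_norm_star. Qed.

Lemma rn_star a : rn (star a) = rn a.
Proof.
suff h b : rn b <= rn (star b) by apply/eqP; rewrite eq_le h -{2}[a]starK h.
have [->|b0] := eqVneq (rn b) 0; first exact: rn_ge0.
have bp : 0 < rn b by rewrite lt_def b0 rn_ge0.
by rewrite -(ler_pM2r bp) -expr2 -rn_starM rn_mul.
Qed.

(** The norm of one is 1 or, in the zero algebra, 0. *)
Lemma rn_one : rn (one : A) <= 1.
Proof.
have := rn_starM one; rewrite star1 mulx1; have := rn_ge0 (one : A).
nra.
Qed.

Definition inverses x y := x ** y = one /\ y ** x = one.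

Lemma inverses_comm x y b : inverses x y -> b ** x = x ** b -> b ** y = y ** b.
Proof.
move=> [xy yx] h.
rewrite -[b ** y]mul1x -yx -[_ ** x ** _]mulA [x ** (b ** y)]mulA -h.
by rewrite -[b ** x ** y]mulA xy mulx1.
Qed.

Lemma inverses_star x y : inverses x y -> star x = x -> star y = y.
Proof.
move=> [xy yx] sx.
have h : star y ** x = one by rewrite -{1}sx -starM xy star1.
by rewrite -[LHS]mulx1 -xy mulA h mul1x.
Qed.

Lemma tends_mulr (u : nat -> A) l b : tends u l -> tends (fun n => u n ** b) (l ** b).
Proof.
move=> h; apply: (tends_le (rn_ge0 b) _ h) => n.
by rewrite -mulBl mulrC rn_mul.
Qed.

Lemma tends_mull (u : nat -> A) l b : tends u l -> tends (fun n => b ** u n) (b ** l).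
Proof.
move=> h; apply: (tends_le (rn_ge0 b) _ h) => n.
by rewrite -mulBr rn_mul.
Qed.

Lemma tends_star (u : nat -> A) l : tends u l -> tends (fun n => star (u n)) (star l).
Proof. by move=> h e /h[N hN]; exists N => n /hN; rewrite -starB rn_star. Qed.

Lemma tends_bound (V : normedZmodType R[i]) (u : nat -> V) l (M : R) :
  tends u l -> (forall n, rn (u n) <= M) -> rn l <= M.
Proof.
move=> h hM; apply/ler_addgt0Pr => e /h[N /(_ N (leqnn N)) h1].
have := rnD (u N) (l - u N); rewrite addrCA subrr addr0 [rn (l - _)]rnB.
by have := hM N; lra.
Qed.

Section SquareRoot.
Variable x : A.
Hypotheses (sx : star x = x) (nx : rn x <= 1).

(** The square root of 1 - x is 1 - z for the limit z of the iteration
    z <- (x + z^2)/2. The iterates are polynomials in x with nonnegative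
    coefficients, so their increments are dominated by those of the scalar
    iteration tit at x = 1, which increases and is bounded by 1. *)
Fixpoint zit n : A := if n is m.+1 then (2^-1)%:C *: (x + zit m ** zit m) else 0.

Fixpoint tit n : R := if n is m.+1 then (1 + tit m ^+ 2) / 2 else 0.

Lemma tit_bounds n : 0 <= tit n <= 1.
Proof.
elim: n => [|n /andP[h1 h2]] /=; first by rewrite lexx ler01.
have h3 : 0 <= tit n ^+ 2 <= 1.
  by rewrite sqr_ge0 expr2 mulr_ile1.
by move: h3; set w := tit n ^+ 2 => /andP[h3 h4]; apply/andP; split; lra.
Qed.

Lemma tit_mono n : tit n <= tit n.+1.
Proof. by have := sqr_ge0 (1 - tit n); rewrite /= expr2 (expr2 (tit n)); lra. Qed.

Lemma zit_comm b n : b ** x = x ** b -> b ** zit n = zit n ** b.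
Proof.
move=> h; elim: n => [|n IH] /=; first by rewrite mulx0 mul0x.
rewrite mulZr mulZl mulDr mulDl h; congr (_ *: (_ + _)).
by rewrite mulA IH -mulA IH mulA.
Qed.

Lemma zit_star n : star (zit n) = zit n.
Proof.
elim: n => [|n IH] /=; first by rewrite star0.
by rewrite starZR starD starM IH sx.
Qed.

Lemma zit_norm n : rn (zit n) <= tit n.
Proof.
elim: n => [|n IH] /=; first by rewrite rn0.
rewrite rnZR ger0_norm ?invr_ge0//.
have := crnD x (zit n ** zit n); have := rn_mul (zit n) (zit n).
have h : rn (zit n) * rn (zit n) <= tit n ^+ 2 by rewrite expr2 ler_pM ?rn_ge0.
by move: h nx; lra.
Qed.

Lemma zit_step n : rn (zit n.+1 - zit n) <= tit n.+1 - tit n.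
Proof.
elim: n => [|n IH].
  by have := zit_norm 1; rewrite /= !subr0.
have -> : zit n.+2 - zit n.+1 =
    (2^-1)%:C *: ((zit n.+1 - zit n) ** (zit n.+1 + zit n)).
  rewrite [zit n.+2]/= [X in _ - X]/= -scalerBr; congr (_ *: _).
  rewrite opprD addrACA subrr add0r -/(zit n.+1).
  have cm : zit n ** zit n.+1 = zit n.+1 ** zit n.
    by apply: zit_comm; exact/esym/zit_comm.
  by rewrite mulBl !mulDr cm opprD addrA addrK.
rewrite rnZR ger0_norm ?invr_ge0//.
have h1 := rn_mul (zit n.+1 - zit n) (zit n.+1 + zit n).
have h2 := crnD (zit n.+1) (zit n); have h3 := zit_norm n.+1; have h4 := zit_norm n.
have -> : tit n.+2 - tit n.+1 = 2^-1 * ((tit n.+1 - tit n) * (tit n.+1 + tit n)).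
  have E2 : tit n.+2 = (1 + tit n.+1 ^+ 2) / 2 by [].
  have E1 : tit n.+1 = (1 + tit n ^+ 2) / 2 by [].
  by rewrite E2; move: (tit n.+1) E1 => t E1; lra.
rewrite ler_wpM2l ?invr_ge0//; apply: le_trans h1 _.
rewrite ler_pM ?rn_ge0//; lra.
Qed.

(** The square root 1 - z commutes with whatever commutes with x, being a limit
    of polynomials in x; rn z <= 1 makes 1 - z positive. *)
Lemma sqrt_exists : exists z, [/\ star z = z, rn z <= 1,
  (one - z) ** (one - z) = one - x & forall b, b ** x = x ** b -> b ** z = z ** b].
Proof.
have dz n m : (n <= m)%N -> rn (zit m - zit n) <= tit m - tit n.
  move=> /subnKC <-; elim: (m - n)%N => [|k IH].
    by rewrite addn0 !subrr rn0.
  rewrite addnS; apply: le_trans (crn_tri _ (zit (n + k)) _) _.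
  by have := zit_step (n + k); lra.
have cz : cauchy_seq zit.
  have ct : cvg (tit n @[n --> \oo])%classic.
    apply: nondecreasing_is_cvgn.
      by apply/nondecreasing_seqP => n; exact: tit_mono.
    by exists 1 => _ [n _ <-]; have /andP[] := tit_bounds n.
  move=> e e0; have /cvg_ex[l /cvgrPdist_lt] := ct.
  move=> /(_ _ (divr_gt0 e0 (ltr0n _ 2)))[N _ hN].
  exists N => n m Nn Nm; wlog nm : n m Nn Nm / (n <= m)%N.
    move=> H; have [nm|/ltnW mn] := leqP n m; first exact: H.
    by rewrite crnBC; exact: H.
  rewrite crnBC; apply: le_trans (dz _ _ nm) _.
  have := hN n Nn; have := hN m Nm; rewrite /= !ltr_norml => /andP[a1 a2] /andP[b1 b2].
  lra.
have [z hz] := cauchy_tends cz; exists z.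
have zz : z = (2^-1)%:C *: (x + z ** z).
  apply: (tends_uniq (tendsS hz)); apply: tendsZ; apply: tendsD; first exact: tends_cst.
  have [M hM] := cauchy_bounded cz.
  apply: (@tends_le _ _ _ (`|M| + rn z) _ _ _ _ _ _ hz).
    by rewrite addr_ge0 ?rn_ge0.
  move=> n; rewrite (_ : _ - _ = zit n ** (zit n - z) + (zit n - z) ** z); last first.
    by rewrite mulBr mulBl addrA subrK.
  apply: le_trans (crnD _ _) _; rewrite mulrDl; apply: lerD.
    apply: le_trans (rn_mul _ _) _; rewrite ler_wpM2r ?rn_ge0//.
    exact: le_trans (hM n) (ler_norm _).
  by rewrite mulrC rn_mul.
split.
- apply: (tends_uniq (tends_star hz)); apply: eq_tends hz => n.
  by rewrite zit_star.
- apply: (tends_bound hz) => n; apply: le_trans (zit_norm n) _.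
  by have /andP[] := tit_bounds n.
- have -> : x = z + z - z ** z.
    rewrite {1 2}zz -scalerDl -rmorphD /= (_ : 2^-1 + 2^-1 = 1 :> R); last by field.
    by rewrite scale1r addrK.
  by rewrite mulBl !mulBr !mul1x mulx1 -addrA -opprD addrA.
- move=> b h; apply: (tends_uniq (tends_mull b hz)).
  by apply: eq_tends (tends_mulr b hz) => n; rewrite zit_comm.
Qed.

End SquareRoot.
End Cstar.

Lemma expr_null (R : realType) (q e : R) : 0 <= q < 1 -> 0 < e ->
  exists N, forall n, (N <= n)%N -> q ^+ n <= e.
Proof.
move=> /andP[q0 q1] e0.
have /cvgrPdist_lt/(_ _ e0)[N _ hN] : (q ^+ n @[n --> \oo] --> (0 : R))%classic.
  by apply: cvg_expr; rewrite ger0_norm.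
exists N => n /hN /=; rewrite sub0r normrN ger0_norm ?exprn_ge0//.
exact: ltW.
Qed.

Lemma geometric_tends (R : realType) (V : completeNormedModType R[i])
    (u : nat -> V) (q r : R) : 0 <= q -> q < 1 -> 0 <= r ->
  (forall n, rn (u n.+1 - u n) <= q ^+ n * r) -> exists l, tends u l.
Proof.
move=> q0 q1 r0 st; have qp : 0 < 1 - q by lra.
have dist n m : (n <= m)%N -> (1 - q) * rn (u m - u n) <= (q ^+ n - q ^+ m) * r.
  move=> /subnKC <-; elim: (m - n)%N => [|k IH].
    by rewrite addn0 !subrr rn0 mulr0 mul0r.
  rewrite addnS; have h1 := crn_tri (u (n + k).+1) (u (n + k)%N) (u n).
  have h2 := ler_wpM2l (ltW qp) h1; have h3 := ler_wpM2l (ltW qp) (st (n + k)%N).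
  move: IH h2 h3; rewrite exprS.
  by move: (rn _) (rn _) (rn _) (q ^+ _) (q ^+ n) => a b c x y; lra.
apply: cauchy_tends => e e0; have rp : 0 < r + 1 by lra.
have [|N hN] := expr_null _ (divr_gt0 (mulr_gt0 qp e0) rp) (q := q); first by rewrite q0.
exists N => n m Nn Nm; wlog nm : n m Nn Nm / (n <= m)%N.
  by move=> H; have [nm|/ltnW mn] := leqP n m; [exact: H|rewrite crnBC; exact: H].
rewrite crnBC -(ler_pM2l qp); apply: le_trans (dist _ _ nm) _.
have := hN n Nn; rewrite ler_pdivlMr// => h; apply: le_trans h.
have qm : 0 <= q ^+ m by rewrite exprn_ge0.
have qn : 0 <= q ^+ n by rewrite exprn_ge0.
by rewrite mulrDr mulrBl mulr1; have := mulr_ge0 qm r0; lra.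
Qed.

Section Neumann.
Context {R : realType} (A : cstar_algebra R).
Implicit Types a b c d x y z : A.
Local Notation "a ** b" := (mul a b) (at level 40, left associativity).

Lemma neumann x (q : R) : q < 1 -> rn x <= q -> exists y, inverses (one - x) y.
Proof.
move=> q1 xq; have q0 : 0 <= q by apply: le_trans xq; exact: rn_ge0.
pose fix y n := if n is m.+1 then one + x ** y m else (0 : A).
have cm n : x ** y n = y n ** x.
  elim: n => [|n IH] /=; first by rewrite mulx0 mul0x.
  by rewrite mulDr mulDl mulx1 mul1x -mulA IH mulA.
have st n : rn (y n.+1 - y n) <= q ^+ n * 1.
  rewrite mulr1.
  elim: n => [|n IH]; first by rewrite /= mulx0 addr0 subr0 expr0 rn_one.
  rewrite (_ : y n.+2 - y n.+1 = x ** (y n.+1 - y n)); last first.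
    by rewrite mulBr /= opprD addrACA subrr add0r.
  by apply: le_trans (rn_mul _ _) _; rewrite exprS ler_pM ?rn_ge0.
have [l hl] := geometric_tends q0 q1 ler01 st; exists l.
have e1 : l = one + x ** l.
  apply: (tends_uniq (tendsS hl)); apply: tendsD; first exact: tends_cst.
  exact: tends_mull.
have e2 : x ** l = l ** x.
  apply: (tends_uniq (tends_mull x hl)).
  by apply: eq_tends (tends_mulr x hl) => n; rewrite cm.
split.
  by rewrite mulBl mul1x {1}e1 addrK.
by rewrite mulBr mulx1 -e2 {1}e1 addrK.
Qed.

(** With g = (1 - d^2)/(1 + d^2) and h = 2d/(1 + d^2), the element g + ih is
    the Cayley transform of d, hence unitary; so g has norm at most 1 and
    k = |h| is the square root of 1 - g^2 = h^2. Since h has the sign of d,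
    k plays the role of an absolute value of d. *)
Definition abs_calculus d c h k :=
  [/\ inverses (one + d ** d) c, star c = c, h = 2 *: (d ** c),
      k ** k = h ** h /\ h ** k = k ** h &
      exists z, [/\ k = one - z, star z = z, rn z <= 1 &
        forall b, b ** d = d ** b -> b ** z = z ** b]].

Lemma abs_calculus_exists d : star d = d -> rn d <= 2^-1 ->
  exists c h k, abs_calculus d c h k.
Proof.
move=> sd nd; have sdd : star (d ** d) = d ** d by rewrite starM sd.
have [||c] := @neumann (- (d ** d)) (4^-1); first by lra.
  rewrite rnN; apply: le_trans (rn_mul _ _) _.
  have := rn_ge0 d; nra.
rewrite opprK => cI; have [ec ce] := cI.
have sc : star c = c.
  by apply: (inverses_star cI); rewrite starD star1 sdd.
have dc : d ** c = c ** d.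
  by apply: (inverses_comm cI); rewrite mulDr mulDl mulx1 mul1x mulA.
pose h := (2 : R[i]) *: (d ** c); pose g := (2 : R[i]) *: c - one.
have conj2 : Num.conj (2 : R[i]) = 2 by rewrite rmorph_nat.
have sg : star g = g by rewrite /g starB starZ sc star1 conj2.
have sh : star h = h by rewrite /h starZ conj2 starM sd sc dc.
have comm b : b ** d = d ** b -> b ** c = c ** b.
  by move=> bd; apply: (inverses_comm cI);
     rewrite mulDr mulDl mulx1 mul1x mulA bd -mulA bd mulA.
have commg b : b ** d = d ** b -> b ** g = g ** b.
  by move=> bd; rewrite /g mulBr mulBl mulZr mulZl (comm b bd) mulx1 mul1x.
have commh b : b ** d = d ** b -> b ** h = h ** b.
  move=> bd; rewrite /h mulZr mulZl; congr (_ *: _).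
  by rewrite mulA bd -!mulA (comm b bd).
have gd : g ** d = d ** g by apply/esym/commg.
have gh : g ** h = h ** g by exact: commh.
(* g + i h is unitary, so that its real part g is a contraction *)
have unit2 : g ** g + h ** h = one.
  have dd : (d ** c) ** (d ** c) = c - c ** c.
    have h1 : c ** c + d ** d ** c ** c = c.
      by rewrite -[RHS]mul1x -ec !mulDl mul1x.
    by rewrite -{3}h1 addrC addKr -mulA [c ** (d ** c)]mulA -dc !mulA.
  rewrite /h mulZl mulZr scalerA dd /g mulBl !mulBr mulZl mulZr scalerA mul1x mulx1 mul1x.
  have -> : (2 * 2 : R[i]) *: (c - c ** c) = 2 *: c + 2 *: c - (2 * 2 : R[i]) *: (c ** c).
    by rewrite scalerBr -scalerDl -natrD -natrM.
  rewrite opprB; move: (_ *: c) (_ *: (c ** c)) => a q.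
  by rewrite (AC (2*2*(2*1)) (3*(1*7)*(2*5)*(4*6))) /= subrr !addNr !addr0.
have hE : h = (2 : R[i]) *: (d ** c) by [].
clearbody g h.
have ng : rn g <= 1.
  have [i [conji ii]] := imaginary_unit (R := R).
  pose u := g + i *: h; have uu : star u ** u = one.
    rewrite /u starD starZ sg sh mulDl !mulDr !mulZr !mulZl scalerA gh conji.
    by rewrite mulrN ii opprK scale1r !scaleNr addrA addrK unit2.
  have nu : rn u <= 1.
    have := rn_starM u; rewrite uu => hu; have := rn_one A; rewrite hu.
    by rewrite expr_le1// rn_ge0.
  have -> : g = (2^-1)%:C *: (u + star u).
    rewrite /u starD starZ sg sh conji scaleNr addrACA subrr addr0.
    rewrite -[g in g + g]scale1r -scalerDl scalerA.
    rewrite (_ : _ * _ = 1) ?scale1r// -(rmorph1 (real_complex R)) -rmorphD -rmorphM /=.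
    by congr (_%:C); field.
  rewrite rnZR ger0_norm ?invr_ge0//; have := crnD u (star u); rewrite rn_star; lra.
have [||z [sz nz zz zc]] := @sqrt_exists _ A (g ** g).
- by rewrite starM sg.
- exact: le_trans (rn_mul _ _) (mulr_ile1 (rn_ge0 _) (rn_ge0 _) ng ng).
have zd b : b ** d = d ** b -> b ** z = z ** b.
  by move=> bd; apply: zc; rewrite mulA (commg b bd) -mulA (commg b bd) mulA.
exists c, h, (one - z); split=> //.
  split; first by rewrite zz -unit2 addrC addKr.
  rewrite mulBr mulBl mulx1 mul1x; congr (_ - _); apply: zd.
  exact/esym/commh.
by exists z.
Qed.

End Neumann.

(** * Representations on semi-inner product spaces *)

Definition hsip (R : realType) (H : hilbert_space R) : semi_inner H.
Proof.
refine (@SemiInner R H (@dot R H) (@dotD R H) (@dotZ R H) (@dotC R H) _).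
by move=> x; rewrite dot_norm exprn_ge0.
Defined.

Lemma sn_hsip (R : realType) (H : hilbert_space R) (x : H) : sn (hsip H) x = rn x.
Proof.
rewrite /sn /sq /= dot_norm rnE -rmorphXn /= sqrtr_sqr ger0_norm//.
exact: rn_ge0.
Qed.

Section Dot.
Context {R : realType} {H : hilbert_space R}.
Implicit Types x y z : H.

Lemma dotr0 x : dot x 0 = 0. Proof. exact: (sip0 (hsip H)). Qed.

Lemma dot0r x : dot 0 x = 0. Proof. exact: (sip0l (hsip H)). Qed.

Lemma dotN x y : dot x (- y) = - dot x y.
Proof. exact: (sipN (hsip H)). Qed.

Lemma dotB x y z : dot x (y - z) = dot x y - dot x z.
Proof. exact: (sipB (hsip H)). Qed.

Lemma dotDl x y z : dot (x + y) z = dot x z + dot y z.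
Proof. exact: (sipDl (hsip H)). Qed.

Lemma dotBl x y z : dot (x - y) z = dot x z - dot y z.
Proof. exact: (sipBl (hsip H)). Qed.

Lemma dotZl (c : R[i]) x y : dot (c *: x) y = Num.conj c * dot x y.
Proof. exact: (sipZl (hsip H)). Qed.

Lemma dot_sumr x (I : Type) (s : seq I) (P : pred I) (F : I -> H) :
  dot x (\sum_(i <- s | P i) F i) = \sum_(i <- s | P i) dot x (F i).
Proof. exact: (sip_sum (hsip H)). Qed.

Lemma dot_rn x : dot x x = (rn x ^+ 2)%:C.
Proof. by rewrite dot_norm rnE rmorphXn. Qed.

Lemma dot_schwarz x y : rn (dot x y) <= rn x * rn y.
Proof. by have := cauchy_schwarz_sn (hsip H) x y; rewrite !sn_hsip. Qed.

End Dot.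

Lemma dot_eq0 (R : realType) (H : hilbert_space R) (x : H) :
  (forall y, dot y x = 0) -> x = 0.
Proof.
move=> /(_ x) h; apply/rn_eq0; rewrite -sn_hsip /sn /sq /= h /=.
exact: sqrtr0.
Qed.

Lemma dot_inj (R : realType) (H : hilbert_space R) (x x' : H) :
  (forall y, dot y x = dot y x') -> x = x'.
Proof.
move=> h; apply/eqP; rewrite -subr_eq0; apply/eqP/dot_eq0 => y.
by rewrite dotB h subrr.
Qed.

(** A *-representation on a semi-inner product space. The identities for products
    and the unit are required up to null vectors only, which is all that GNS
    and induced representations provide before completion. *)
Record prerep (R : realType) (A : cstar_algebra R) := Prerep {
  pr_space :> lmodType R[i] ;
  pr_sip : semi_inner pr_space ;
  pr : A -> pr_space -> pr_space ;
  prDl : forall a b x, pr (a + b) x = pr a x + pr b x ;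
  prZl : forall (z : R[i]) a x, pr (z *: a) x = z *: pr a x ;
  prDr : forall a x y, pr a (x + y) = pr a x + pr a y ;
  prZr : forall a (z : R[i]) x, pr a (z *: x) = z *: pr a x ;
  prM : forall a b x y, pr_sip y (pr (mul a b) x) = pr_sip y (pr a (pr b x)) ;
  pr1 : forall x y, pr_sip y (pr one x) = pr_sip y x ;
  pr_star : forall a x y, pr_sip (pr a x) y = pr_sip x (pr (star a) y)
}.

Section Prerep.
Context {R : realType} (A : cstar_algebra R).
Local Notation "a ** b" := (mul a b) (at level 40, left associativity).

Section Bound.
Variable P : prerep A.
Local Notation B := (pr_sip P).
Implicit Types (a : A) (x y : P).

Lemma prBl a b x : pr (a - b) x = pr a x - pr b x.
Proof. by rewrite prDl -(scaleN1r b) prZl scaleN1r. Qed.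

Lemma prBr a x y : pr a (x - y) = pr a x - pr a y.
Proof. by rewrite prDr -(scaleN1r y) prZr scaleN1r. Qed.

Lemma sq_pr a x : (sq B (pr a x))%:C = B x (pr (star a ** a) x).
Proof. by rewrite -sqE pr_star prM. Qed.

(** The operator |a|^2 - a^* a is a multiple of a square, hence positive in every
    representation. *)
Lemma prerep_contractive a x : sn B (pr a x) <= rn a * sn B x.
Proof.
rewrite -(@ler_pXn2r _ 2)// ?nnegrE ?mulr_ge0 ?sn_ge0 ?rn_ge0//.
rewrite exprMn !sn2.
have [a0|a0] := eqVneq (rn a) 0.
  have aE : a = 0 by apply: rn_eq0.
  have -> : pr a x = 0 by have := prZl 0 a x; rewrite aE !scale0r.
  by rewrite /sq sip0 mulr_ge0 ?sqr_ge0// sq_ge0.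
have ap : 0 < rn a by rewrite lt_def a0 rn_ge0.
pose r := (rn a ^+ 2)^-1; have rp : 0 < r by rewrite invr_gt0 exprn_gt0.
pose X := r%:C *: (star a ** a).
have [||z [sz _ zz _]] := @sqrt_exists _ A X.
- by rewrite starZR starM starK.
- by rewrite rnZR rn_starM gtr0_norm// mulVf// gt_eqF// exprn_gt0.
have := sq_ge0 B (pr (one - z) x); rewrite -ler0c sq_pr starB star1 sz zz.
rewrite prBl sipB pr1 prZl sipZ -sq_pr sqE -rmorphM -rmorphB /= ler0c subr_ge0.
by rewrite mulrC -ler_pdivlMr// /r invrK mulrC.
Qed.

End Bound.

Definition rep_prerep (pi : representation A) : prerep A.
Proof.
refine (@Prerep R A pi (hsip pi) (@rep R A pi) _ _ _ _ _ _ _).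
- exact: repDl.
- exact: repZl.
- exact: repDr.
- exact: repZr.
- by move=> a b x y; rewrite repM.
- by move=> x y; rewrite rep1.
- by move=> a x y; exact: rep_star.
Defined.

Lemma rep_contractive (pi : representation A) a (x : pi) :
  rn (rep a x) <= rn a * rn x.
Proof.
by have := prerep_contractive (P := rep_prerep pi) a x; rewrite /= !sn_hsip.
Qed.

Section Rep.
Variable pi : representation A.
Local Notation B := (hsip pi).
Implicit Types (a b : A) (x y v : pi).

Lemma repBl a b x : rep (a - b) x = rep a x - rep b x.
Proof. exact: (@prBl (rep_prerep pi)). Qed.

Lemma repBr a x y : rep a (x - y) = rep a x - rep a y.
Proof. exact: (@prBr (rep_prerep pi)). Qed.

Lemma rep0l x : rep (0 : A) x = 0.
Proof. by have := repZl 0 (0 : A) x; rewrite !scale0r. Qed.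

Lemma rep0r a : rep a (0 : pi) = 0.
Proof. by have := repZr a 0 (0 : pi); rewrite !scale0r. Qed.

Lemma repNl a x : rep (- a) x = - rep a x.
Proof. by rewrite -(scaleN1r a) repZl scaleN1r. Qed.

Lemma rep_suml (I : Type) (s : seq I) (P : pred I) (F : I -> A) x :
  rep (\sum_(i <- s | P i) F i) x = \sum_(i <- s | P i) rep (F i) x.
Proof.
by elim/big_rec2 : _ => [|i y1 y2 _ <-]; rewrite ?rep0l ?repDl.
Qed.

Lemma rep_sumr (I : Type) (s : seq I) (P : pred I) (F : I -> pi) a :
  rep a (\sum_(i <- s | P i) F i) = \sum_(i <- s | P i) rep a (F i).
Proof.
by elim/big_rec2 : _ => [|i y1 y2 _ <-]; rewrite ?rep0r ?repDr.
Qed.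

Definition quad a v : R := complex.Re (dot v (rep a v)).

Lemma quadB a b v : quad (a - b) v = quad a v - quad b v.
Proof. by rewrite /quad repBl dotB ReB. Qed.

Lemma quadZ (r : R) a v : quad (r%:C *: a) v = r * quad a v.
Proof. by rewrite /quad repZl dotZ ReRM. Qed.

Lemma quad1 v : quad one v = rn v ^+ 2.
Proof. by rewrite /quad rep1 -sn_hsip sn2. Qed.

Lemma quad_starM a v : quad (star a ** a) v = rn (rep a v) ^+ 2.
Proof. by rewrite /quad repM -{1}(starK a) -rep_star starK -sn_hsip sn2. Qed.

Lemma quadE a v : star a = a -> dot v (rep a v) = (quad a v)%:C.
Proof.
move=> sa; rewrite /quad; set z := dot v _.
have : Num.conj z = z by rewrite /z -dotC rep_star sa.
case: z => p q; rewrite conjE /= => -[/eqP].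
by rewrite -subr_eq0 -opprD oppr_eq0 -mulr2n mulrn_eq0 /= => /eqP ->.
Qed.

Lemma quad_le a v : star a = a -> `|quad a v| <= rn a * rn v ^+ 2.
Proof.
move=> sa; apply: le_trans (rn_Re _) _.
apply: le_trans (dot_schwarz _ _) _; rewrite mulrC expr2 mulrA ler_wpM2r ?rn_ge0//.
exact: rep_contractive.
Qed.

(** Cauchy-Schwarz for the semi-inner product <x, a y>. *)
Lemma quad_null a v : star a = a -> (forall w, 0 <= quad a w) ->
  quad a v = 0 -> rep a v = 0.
Proof.
move=> sa pa av.
have h1 x y z : dot x (rep a (y + z)) = dot x (rep a y) + dot x (rep a z).
  by rewrite repDr dotD.
have h2 (c : R[i]) x y : dot x (rep a (c *: y)) = c * dot x (rep a y).
  by rewrite repZr dotZ.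
have h3 x y : dot y (rep a x) = Num.conj (dot x (rep a y)).
  by rewrite -dotC rep_star sa.
have h4 x : 0 <= dot x (rep a x) by rewrite quadE// ler0c.
pose Ba := SemiInner h1 h2 h3 h4.
apply: dot_eq0; apply: (@sn_eq0P _ _ Ba).
by rewrite /sn /sq /= -/(quad a v) av sqrtr0.
Qed.

Section Abs.
Variables d c h k : A.
Hypotheses (sd : star d = d) (dchk : abs_calculus d c h k).

Lemma abs_star : [/\ star h = h, star k = k & c ** d = d ** c].
Proof.
have [cI sc hE [_ _] [z [-> sz _ _]]] := dchk.
have cd : d ** c = c ** d.
  by apply: (inverses_comm cI); rewrite mulDr mulDl mulx1 mul1x mulA.
split; last by [].
  by rewrite hE starZ rmorph_nat starM sd sc cd.
by rewrite starB star1 sz.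
Qed.

Lemma abs_k_ge0 v : 0 <= quad k v.
Proof.
have [cI sc hE _ [z [-> sz nz _]]] := dchk.
rewrite quadB quad1 subr_ge0; apply: le_trans (ler_norm _) _.
apply: le_trans (quad_le _ sz) _.
by rewrite ler_piMl ?sqr_ge0.
Qed.

Lemma quad_hd v : 2 * quad d v = quad h v + quad h (rep d v).
Proof.
have [[ec ce] sc hE _ _] := dchk; have [_ _ cd] := abs_star.
have -> : 2 * quad d v = quad (h ** (one + d ** d)) v.
  rewrite hE mulZl -(mulA d c) ce mulx1 -quadZ; congr (quad (_ *: _) v).
  by rewrite -(rmorph_nat (real_complex R)).
have hd : h ** d = d ** h by rewrite hE mulZl mulZr -mulA cd.
rewrite mulDr mulx1 /quad repDl dotD ReD; congr (_ + complex.Re _).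
by rewrite mulA hd -mulA !repM rep_star sd.
Qed.

(** h = 2 c d with c the inverse of 1 + d^2: evaluating h at (1 + d^2) w gives
    the values of d at w and at d w. *)
Lemma abs_h_sign (s : R) : (forall v, 0 <= s * quad d v) ->
  forall v, 0 <= s * quad h v.
Proof.
move=> pd v; have [[ec ce] sc hE _ _] := dchk; have [sh _ cd] := abs_star.
pose w := rep c v; have -> : v = rep (one + d ** d) w by rewrite -repM ec rep1.
have hd : h ** d = d ** h by rewrite hE mulZl mulZr -mulA cd.
have -> : s * quad h (rep (one + d ** d) w) = 2 * (s * quad d w + s * quad d (rep d w)).
  rewrite -mulrDr mulrCA; congr (_ * _).
  rewrite /quad -repM.
  have -> : h ** (one + d ** d) = 2%:C *: d.
    rewrite hE mulZl -(mulA d c) ce mulx1; congr (_ *: _).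
    by rewrite -(rmorph_nat (real_complex R)).
  rewrite repZl dotZ ReRM; congr (_ * _).
  rewrite repDl rep1 dotDl ReD; congr (_ + complex.Re _).
  by rewrite repM rep_star sd.
by rewrite mulr_ge0 ?addr_ge0.
Qed.

(** Where d has the constant sign s, both k and s h are positive and have the same
    square; a positive square root is unique. *)
Lemma abs_of_sign (s : R) : s ^+ 2 = 1 -> (forall v, 0 <= s * quad d v) ->
  forall v, rep k v = s%:C *: rep h v.
Proof.
move=> s1 pd v; have [_ _ hE [kk hk] _] := dchk; have [sh sk _] := abs_star.
pose H := s%:C *: h; have sH : star H = H by rewrite starZR sh.
have pH w : 0 <= quad H w by rewrite quadZ; exact: abs_h_sign.
have HH : H ** H = h ** h.
  by rewrite mulZl mulZr scalerA -rmorphM -expr2 s1 rmorph1 scale1r.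
have HK : H ** k = k ** H by rewrite mulZl mulZr hk.
pose u := rep (k - H) v.
have u0 : rep (k + H) u = 0.
  by rewrite -repM mulDl !mulBr kk HH HK addrA subrK subrr rep0l.
have q0 : quad k u + quad H u = 0.
  by rewrite /quad -ReD -dotD -repDl u0 dotr0.
have pk := abs_k_ge0 u; have ph := pH u.
have ku : rep k u = 0 by apply: quad_null => //; [exact: abs_k_ge0|lra].
have hu : rep H u = 0 by apply: quad_null => //; lra.
have : u = 0.
  apply/rn_eq0/eqP; rewrite -sqrf_eq0 -sn_hsip sn2 /sq /= {1}/u rep_star.
  by rewrite starB sk sH repBl ku hu subr0 dotr0.
by rewrite /u repBl repZl => /eqP; rewrite subr_eq0 => /eqP.
Qed.

End Abs.
End Rep.
End Prerep.

(** * Hull-kernel open sets from positivity *)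

Section Sequential.
Context {R : realType} {V : completeNormedModType R[i]}.

Lemma closed_sequential (K : set V) :
  (forall u l, (forall n, K (u n)) -> tends u l -> K l) -> closed K.
Proof.
move=> h l cl.
have ex n : exists x, K x /\ rn (x - l) <= invS n.
  have e1 : 0 < (invS n)%:C :> R[i] by rewrite ltcR invS_gt0.
  have [x [Kx /ball_rn xl]] := cl _ (nbhsx_ballx l _ e1).
  by exists x; split=> //; rewrite crnBC ltW.
have [u hu] := choice ex; apply: (h u l) => [n|e /invS_null[N hN]].
  by have [] := hu n.
by exists N => n Nn; have [_ h1] := hu n; apply: le_trans h1 (hN _ Nn).
Qed.

Lemma closed_tends (K : set V) u l :
  closed K -> (forall n, K (u n)) -> tends u l -> K l.
Proof.
move=> cK Ku ul; apply: cK => W /nbhs_ballP[e e0 We].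
have eE := ge0_RRe (ltW e0); have ep : 0 < complex.Re e by rewrite -ltcR -eE.
have [N hN] := ul _ (divr_gt0 ep (ltr0n _ 2)).
exists (u N); split=> //; apply: We; rewrite eE; apply/ball_rn.
rewrite crnBC; apply: le_lt_trans (hN N (leqnn N)) _.
by rewrite ltr_pdivrMr//; lra.
Qed.

End Sequential.

Section HullKernel.
Context {R : realType} (A : cstar_algebra R).
Local Notation "a ** b" := (mul a b) (at level 40, left associativity).
Implicit Types (s t : irrep A) (U : irrep A -> Prop) (a b d : A).

Lemma rep_tends (pi : representation A) a (u : nat -> pi) l :
  tends u l -> tends (fun n => rep a (u n)) (rep a l).
Proof.
move=> h; apply: (tends_le (rn_ge0 a) _ h) => n.
by rewrite -repBr; exact: rep_contractive.
Qed.

Lemma hk_open_nonker a : hk_open (fun s => ~ rep_ker s a).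
Proof. by move=> t h; move=> nk; apply: nk; apply: h => s /contrapT. Qed.

Lemma hk_openP U s : hk_open U -> U s ->
  exists a, (forall r, ~ U r -> rep_ker r a) /\ ~ rep_ker s a.
Proof.
move=> oU Us; apply: contrapT => h; apply: (oU s) => //.
by move=> a ha; apply: contrapT => nk; apply: h; exists a.
Qed.

(** The kernel of an irreducible representation is prime: the vectors killed by
    all a x form a closed invariant subspace. *)
Lemma hk_openI U U' : hk_open U -> hk_open U' -> hk_open (fun s => U s /\ U' s).
Proof.
move=> oU oU' t ht [Ut Ut'].
have [a [aU at_]] := hk_openP oU Ut; have [b [bU bt]] := hk_openP oU' Ut'.
pose K : set t := fun w => forall x, rep (a ** x) w = 0.
have [v bv] : exists v : t, rep b v != 0.
  apply: contrapT => h; apply: bt => v; apply/eqP/negPn/negP => bv.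
  by apply: h; exists v.
have Kb : K (rep b v).
  move=> x; rewrite -repM; apply: ht => r nU.
  have [Ur|nUr] := pselect (U r); last by move=> w; rewrite !repM aU.
  have nU'r : ~ U' r by move=> U'r; apply: nU.
  by move=> w; rewrite repM bU// rep0r.
have [_ /(_ K)[]] := irrepP t.
- apply: closed_sequential => u l Ku ul x.
  apply: (tends_uniq (rep_tends (a ** x) ul)).
  by apply: eq_tends (@tends_cst _ _ 0) => n; rewrite Ku.
- by move=> x; rewrite rep0r.
- by move=> z x y Kx Ky w; rewrite repDr repZr Kx Ky scaler0 addr0.
- by move=> c x Kx w; rewrite -repM -mulA Kx.
- move=> KE; have : K (rep b v) by [].
  by rewrite KE => bv0; move: bv; rewrite bv0 eqxx.
- move=> KE; apply: at_ => w; have : K w by rewrite KE.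
  by move=> /(_ one); rewrite mulx1.
Qed.

Lemma hk_open_ext U U' : (forall s, U s <-> U' s) -> hk_open U -> hk_open U'.
Proof.
by move=> h; rewrite (_ : U = U')//; apply/funext => s; apply/propext.
Qed.

(** Scaling brings any self-adjoint element into the ball where the absolute
    value is constructed. *)
Lemma abs_calculus_scaled d : star d = d -> exists (l : R) c h k,
  [/\ 0 < l, star (l%:C *: d) = l%:C *: d & abs_calculus (l%:C *: d) c h k].
Proof.
move=> sd; pose l := (2 * (rn d + 1))^-1.
have rd := rn_ge0 d; have rp : 0 < rn d + 1 by lra.
have l0 : 0 < l by rewrite invr_gt0 mulr_gt0.
have sl : star (l%:C *: d) = l%:C *: d by rewrite starZR sd.
have [|c [h [k H]]] := @abs_calculus_exists _ A _ sl.
  rewrite rnZR gtr0_norm// /l invfM -mulrA ler_piMr ?invr_ge0//.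
  by rewrite mulrC ler_pdivrMr//; lra.
by exists l, c, h, k.
Qed.

(** |d| + d vanishes in a representation exactly when d is negative there, so
    the complement of the set is the hull of one element. *)
Lemma hk_open_quad d : star d = d ->
  hk_open (fun s => exists v : s, 0 < quad d v).
Proof.
move=> /abs_calculus_scaled[l [c [h [k [l0 sl H]]]]].
apply: (@hk_open_ext (fun s => ~ rep_ker s (k + h)) _ _ (@hk_open_nonker _)) => s; split.
- move=> nk; apply: contrapT => np; apply: nk.
  have np' (v : s) : 0 <= -1 * quad (l%:C *: d) v.
    rewrite quadZ mulN1r oppr_ge0 mulr_ge0_le0 ?(ltW l0)// leNgt.
    by apply/negP => p; apply: np; exists v.
  move=> v; rewrite repDl (abs_of_sign sl H _ np') ?sqrrN ?expr1n//.
  by rewrite rmorphN rmorph1 scaleN1r addNr.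
- move=> [v pv] nk; have := quad_hd sl H v.
  have hk (w : s) : quad h w <= 0.
    have := abs_k_ge0 H w; have : quad (k + h) w = 0 by rewrite /quad nk dotr0.
    by rewrite /quad repDl dotD ReD; lra.
  have := hk v; have := hk (rep (l%:C *: d) v); rewrite quadZ.
  have : 0 < l * quad d v by rewrite mulr_gt0.
  lra.
Qed.

(** For g >= e the value |d| + e' at d = g - e coincides with a multiple of g,
    while |d| + e' is invertible in A whatever the sign of d; this inverts g
    wherever it is bounded below by e. *)
Lemma bounded_below_inverse g (e : R) : star g = g -> 0 < e ->
  exists v : A, forall pi : representation A,
    (forall x : pi, e * rn x ^+ 2 <= quad g x) ->
    forall x : pi, rep (g ** v) x = x.
Proof.
move=> sg e0; pose d := g - e%:C *: one.
have sd : star d = d by rewrite starB starZR star1 sg.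
have [l [c [h [k [l0 sl H]]]]] := abs_calculus_scaled sd.
pose D := l%:C *: d; rewrite -/D in sl H.
pose e1 := l * e; have e1p : 0 < e1 by rewrite mulr_gt0.
have [[ec ce] sc hE _ [z [kE _ nz _]]] := H.
pose e2 := 2 * e1 / (1 + e1 ^+ 2).
have den : 0 < 1 + e1 ^+ 2 by rewrite ltr_pwDl// sqr_ge0.
have e2p : 0 < e2 by rewrite divr_gt0// mulr_gt0.
have [w kw] : exists w, (k + e2%:C *: one) ** w = one.
  pose r := (1 + e2)^-1; have rp : 0 < r by rewrite invr_gt0; lra.
  have [||y [y1 _]] := @neumann _ A (r%:C *: z) r.
  - by rewrite invf_lt1//; lra.
  - by rewrite rnZR gtr0_norm// ler_piMr// ltW.
  exists (r%:C *: y); rewrite mulZr -mulZl -[RHS]y1; congr (_ ** _).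
  rewrite kE scalerDr scalerBr scalerA -rmorphM addrAC -scalerDl -rmorphD /=.
  rewrite (_ : r + r * e2 = 1) ?rmorph1 ?scale1r//.
  by rewrite -{1}[r]mulr1 -mulrDr mulVf//; apply/lt0r_neq0; lra.
exists ((l * e2)%:C *: ((D + e1^-1%:C *: one) ** c ** w)) => pi pg x.
have pd (y : pi) : 0 <= 1 * quad D y.
  rewrite mul1r quadZ mulr_ge0 ?(ltW l0)// quadB quadZ quad1 subr_ge0.
  exact: pg.
have kh (y : pi) : rep k y = rep h y.
  by rewrite (abs_of_sign sl H _ pd) ?expr1n// rmorph1 scale1r.
have gD : l%:C *: g = D + e1%:C *: one.
  by rewrite /D /d scalerBr scalerA -rmorphM -/e1 subrK.
(* h + e2 is a multiple of g = (D + e1) / l, since 1 + D^2 times h + e2 is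
   e2 (D + e1)(D + 1/e1); and h = k where D >= 0 *)
clearbody D; have key : g ** ((l * e2)%:C *: ((D + e1^-1%:C *: one) ** c)) = h + e2%:C *: one.
  rewrite mulZr rmorphM /= mulrC -scalerA -mulZl gD mulA.
  have -> : (D + e1%:C *: one) ** (D + (e1^-1)%:C *: one) =
      (one + D ** D) + (e1 + e1^-1)%:C *: D.
    rewrite mulDl !mulDr !mulZr !mulZl !mulx1 !mul1x scalerA -rmorphM.
    rewrite ?mulfV ?mulVf ?gt_eqF// rmorph1 scale1r rmorphD scalerDl.
    by rewrite (AC (2*2) ((4*1)*(3*2))).
  rewrite mulDl ec mulZl scalerDr addrC; congr (_ + _).
  rewrite scalerA -rmorphM hE; congr (_ *: _).
  rewrite -(rmorph_nat (real_complex R)); congr (_%:C).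
  by rewrite /e2; field; rewrite !gt_eqF//.
rewrite -[X in rep (g ** X)]mulZl mulA key repM repDl -kh -repDl -repM kw.
by rewrite rep1.
Qed.

End HullKernel.

(** * Extremal states on an ordered vector space *)

Section ExtremalState.
Context {R : realType} {V : lmodType R[i]}.
Implicit Types (x y q : V) (Q : set V) (f g : V -> R).

Definition cone Q :=
  (forall x y, Q x -> Q y -> Q (x + y)) /\
  (forall (r : R) x, 0 <= r -> Q x -> Q (r%:C *: x)).

Definition real_linear f :=
  (forall x y, f (x + y) = f x + f y) /\
  (forall (r : R) x, f (r%:C *: x) = r * f x).

Lemma real_linearN f x : real_linear f -> f (- x) = - f x.
Proof. by move=> [_ fZ]; have := fZ (-1) x; rewrite rmorphN rmorph1 scaleN1r mulN1r. Qed.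

Definition positive_functional Q f :=
  real_linear f /\ forall x, Q x -> 0 <= f x.
Variables (Q : set V) (e : V).
Hypotheses (cQ : cone Q) (Qe : Q e) (QNe : ~ Q (- e))
  (unitQ : forall x, exists M : R, Q (M%:C *: e - x)).

(** Enlarging the cone shrinks its set of states. The cones Q' considered are
    those whose states form a face of the states of Q, so that the single state
    of a maximal one is an extreme point. *)
Definition facial Q' :=
  [/\ cone Q', (forall x, Q x -> Q' x), ~ Q' (- e) &
    forall f g, positive_functional Q f -> positive_functional Q g ->
      (forall x, Q' x -> 0 <= f x + g x) -> forall x, Q' x -> 0 <= f x].

Lemma facial_refl : facial Q.
Proof. by split=> // f g [_ pf]. Qed.

Lemma facial_maximal : exists2 Q', facial Q' &
  forall Q'', facial Q'' -> (forall x, Q' x -> Q'' x) -> forall x, Q'' x -> Q' x.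
Proof.
have [|M [PM maxM]] := @Zorn_bigcup V (fun X => X = set0 \/ facial X).
  move=> F FP tF.
  have [[X0 [FX0 X00]]|nF] := pselect (exists X, F X /\ X <> set0); last first.
    left; rewrite -subset0 => x [X FX Xx]; apply: nF; exists X; split=> // X0.
    by rewrite X0 in Xx.
  have fX0 : facial X0 by have [] := FP _ FX0.
  have fac X x : F X -> X x -> facial X.
    by move=> FX Xx; have [X0'|//] := FP _ FX; move: Xx; rewrite X0'.
  right; split.
  - split.
      move=> x y [X FX Xx] [Y FY Yy]; have [XY|YX] := tF _ _ FX FY.
        by exists Y => //; have [[+ _] _ _ _] := fac _ _ FY Yy; apply=> //; exact: XY.
      by exists X => //; have [[+ _] _ _ _] := fac _ _ FX Xx; apply=> //; exact: YX.
    move=> r x r0 [X FX Xx]; exists X => //.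
    by have [[_ +] _ _ _] := fac _ _ FX Xx; apply.
  - by move=> x Qx; exists X0 => //; have [_ + _ _] := fX0; apply.
  - by move=> [X FX Xe]; have [_ _ + _] := fac _ _ FX Xe; apply.
  - move=> f g pf pg fg x [X FX Xx]; have [_ _ _ h] := fac _ _ FX Xx.
    by apply: (h f g) => // y Xy; apply: fg; exists X.
have fM : facial M.
  case: PM => // M0; exfalso; apply: (maxM Q); last by right; exact: facial_refl.
  rewrite M0; split; first by move=> x [].
  by move=> h; have := h _ Qe.
exists M => // Q'' fQ'' MQ'' x Q''x; apply: contrapT => nMx.
apply: (maxM Q''); last by right.
by split=> // h; apply: nMx; apply: h.
Qed.

Lemma cone_scale_sub Q' (r s : R) : cone Q' -> Q' e -> s <= r ->
  forall x, Q' (s%:C *: e + x) -> Q' (r%:C *: e + x).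
Proof.
move=> [cD cZ] Q'e sr x h.
have -> : r%:C *: e + x = (r - s)%:C *: e + (s%:C *: e + x).
  by rewrite addrA -scalerDl -rmorphD subrK.
by apply: (cD) h; apply: cZ => //; rewrite subr_ge0.
Qed.

(** For a maximal facial cone Q' let p x be the infimum of the M with M e >= x.
    Maximality gives x >= (p x) e as well, so p x is the value at x of every state
    of Q', and p is linear. *)
Lemma extremal_state : exists phi,
  [/\ positive_functional Q phi, phi e = 1 &
    forall f g, positive_functional Q f -> positive_functional Q g ->
      (forall x, f x + g x = phi x) -> forall x, f x = f e * phi x].
Proof.
have [Q' fQ' maxQ'] := facial_maximal.
have [[cD cZ] QQ' nQ' face] := fQ'.
have Q'0 : Q' 0.
  by rewrite -(scale0r e) -(rmorph0 (real_complex R)); apply: cZ => //; exact: QQ'.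
have neg (r : R) : Q' (r%:C *: e) -> 0 <= r.
  move=> h; rewrite leNgt; apply/negP => r0; apply: nQ'.
  have -> : - e = (- r^-1)%:C *: (r%:C *: e).
    by rewrite scalerA -rmorphM mulNr mulVf ?lt_eqF// rmorphN rmorph1 scaleN1r.
  by apply: cZ => //; rewrite oppr_ge0 invr_le0 ltW.
pose S x : set R := fun M => Q' (M%:C *: e - x).
have infS x : has_inf (S x).
  split; first by have [M hM] := unitQ x; exists M; apply: QQ'.
  have [N hN] := unitQ (- x); rewrite opprK in hN; exists (- N) => M SM.
  rewrite -subr_ge0 opprK; apply: neg; rewrite rmorphD scalerDl.
  by have := cD _ _ SM (QQ' _ hN); rewrite addrCA -addrA addNr addr0 addrC.
pose p x := inf (S x).
have lep x M : S x M -> p x <= M by move=> h; apply: (inf_lbound (infS x).2).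
have gep x (d : R) : 0 < d -> Q' ((p x + d)%:C *: e - x).
  move=> d0; have [M SM Mp] := inf_adherent d0 (infS x).
  by apply: (cone_scale_sub (s := M)) SM; rewrite ?ltW//; exact: QQ'.
(* The cone generated by Q' and x - (p x) e is facial: functionals that
   are nonnegative on Q' are nonpositive at x - (p x) e, so two of them whose
   sum is nonnegative there both vanish there. *)
have top x : Q' (x - (p x)%:C *: e).
  pose Q'' : set V := fun y => exists q (l : R), [/\ Q' q, 0 <= l &
    y = q + l%:C *: (x - (p x)%:C *: e)].
  suff fQ'' : facial Q''.
    apply: (maxQ' _ fQ'').
      by move=> y Q'y; exists y, 0; split=> //; rewrite scale0r addr0.
    by exists 0, 1; split=> //; rewrite add0r scale1r.
  split.
  - split.
      move=> y y' [q [l [Qq l0 ->]]] [q' [l' [Qq' l'0 ->]]].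
      exists (q + q'), (l + l'); split; [exact: cD|exact: addr_ge0|].
      by rewrite addrACA -scalerDl -rmorphD.
    move=> r y r0 [q [l [Qq l0 ->]]]; exists (r%:C *: q), (r * l); split.
    + exact: cZ.
    + exact: mulr_ge0.
    + by rewrite scalerDr [in LHS]scalerA -rmorphM.
  - by move=> y Qy; exists y, 0; split; [exact: QQ'|by []|rewrite scale0r addr0].
  - move=> [q [l [Qq l0 qE]]].
    have [l00|lp] := eqVneq l 0.
      by apply: nQ'; rewrite qE l00 scale0r addr0.
    have lgt : 0 < l by rewrite lt_def lp.
    have : S x (p x - l^-1).
      rewrite /S /=; have -> : (p x - l^-1)%:C *: e - x = l^-1%:C *: q.
        have -> : q = - e - l%:C *: (x - (p x)%:C *: e) by rewrite qE addrK.
        rewrite scalerBr scalerA -rmorphM mulVf// rmorph1 scale1r scalerN opprB.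
        by rewrite rmorphB scalerBl [RHS]addrCA addrA.
      by apply: cZ => //; rewrite invr_ge0 ltW.
    by move=> /lep; have := lgt; rewrite -invr_gt0; lra.
  - move=> f g pf pg fg y [q [l [Qq l0 ->]]].
    have fg' z : Q' z -> 0 <= f z + g z.
      by move=> Qz; apply: fg; exists z, 0; split=> //; rewrite scale0r addr0.
    have pf' := face _ _ pf pg fg'.
    have pg' : forall z, Q' z -> 0 <= g z.
      by apply: (face _ _ pg pf) => z /fg'; rewrite addrC.
    have bound h : positive_functional Q h -> (forall z, Q' z -> 0 <= h z) ->
        h x <= p x * h e.
      move=> [[hD hZ] hp] hQ'; have he := hp _ Qe.
      apply/ler_addgt0Pr => d d0.
      have hep : 0 < h e + 1 by lra.
      have := hQ' _ (gep x _ (divr_gt0 d0 hep)); rewrite hD real_linearN// hZ mulrDl subr_ge0.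
      have : d / (h e + 1) * h e <= d.
        rewrite -mulrA ler_piMr ?(ltW d0)// mulrC ler_pdivrMr// mul1r; lra.
      lra.
    have [[fD fZ] _] := pf; have [[gD gZ] _] := pg.
    have b1 := bound _ pf pf'; have b2 := bound _ pg pg'.
    have : 0 <= f (x - (p x)%:C *: e) + g (x - (p x)%:C *: e).
      by apply: fg; exists 0, 1; split=> //; rewrite add0r scale1r.
    move=> b3; have {b3} : f (x - (p x)%:C *: e) = 0.
      by move: b3; rewrite !fD !gD !real_linearN// !fZ !gZ; lra.
    by move=> E; rewrite fD fZ E mulr0 addr0; exact: pf'.
(* T x m : the states of Q' all take the value m at x *)
pose T x m := forall d : R, 0 < d -> Q' (x - m%:C *: e + d%:C *: e) /\
   Q' (m%:C *: e - x + d%:C *: e).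
have Qpos (d : R) : 0 < d -> Q' (d%:C *: e) by move=> d0; apply: cZ (ltW d0) (QQ' _ Qe).
have Tp x : T x (p x).
  move=> d d0; split; first by apply: cD (top x) (Qpos _ d0).
  by have := gep x _ d0; rewrite rmorphD scalerDl addrAC.
have Tval f x m : real_linear f -> (forall z, Q' z -> 0 <= f z) -> T x m ->
    f x = m * f e.
  move=> lf fp Tx; have [fD fZ] := lf.
  have fe := fp _ (QQ' _ Qe); have fep : 0 < f e + 1 by lra.
  have key (d : R) : 0 < d -> `|f x - m * f e| <= d.
    move=> d0; have [/fp + /fp] := Tx _ (divr_gt0 d0 fep).
    rewrite !fD !real_linearN// !fZ.
    have : d / (f e + 1) * f e <= d.
      rewrite -mulrA ler_piMr ?(ltW d0)// mulrC ler_pdivrMr// mul1r; lra.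
    by rewrite ler_norml; lra.
  apply/eqP; rewrite -subr_eq0 -normr_eq0 eq_le normr_ge0 andbT.
  by apply/ler_addgt0Pr => d /key; rewrite add0r.
have Tuniq x m m' : T x m -> T x m' -> m = m'.
  move=> h h'; apply/eqP; rewrite -subr_eq0 -normr_eq0 eq_le normr_ge0 andbT.
  apply/ler_addgt0Pr => d d0; rewrite add0r.
  have [h1 h2] := h _ (divr_gt0 d0 (ltr0n _ 2)).
  have [h3 h4] := h' _ (divr_gt0 d0 (ltr0n _ 2)).
  have cmp (a b : R) : Q' (x - a%:C *: e + (d / 2)%:C *: e) ->
      Q' (b%:C *: e - x + (d / 2)%:C *: e) -> a - b <= d.
    move=> k1 k2; have := cD _ _ k1 k2.
    rewrite (AC ((2*1)*(2*1)) ((1*5)*((4*2)*(3*6)))) /= subrr add0r -scalerBl.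
    by rewrite -!scalerDl -rmorphB -!rmorphD => /neg; lra.
  rewrite ler_norml; have := cmp m m' h1 h4; have := cmp m' m h3 h2; lra.
have pD x y : p (x + y) = p x + p y.
  apply: (Tuniq (x + y)) => // d d0.
  have [h1 h2] := Tp x _ (divr_gt0 d0 (ltr0n _ 2)).
  have [h3 h4] := Tp y _ (divr_gt0 d0 (ltr0n _ 2)).
  have dE : d%:C *: e = (d / 2)%:C *: e + (d / 2)%:C *: e.
    by rewrite -scalerDl -rmorphD -splitr.
  split.
    have := cD _ _ h1 h3; rewrite addrACA -dE addrACA -opprD -scalerDl.
    by rewrite -rmorphD.
  have := cD _ _ h2 h4; rewrite addrACA -dE addrACA -opprD -scalerDl.
  by rewrite -rmorphD.
have p_ge0 x : Q' x -> 0 <= p x.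
  move=> Qx; apply/ler_addgt0Pr => d d0; apply: neg.
  by have := cD _ _ (gep x _ d0) Qx; rewrite subrK.
have pN x : p (- x) = - p x.
  apply: (Tuniq (- x)) => // d /(Tp x)[h1 h2].
  by rewrite rmorphN scaleNr !opprK [- x + _]addrC [- _ + x]addrC; split.
have pZ0 (r : R) x : 0 < r -> p (r%:C *: x) = r * p x.
  move=> r0; apply: (Tuniq (r%:C *: x)) => // d d0.
  have [h1 h2] := Tp x _ (divr_gt0 d0 r0).
  have dE : d%:C *: e = r%:C *: ((d / r)%:C *: e).
    by rewrite scalerA -rmorphM mulrC divfK// gt_eqF.
  rewrite dE rmorphM -scalerA -!scalerBr -!scalerDr.
  by split; apply: cZ => //; exact: ltW.
have p0 : p 0 = 0 by have := pD 0 0; rewrite addr0; lra.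
have pZ (r : R) x : p (r%:C *: x) = r * p x.
  have [r0|r0|<-] := ltgtP 0 r; first exact: pZ0.
    have := pZ0 (- r) x; rewrite oppr_gt0 rmorphN scaleNr pN => /(_ r0); lra.
  by rewrite rmorph0 scale0r p0 mul0r.
have lp : real_linear p by [].
exists p; split.
- by split=> // x /QQ'; exact: p_ge0.
- by apply: (Tuniq e) => // d d0; rewrite rmorph1 scale1r subrr add0r; split; exact: Qpos.
- move=> f g pf pg fg x; have [lf _] := pf.
  rewrite mulrC; apply: Tval => //.
  by apply: (face _ _ pf pg) => z Qz; rewrite fg; exact: p_ge0.
Qed.

End ExtremalState.

(** * Completing a prerepresentation *)

Section CompleteRep.
Context {R : realType} (A : cstar_algebra R) (P : prerep A).
Local Notation B := (pr_sip P).
Local Notation H := (completion B).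
Implicit Types (a b : A) (x y : P) (f g : H).

Lemma pr_starr a x y : B x (pr a y) = B (pr (star a) x) y.
Proof. by rewrite pr_star starK. Qed.

Lemma represents_pr a u f : represents B u (cfun f) ->
  represents B (fun n => pr a (u n)) (fun x => cfun f (pr (star a) x)).
Proof.
move=> [cu uf]; split; last first.
  by move=> x; apply: eq_tends (uf (pr (star a) x)) => n; rewrite -pr_starr.
move=> e e0; have a1 : 0 < rn a + 1 by have := rn_ge0 a; lra.
have [N hN] := cu _ (divr_gt0 e0 a1); exists N => n m Nn Nm.
rewrite -prBr; apply: le_trans (prerep_contractive _ _) _.
have := hN n m Nn Nm; rewrite ler_pdivlMr//.
by have := sn_ge0 B (u n - u m); lra.
Qed.

(** The operator of a acts on functionals through the adjoint; this is the
    extension by continuity of pr a. *)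
Definition crep a f : H :=
  @Compl _ _ B _ (represents_compl (represents_pr a (rseqP f))).

Lemma cfun_null f x y : (forall z, B z x = B z y) -> cfun f x = cfun f y.
Proof.
move=> h; apply: (tends_uniq ((rseqP f).2 x)).
apply: eq_tends ((rseqP f).2 y) => n; rewrite [LHS]sipC [RHS]sipC.
by rewrite h.
Qed.

Lemma cfunD f x y : cfun f (x + y) = (cfun f x : R[i]) + cfun f y.
Proof.
apply: (tends_uniq ((rseqP f).2 (x + y))).
by apply: eq_tends (tendsD ((rseqP f).2 x) ((rseqP f).2 y)) => n; rewrite sipDl.
Qed.

Lemma cfunZ f (c : R[i]) x : cfun f (c *: x) = Num.conj c * cfun f x.
Proof.
apply: (tends_uniq ((rseqP f).2 (c *: x))).
by apply: eq_tends (@tendsZ _ R[i]^o _ _ _ ((rseqP f).2 x)) => n; rewrite sipZl.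
Qed.

Definition complete_rep : representation A.
Proof.
refine (@Representation R A (completion_hilbert B) crep _ _ _ _ _ _ _).
- move=> a b f; apply: compl_eqP => x /=.
  by rewrite starD prDl cfunD.
- move=> z a f; apply: compl_eqP => x /=.
  by rewrite starZ prZl cfunZ conjCK.
- by move=> a f g; apply: compl_eqP.
- by move=> a z f; apply: compl_eqP.
- move=> a b f; apply: compl_eqP => x /=.
  by rewrite starM; apply: cfun_null => z; rewrite prM.
- move=> f; apply: compl_eqP => x /=; apply: cfun_null => z.
  by rewrite star1 pr1.
- move=> a f g.
  have h1 : represents B (fun n => pr a (rseq f n)) (cfun (crep a f)).
    exact: represents_pr (rseqP f).
  have h2 : represents B (fun n => pr (star a) (rseq g n)) (cfun (crep (star a) g)).
    exact: represents_pr (rseqP g).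
  apply: (tends_uniq (cdotE h1 (rseqP g))).
  by apply: eq_tends (cdotE (rseqP f) h2) => n; rewrite pr_star.
Defined.

Definition pr_in (x : P) : complete_rep := ciota B x.

Lemma rep_pr_in a x : rep a (pr_in x) = pr_in (pr a x).
Proof. by apply: compl_eqP => y /=; rewrite -pr_starr. Qed.

Lemma dot_pr_in x y : dot (pr_in x) (pr_in y) = B x y.
Proof. exact: cdot_iota. Qed.

Lemma pr_in_dense (f : complete_rep) (e : R) : 0 < e ->
  exists x, rn (f - pr_in x) <= e.
Proof. exact: ciota_dense. Qed.

End CompleteRep.

(** * Orthogonal projection *)

Section Projection.
Context {R : realType} (H : hilbert_space R) (K : set H).
Hypotheses (cK : closed K) (K0 : K 0)
  (Klin : forall (z : R[i]) x y, K x -> K y -> K (z *: x + y)).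

Lemma parallelogram (x y : H) :
  rn (x + y) ^+ 2 + rn (x - y) ^+ 2 = 2 * rn x ^+ 2 + 2 * rn y ^+ 2.
Proof.
rewrite -!sn_hsip !sn2 !sqD sqN; have -> : hsip H x (- y) = - hsip H x y.
  exact: sipN.
rewrite ReN; lra.
Qed.

(** A minimizing sequence is Cauchy by the parallelogram identity; the limit is
    the nearest point, and the variation of the distance gives orthogonality. *)
Lemma projection_exists (h : H) : exists2 p, K p & forall k, K k -> dot k (h - p) = 0.
Proof.
pose S : set R := fun r => exists2 k, K k & r = rn (h - k).
have iS : has_inf S.
  split; first by exists (rn (h - 0)), 0.
  by exists 0 => _ [k _ ->]; exact: rn_ge0.
pose d := inf S.
have led k : K k -> d <= rn (h - k).
  by move=> Kk; apply: (inf_lbound iS.2); exists k.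
have d0 : 0 <= d by apply: lb_le_inf => [|_ [k _ ->]]; [exact: iS.1|exact: rn_ge0].
have ex n : exists k, K k /\ rn (h - k) <= d + invS n.
  have [_ [k Kk ->] lt] := inf_adherent (invS_gt0 n) iS.
  by exists k; split=> //; apply: ltW.
clearbody d; have [u hu] := choice ex.
(* the midpoint of u n and u m lies in K *)
have mid n m : rn (u n - u m) ^+ 2 <= (4 * d + 2) * (invS n + invS m).
  have := parallelogram (h - u n) (h - u m).
  rewrite (_ : (h - u n) - (h - u m) = u m - u n); last first.
    by rewrite opprB addrC addrA subrK.
  have [k Kk kE] : exists2 k, K k & (h - u n) + (h - u m) = 2%:C *: (h - k).
    exists ((2^-1)%:C *: (u n) + (2^-1)%:C *: (u m)).
      apply: Klin; first by have [] := hu n.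
      by rewrite -[X in K X]addr0; apply: Klin => //; have [] := hu m.
    rewrite scalerBr scalerDr !scalerA -rmorphM mulfV ?pnatr_eq0// rmorph1 !scale1r.
    by rewrite addrACA -opprD rmorph_nat scaler_nat mulr2n.
  have [_ h1] := hu n; have [_ h2] := hu m; have h3 := led _ Kk.
  have h4 : rn (2%:C *: (h - k)) ^+ 2 = 4 * rn (h - k) ^+ 2.
    by rewrite rnZR exprMn real_normK ?num_real//; ring.
  rewrite kE h4 (crnBC (u m) (u n)); move: h1 h2 h3 (rn_ge0 (h - u n)) (rn_ge0 (h - u m)).
  have [n0 n1] := (invS_gt0 n (R := R), invS_le1 n (R := R)).
  have [m0 m1] := (invS_gt0 m (R := R), invS_le1 m (R := R)).
  move: (invS n) (invS m) n0 n1 m0 m1 => x y x0 x1 y0 y1.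
  move: (rn (h - k)) (rn (h - u n)) (rn (h - u m)) (rn (u n - u m)) => a b c e.
  move=> hb hc ha b0 c0 eq.
  have hb2 : b ^+ 2 <= (d + x) ^+ 2 by rewrite ler_pXn2r// nnegrE addr_ge0// ltW.
  have hc2 : c ^+ 2 <= (d + y) ^+ 2 by rewrite ler_pXn2r// nnegrE addr_ge0// ltW.
  have ha2 : d ^+ 2 <= a ^+ 2 by rewrite ler_pXn2r// nnegrE (le_trans d0).
  have hx : x ^+ 2 <= x by rewrite expr2 ler_piMl// ltW.
  have hy : y ^+ 2 <= y by rewrite expr2 ler_piMl// ltW.
  by move: hb2 hc2; rewrite !sqrrD; lra.
have cu : cauchy_seq u.
  move=> e e0; have c0 : 0 < 2 * (4 * d + 2) by lra.
  have [N hN] := invS_null (divr_gt0 (exprn_gt0 2 e0) c0); exists N => n m /hN n1 /hN m1.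
  rewrite -(@ler_pXn2r _ 2)// ?nnegrE ?rn_ge0 ?(ltW e0)//; apply: le_trans (mid n m) _.
  by move: n1 m1; rewrite !ler_pdivlMr//; lra.
have [p hp] := cauchy_tends cu.
have Kp : K p by apply: (closed_tends cK _ hp) => n; have [] := hu n.
have dp : rn (h - p) <= d.
  apply/ler_addgt0Pr => e e0; have e2 : 0 < e / 2 by rewrite divr_gt0.
  have [N hN] := hp _ e2; have [M hM] := invS_null e2.
  have := crn_tri h (u (maxn N M)) p; have [_] := hu (maxn N M).
  have := hN _ (leq_maxl N M); have := hM _ (leq_maxr N M); lra.
exists p => // k Kk; set q := h - p.
have key (c : R[i]) : sq (hsip H) q <= sq (hsip H) (q + c *: k).
  rewrite -!sn2 !sn_hsip ler_pXn2r ?nnegrE ?rn_ge0//; apply: le_trans dp _.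
  rewrite (_ : q + c *: k = h - ((- c) *: k + p)); first by apply: led; exact: Klin.
  by rewrite scaleNr opprD opprK /q addrA addrAC.
clearbody q; have [k0|kn0] := eqVneq (sq (hsip H) k) 0.
  have : rn k = 0 by rewrite -sn_hsip /sn k0 sqrtr0.
  by move=> /rn_eq0 ->; rewrite dot0r.
have kp : 0 < sq (hsip H) k by rewrite lt_def kn0 sq_ge0.
pose c := (sq (hsip H) k)^-1; have c0 : 0 < c by rewrite invr_gt0.
have ck : c * sq (hsip H) k = 1 by rewrite mulVf.
have := key ((- c)%:C * dot k q); rewrite sqD sqZ.
have -> : hsip H q (((- c)%:C * dot k q) *: k) = (- c * rn (dot k q) ^+ 2)%:C.
  by rewrite sipZ /= (dotC k q) -mulrA [dot k q * _]mulrC conjM_rn -rmorphM.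
rewrite rnM rn_real normrN gtr0_norm// exprMn [complex.Re _]/= => le.
apply/rn_eq0/eqP; rewrite -sqrf_eq0 eq_le sqr_ge0 andbT.
clearbody c; move: (rn _ ^+ 2) le (sqr_ge0 (rn (dot k q))) => s le s0.
have E : c ^+ 2 * s * sq (hsip H) k = c * s by rewrite expr2 mulrAC -(mulrA c) ck mulr1.
have : c * s <= 0 by move: le; rewrite E; lra.
by rewrite pmulr_rle0.
Qed.

End Projection.

(** * Existence of irreducible representations *)

Section SumsOfSquares.
Context {R : realType} (A : cstar_algebra R).
Local Notation "a ** b" := (mul a b) (at level 40, left associativity).
Implicit Types (x y z : A) (G : A -> Prop).

Inductive sos G : A -> Prop :=
| sos0 : sos G 0
| sosS y s : G y -> sos G s -> sos G (star y ** y + s).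

Lemma sosD G s t : sos G s -> sos G t -> sos G (s + t).
Proof.
move=> hs ht; elim: hs => [|y s' Gy _ IH]; first by rewrite add0r.
by rewrite -addrA; exact: sosS.
Qed.

Lemma sosZ G (r : R) s : (forall (c : R) y, G y -> G (c%:C *: y)) -> 0 <= r ->
  sos G s -> sos G (r%:C *: s).
Proof.
move=> GZ r0; elim=> [|y s' Gy _ IH]; first by rewrite scaler0; exact: sos0.
rewrite scalerDr (_ : r%:C *: _ = star ((Num.sqrt r)%:C *: y) ** ((Num.sqrt r)%:C *: y)).
  by apply: sosS => //; exact: GZ.
by rewrite starZR mulZl mulZr scalerA -rmorphM -expr2 sqr_sqrtr.
Qed.

Lemma sos1 G y : G y -> sos G (star y ** y).
Proof. by move=> Gy; rewrite -[_ ** _]addr0; exact: sosS Gy (sos0 _). Qed.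

Lemma sos_quad G s (pi : representation A) (v : pi) : sos G s -> 0 <= quad s v.
Proof.
elim=> [|y s' _ _ IH]; first by rewrite /quad rep0l dotr0.
by rewrite /quad repDl dotD ReD addr_ge0// -/(quad _ _) quad_starM sqr_ge0.
Qed.

End SumsOfSquares.

Section IrrepExistence.
Context {R : realType} (A : cstar_algebra R) (E : A -> Prop).
Local Notation "a ** b" := (mul a b) (at level 40, left associativity).
Implicit Types (x y z a b : A).

Definition left_multiple y := exists k a, E k /\ y = k ** a.
Hypothesis approx : forall n, sos left_multiple n ->
  exists (pi : representation A) (v : pi), rn v = 1 /\ quad n v <= 1.

(** A state that is nonnegative on this cone is positive, takes equal values at x
    and x^*, and vanishes at the squares of the left multiples of E. *)
Definition gns_cone : set A := fun x => exists s n,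
  [/\ sos (fun=> True) s, sos left_multiple n & x + star x + n = s].

Lemma left_multipleZ (c : R) y : left_multiple y -> left_multiple (c%:C *: y).
Proof. by move=> [k [a [Ek ->]]]; exists k, (c%:C *: a); rewrite mulZr. Qed.

Lemma gns_cone_cone : cone gns_cone.
Proof.
split.
  move=> x y [s [n [hs hn e1]]] [s' [n' [hs' hn' e2]]].
  exists (s + s'), (n + n'); split; [exact: sosD|exact: sosD|].
  by rewrite starD -e1 -e2 (AC ((2*2)*2) ((1*3*5)*(2*4*6))).
move=> r x r0 [s [n [hs hn e1]]]; exists (r%:C *: s), (r%:C *: n); split.
- exact: sosZ.
- by apply: sosZ => // c y; exact: left_multipleZ.
- by rewrite starZR -e1 !scalerDr.
Qed.

Lemma gns_cone_sq y : gns_cone (star y ** y).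
Proof.
exists (star y ** y + star y ** y), 0; split; [|exact: sos0|].
  by apply: sosD; exact: sos1.
by rewrite starM starK addr0.
Qed.

Lemma gns_cone_one : gns_cone one.
Proof. by have := gns_cone_sq one; rewrite star1 mulx1. Qed.

Lemma gns_cone_proper : ~ gns_cone (- one).
Proof.
move=> [s [n [hs hn e1]]]; have [pi [v [v1 nv]]] := approx hn.
have := sos_quad v hs; rewrite -e1 starN star1 /quad !repDl !repNl !dotD.
rewrite !ReD -/(quad n v) (_ : dot v (- _) = - 1); last first.
  by rewrite rep1 dotN dot_rn v1 expr1n.
by rewrite /=; lra.
Qed.

Lemma gns_cone_unit x : exists M : R, gns_cone (M%:C *: one - x).
Proof.
pose w := x + star x; pose r := rn w + 1.
have r0 : 0 < r by have := rn_ge0 w; rewrite /r; lra.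
have sw : star w = w by rewrite /w starD starK addrC.
have [||z [sz _ zz _]] := @sqrt_exists _ A (r^-1%:C *: w).
- by rewrite starZR sw.
- by rewrite rnZR gtr0_norm ?invr_gt0// mulrC ler_pdivrMr// mul1r /r; lra.
exists (r / 2); exists (r%:C *: (star (one - z) ** (one - z))), 0; split.
- by apply: sosZ => //; [exact: ltW|exact: sos1].
- exact: sos0.
rewrite addr0 !starB starZR !star1 sz addrACA -opprD -/w -scalerDl -rmorphD -splitr.
by rewrite zz scalerBr scalerA -rmorphM mulfV ?gt_eqF// rmorph1 scale1r.
Qed.

Lemma gns_cone_skew x : gns_cone (x - star x).
Proof.
exists 0, 0; split; [exact: sos0|exact: sos0|].
by rewrite starB starK addr0 addrA subrK subrr.
Qed.

Lemma gns_cone_null y : left_multiple y -> gns_cone (- (star y ** y)).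
Proof.
move=> Ey; exists 0, (star y ** y + star y ** y); split; [exact: sos0| |].
  by apply: sosD; exact: sos1.
by rewrite starN starM starK -opprD addNr.
Qed.

Section GNS.
Variable phi : A -> R.
Hypothesis phi_pos : positive_functional gns_cone phi.
Let phiD x y : phi (x + y) = phi x + phi y. Proof. exact: phi_pos.1.1. Qed.
Let phiZ (r : R) x : phi (r%:C *: x) = r * phi x. Proof. exact: phi_pos.1.2. Qed.
Let phiN x : phi (- x) = - phi x.
Proof. exact: real_linearN phi_pos.1. Qed.
Let phi0 : phi 0 = 0. Proof. by have := phiD 0 0; rewrite addr0; lra. Qed.

Lemma phi_star x : phi (star x) = phi x.
Proof.
have := phi_pos.2 _ (gns_cone_skew x); have := phi_pos.2 _ (gns_cone_skew (star x)).
by rewrite starK !phiD !phiN; lra.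
Qed.

Definition Phi x : R[i] := phi x +i* (- phi ('i%C *: x)).

Lemma PhiD x y : Phi (x + y) = Phi x + Phi y.
Proof.
rewrite /Phi scalerDr !phiD opprD; apply/eqP; rewrite eq_complex /= !eqxx//.
Qed.

Lemma PhiZ (c : R[i]) x : Phi (c *: x) = c * Phi x.
Proof.
have ii : 'i%C * 'i%C = -1 :> R[i] by rewrite -expr2 sqr_i.
have cE y : c *: y = (complex.Re c)%:C *: y + (complex.Im c)%:C *: ('i%C *: y).
  by rewrite scalerA -scalerDl [_ * 'i%C]mulrC -complexE.
have -> : c * Phi x = (complex.Re c +i* complex.Im c) * Phi x by case: c {cE}.
rewrite /Phi cE scalerDr !scalerA ![ 'i%C * _]mulrC -!scalerA.
rewrite [in X in _ +i* (- phi (_ + _ *: X))]scalerA ii scaleN1r.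
rewrite !phiD !phiZ phiN; apply/eqP; rewrite eq_complex /=.
by apply/andP; split; apply/eqP; ring.
Qed.

Lemma Phi_star x : Phi (star x) = Num.conj (Phi x).
Proof.
have -> : Phi (star x) = phi (star x) +i* (- phi ('i%C *: star x)) by [].
rewrite -[ 'i%C *: star x]starK starZ starK conjE.
have -> : ('i%C : R[i])^*%C = - 'i%C by apply/eqP; rewrite eq_complex /= oppr0 !eqxx.
by rewrite !phi_star scaleNr phiN.
Qed.

Lemma Phi_ge0 x : 0 <= Phi (star x ** x).
Proof.
have := Phi_star (star x ** x); rewrite starM starK => h.
have : Phi (star x ** x) \is Num.real by rewrite CrealE -h.
move/RRe_real => <-; rewrite ler0c /=; exact: phi_pos.2 _ (gns_cone_sq x).
Qed.

Definition gns_sip : semi_inner A.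
Proof.
refine (@SemiInner R A (fun x y => Phi (star x ** y)) _ _ _ Phi_ge0).
- by move=> x y z; rewrite mulDr PhiD.
- by move=> c x y; rewrite mulZr PhiZ.
- by move=> x y; rewrite -Phi_star starM starK.
Defined.

Definition gns_prerep : prerep A.
Proof.
refine (@Prerep R A A gns_sip (@mul _ A) _ _ _ _ _ _ _).
- by move=> a b x; rewrite mulDl.
- by move=> z a x; rewrite mulZl.
- by move=> a x y; rewrite mulDr.
- by move=> a z x; rewrite mulZr.
- by move=> a b x y; rewrite mulA.
- by move=> x y; rewrite mul1x.
- by move=> a x y; rewrite /= starM mulA.
Defined.

Definition gns : representation A := complete_rep gns_prerep.

Definition gns_vec : gns := pr_in (one : gns_prerep).

Lemma gns_cyclic a : rep a gns_vec = pr_in (a : gns_prerep).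
Proof. by rewrite /gns_vec rep_pr_in /= mulx1. Qed.

Lemma gns_state a : dot gns_vec (rep a gns_vec) = Phi a.
Proof. by rewrite gns_cyclic dot_pr_in /= star1 mul1x. Qed.

Lemma gns_dense (f : gns) (e : R) : 0 < e -> exists a, rn (f - rep a gns_vec) <= e.
Proof.
move=> /(pr_in_dense (P := gns_prerep) f)[a ha]; exists a.
by rewrite gns_cyclic.
Qed.

Lemma gns_eq0 (f : gns) : (forall a, dot (rep a gns_vec) f = 0) -> f = 0.
Proof.
move=> h; apply: rn_le0 => e e0; have [a ha] := gns_dense f e0.
have ff : dot f f = dot (f - rep a gns_vec) f by rewrite dotBl h subr0.
have := dot_schwarz (f - rep a gns_vec) f; rewrite -ff dot_rn rn_real.
rewrite ger0_norm ?sqr_ge0// expr2 => le.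
have [->|f0] := eqVneq (rn f) 0; first exact: ltW.
have fp : 0 < rn f by rewrite lt_def f0 rn_ge0.
by apply: le_trans ha; rewrite -(ler_pM2r fp).
Qed.

Lemma gns_kills k : E k -> rep_ker gns k.
Proof.
move=> Ek f; apply: dot_eq0 => y; apply/rn_eq0/eqP; rewrite eq_le rn_ge0 andbT.
apply/ler_addgt0Pr => e e0; rewrite add0r.
have c0 : 0 < rn k * rn y + 1.
  by have := mulr_ge0 (rn_ge0 k) (rn_ge0 y); lra.
have [a ha] := gns_dense f (divr_gt0 e0 c0).
have ka : rep k (rep a gns_vec) = 0.
  have Eka : left_multiple (k ** a) by exists k, a.
  apply/rn_eq0/eqP; rewrite -sqrf_eq0 -repM -quad_starM /quad gns_state /= eq_le.
  have := phi_pos.2 _ (gns_cone_null Eka); have := phi_pos.2 _ (gns_cone_sq (k ** a)).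
  by rewrite phiN oppr_ge0 => -> ->.
have -> : rep k f = rep k (f - rep a gns_vec) by rewrite repBr ka subr0.
apply: le_trans (dot_schwarz _ _) _.
have h1 := rep_contractive k (f - rep a gns_vec).
have h2 : rn y * rn (rep k (f - rep a gns_vec)) <= rn y * (rn k * (e / (rn k * rn y + 1))).
  rewrite ler_wpM2l ?rn_ge0//; apply: le_trans h1 _.
  by rewrite ler_wpM2l ?rn_ge0.
apply: le_trans h2 _; rewrite mulrA [rn y * _]mulrC mulrCA ler_piMr ?(ltW e0)//.
by rewrite ler_pdivrMr// mul1r; lra.
Qed.
Hypothesis phi1 : phi one = 1.
Hypothesis phi_extr : forall f g, positive_functional gns_cone f ->
  positive_functional gns_cone g -> (forall x, f x + g x = phi x) ->
  forall x, f x = f one * phi x.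

(** An invariant subspace splits the cyclic vector as p + q, hence the state into
    two positive parts. By extremality the parts are proportional, so p is a
    multiple of the cyclic vector. *)
Lemma gns_irreducible : irreducible gns.
Proof.
have h0 : gns_vec != 0.
  apply/eqP => h0; have := gns_state one; rewrite h0 dot0r => /(congr1 (@complex.Re R)).
  by rewrite /= phi1 => /esym/eqP; rewrite oner_eq0.
split; first by exists gns_vec.
move=> K cK K0 Klin Kinv.
have [p Kp orth] := projection_exists cK K0 Klin gns_vec.
pose q := gns_vec - p; have hpq : gns_vec = p + q by rewrite /q addrC subrK.
have kq k : K k -> dot k q = 0 by exact: orth.
clearbody q; have qk k : K k -> dot q k = 0 by move=> Kk; rewrite dotC kq// conjC0.
have rlin (v : gns) : real_linear (fun a => quad a v).
  split=> [a b|r a]; first by rewrite /quad repDl dotD ReD.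
  exact: quadZ.
(* the cross terms vanish, p lying in K and q being orthogonal to K *)
have fg a : quad a p + quad a q = phi a.
  have -> : phi a = quad a (p + q) by rewrite -hpq /quad gns_state.
  rewrite /quad repDr dotD !dotDl.
  have -> : dot q (rep a p) = 0 by apply/qk/Kinv.
  have -> : dot p (rep a q) = 0.
    by rewrite -{1}[a]starK -rep_star; apply/kq/Kinv.
  by rewrite addr0 add0r ReD.
have posq (v w : gns) : (forall a, quad a v + quad a w = phi a) ->
    positive_functional gns_cone (fun a => quad a v).
  move=> vw; split=> // x [s [n [hs hn e1]]].
  have n0 : quad n v = 0.
    have nphi : phi n = 0.
      elim: hn => [|y t Ey _ IH]; first exact: phi0.
      rewrite phiD IH addr0; apply/eqP; rewrite eq_le.
      have := phi_pos.2 _ (gns_cone_null Ey); have := phi_pos.2 _ (gns_cone_sq y).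
      by rewrite phiN oppr_ge0 => -> ->.
    have := vw n; have := sos_quad v hn; have := sos_quad w hn; rewrite nphi; lra.
  have := sos_quad v hs; rewrite -e1 /quad !repDl !dotD !ReD -/(quad _ _).
  have -> : complex.Re (dot v (rep (star x) v)) = quad x v.
    by rewrite -rep_star (dotC v) ReconjE.
  by rewrite [complex.Re (dot v (rep n v))]n0 -/(quad x v); lra.
have pf : positive_functional gns_cone (fun a => quad a p) := posq p q fg.
have pg : positive_functional gns_cone (fun a => quad a q).
  by apply: (posq q p) => a; rewrite addrC.
have ext := phi_extr pf pg fg.
pose l := quad one p.
have pE : p = l%:C *: gns_vec.
  apply/eqP; rewrite -subr_eq0; apply/eqP/gns_eq0 => a.
  have key b : dot gns_vec (rep b p) = l%:C * Phi b.
    have re c : complex.Re (dot gns_vec (rep c p)) = l * phi c.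
      rewrite -ext /quad {1}hpq dotDl ReD (_ : dot q _ = 0) ?addr0//.
      by apply/qk/Kinv.
    apply/eqP; rewrite eq_complex re /=; apply/andP; split; apply/eqP; first ring.
    have := re ('i%C *: b); rewrite repZl dotZ mulrC ReiNIm => h.
    by rewrite mul0r addr0 mulrN -h opprK.
  rewrite dotB dotZ rep_star key rep_star gns_state; exact: subrr.
have [l0|ln0] := eqVneq l 0.
  left; have p0 : p = 0 by rewrite pE l0 scale0r.
  apply/seteqP; split=> [k Kk|k ->//] /=; apply: gns_eq0 => a.
  rewrite rep_star dotC; have := kq _ (Kinv (star a) _ Kk).
  by rewrite hpq p0 add0r => ->; rewrite conjC0.
right; have Kh : K gns_vec.
  rewrite (_ : gns_vec = (l^-1)%:C *: p + 0); first exact: Klin.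
  by rewrite addr0 pE scalerA -rmorphM mulVf// rmorph1 scale1r.
apply/seteqP; split=> // f _.
have [u hu] := choice (fun n => gns_dense f (invS_gt0 n)).
apply: (closed_tends (u := fun n => rep (u n) gns_vec) cK) => [n|e /invS_null[N hN]].
  exact: Kinv.
by exists N => n /hN; apply: le_trans; rewrite crnBC.
Qed.

End GNS.

(** The hypothesis approx keeps - one out of gns_cone, so there are states
    vanishing on the squares of the left multiples of E. They form a face of the
    state space, whose extreme points therefore have irreducible GNS
    representations; these kill E. *)
Lemma irrep_killing : exists t : irrep A, forall k, E k -> rep_ker t k.
Proof.
have [phi [pphi phi1 ext]] := extremal_state gns_cone_cone gns_cone_one
  gns_cone_proper gns_cone_unit.
exists (Irrep (gns_irreducible pphi phi1 ext)) => k Ek.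
exact: gns_kills.
Qed.

End IrrepExistence.

(** * Finite orthonormal frames and traces *)

Section Frames.
Context {R : realType} {V : lmodType R[i]} (B : semi_inner V).
Implicit Types (u v w z : V) (f : seq V).

Definition expands f v := forall z, B z v = \sum_(u <- f) B u v * B z u.

(** An orthonormal basis of V modulo the null vectors of B; orthogonality
    follows from Parseval's identity for the unit vectors of the family. *)
Definition pframe f := (forall u, u \in f -> B u u = 1) /\ forall v, expands f v.

Lemma expandsD f (c : R[i]) v w : expands f v -> expands f w -> expands f (c *: v + w).
Proof.
move=> hv hw z; rewrite sipD sipZ hv hw mulr_sumr -big_split /=.
by apply: eq_bigr => u _; rewrite sipD sipZ mulrDl mulrA.
Qed.

(** The new family f is included in the list so that the induction may use the
    orthonormality of f, which is what expands f u says for u in f. *)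
Lemma gram_schmidt (ws : seq V) : exists f, (forall u, u \in f -> B u u = 1) /\
  (forall w, w \in ws ++ f -> expands f w).
Proof.
elim: ws => [|w ws [f [f1 fe]]]; first by exists [::].
pose w' := w - \sum_(u <- f) B u w *: u.
have perp u : u \in f -> B u w' = 0.
  move=> uf; rewrite sipB sip_sum sipC (fe u); last by rewrite mem_cat uf orbT.
  rewrite rmorph_sum /=; apply/eqP; rewrite subr_eq0; apply/eqP/eq_bigr => v _.
  by rewrite rmorphM /= -!sipC sipZ mulrC.
have Bzw z : B z w' = B z w - \sum_(u <- f) B u w * B z u.
  by rewrite sipB sip_sum; congr (_ - _); apply: eq_bigr => u _; rewrite sipZ.
have [w0|wn0] := eqVneq (sq B w') 0.
  exists f; split=> // v; rewrite inE => /predU1P[->|]; last exact: fe.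
  move=> z; apply/eqP; rewrite -subr_eq0 -Bzw; apply/eqP/sn_eq0P.
  by rewrite /sn w0 sqrtr0.
have wp : 0 < sq B w' by rewrite lt_def wn0 sq_ge0.
pose c : R := (sn B w')^-1; pose u0 := c%:C *: w'.
have snp : 0 < sn B w' by rewrite sqrtr_gt0.
have u01 : B u0 u0 = 1.
  rewrite /u0 sipZ sipZl conjR sqE -!rmorphM -(rmorph1 (real_complex R)) -sn2.
  by congr (_%:C); rewrite /c; field; rewrite gt_eqF.
have perp0 u : u \in f -> B u u0 = 0 by move=> uf; rewrite sipZ perp// mulr0.
have perp0' u : u \in f -> B u0 u = 0 by move=> uf; rewrite sipC perp0// conjC0.
have ext v : expands f v -> expands (u0 :: f) v.
  move=> ev z; rewrite big_cons (_ : B u0 v = 0) ?mul0r ?add0r//.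
  by rewrite ev big1_seq// => u /andP[_ /perp0' ->]; rewrite mulr0.
have eu0 : expands (u0 :: f) u0.
  move=> z; rewrite big_cons u01 mul1r big1_seq ?addr0// => u /andP[_ /perp0 ->].
  by rewrite mul0r.
exists (u0 :: f); split; first by move=> u; rewrite inE => /predU1P[->//|]; exact: f1.
move=> v; rewrite mem_cat !inE => /or3P[/predU1P[->|vw]|/eqP->//|vf].
- have -> : w = (sn B w')%:C *: u0 + \sum_(u <- f) B u w *: u.
    by rewrite /u0 scalerA -rmorphM mulfV ?gt_eqF// rmorph1 scale1r subrK.
  apply: expandsD => //; apply: ext.
  have : forall s, {subset s <= f} -> expands f (\sum_(u <- s) B u w *: u).
    elim=> [_ z|u s IH sf]; first by rewrite big_nil sip0 big1// => u _; rewrite sip0 mul0r.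
    rewrite big_cons; apply: expandsD.
      by apply: fe; rewrite mem_cat sf ?orbT// mem_head.
    by apply: IH => v' v's; apply: sf; rewrite inE v's orbT.
  exact.
- by apply/ext/fe; rewrite mem_cat vw.
- by apply/ext/fe; rewrite mem_cat vf orbT.
Qed.

Lemma pframe_exists (ws : seq V) :
  (forall v, exists c : V -> R[i], forall z, B z v = \sum_(w <- ws) c w * B z w) ->
  exists f, pframe f.
Proof.
move=> sp; have [f [f1 fe]] := gram_schmidt ws; exists f; split=> // v.
have [c hc] := sp v.
suff h : forall s, {subset s <= ws} -> expands f (\sum_(w <- s) c w *: w).
  have hv z : B z v = B z (\sum_(w <- ws) c w *: w).
    by rewrite hc sip_sum; apply: eq_bigr => u _; rewrite sipZ.
  move=> z; rewrite hv (h ws)//; apply: eq_bigr => u _.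
  by rewrite [in RHS]hv.
elim=> [_ z|u s IH sf].
  by rewrite big_nil sip0 big1// => u _; rewrite sip0 mul0r.
rewrite big_cons; apply: expandsD.
  by apply: fe; rewrite mem_cat sf ?mem_head.
by apply: IH => v' v's; apply: sf; rewrite inE v's orbT.
Qed.

Lemma pframe_size f : pframe f -> \sum_(u <- f) B u u = (size f)%:R.
Proof.
move=> [f1 _]; rewrite big_seq (eq_bigr (fun=> 1)); last by move=> u /f1.
by rewrite -big_seq big_const_seq count_predT iter_addr_0.
Qed.

(** Expand B u (T u) in the other frame and move T to its adjoint. *)
Lemma pframe_trace f f' (T S : V -> V) : pframe f -> pframe f' ->
  (forall x y, B (T x) y = B x (S y)) ->
  \sum_(u <- f) B u (T u) = \sum_(u <- f') B u (T u).
Proof.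
move=> [_ fe] [_ fe'] TS.
have TS' x y : B y (T x) = B (S y) x by rewrite sipC TS -sipC.
under eq_bigr => u _ do rewrite (fe' (T u)).
rewrite exchange_big /=; apply: eq_bigr => w _.
rewrite TS' [RHS](fe w); apply: eq_bigr => u _.
by rewrite TS' mulrC.
Qed.

End Frames.

Section Trace.
Context {R : realType} {A : cstar_algebra R}.
Implicit Types pi : representation A.
Local Notation "a ** b" := (mul a b) (at level 40, left associativity).

Definition findim pi := exists f : seq pi, pframe (hsip pi) f.

Definition rep_frame pi : seq pi := xget [::] [set f | pframe (hsip pi) f]%classic.

Definition trace pi (b : A) : R[i] := \sum_(u <- rep_frame pi) dot u (rep b u).

Definition dim pi : nat := size (rep_frame pi).

Lemma rep_frameP pi : findim pi -> pframe (hsip pi) (rep_frame pi).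
Proof. by move=> [f hf]; rewrite /rep_frame; apply: (xgetPex [::]); exists f. Qed.

Lemma traceE pi b (f : seq pi) : pframe (hsip pi) f ->
  trace pi b = \sum_(u <- f) dot u (rep b u).
Proof.
move=> hf; have hpi : findim pi by exists f.
apply: (pframe_trace (B := hsip pi) (T := @rep _ _ pi b) (S := @rep _ _ pi (star b))
  (rep_frameP hpi) hf).
by move=> x y /=; exact: rep_star.
Qed.

Lemma trace1 pi : findim pi -> trace pi one = (dim pi)%:R.
Proof.
move=> /rep_frameP hf; rewrite -(pframe_size hf); apply: eq_bigr => u _.
by rewrite rep1.
Qed.

Lemma pframe_expand pi (f : seq pi) x : pframe (hsip pi) f ->
  x = \sum_(u <- f) dot u x *: u.
Proof.
move=> [_ fe]; apply: dot_inj => y; have := fe x y; rewrite /= => ->; rewrite dot_sumr.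
by apply: eq_bigr => u _; rewrite dotZ.
Qed.

Lemma traceD pi a b : trace pi (a + b) = trace pi a + trace pi b.
Proof. by rewrite -big_split; apply: eq_bigr => u _; rewrite repDl dotD. Qed.

Lemma trace_sum pi (I : Type) (s : seq I) (F : I -> A) :
  trace pi (\sum_(i <- s) F i) = \sum_(i <- s) trace pi (F i).
Proof.
elim: s => [|i s IH].
  by rewrite !big_nil /trace big1// => u _; rewrite rep0l dotr0.
by rewrite !big_cons traceD IH.
Qed.

Lemma traceC pi a b : findim pi -> trace pi (a ** b) = trace pi (b ** a).
Proof.
move=> /rep_frameP hf; rewrite /trace.
under eq_bigr => u _ do rewrite repM [rep b u](pframe_expand _ hf) rep_sumr dot_sumr.
rewrite exchange_big /=; apply: eq_bigr => w _.
rewrite repM [in RHS](pframe_expand (rep a w) hf) rep_sumr dot_sumr.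
by apply: eq_bigr => u _; rewrite !repZr !dotZ mulrC.
Qed.

End Trace.

(** * Local triviality over a Hausdorff spectrum *)

Section LocalStructure.
Context {R : realType} (A : cstar_algebra R).
Local Notation "a ** b" := (mul a b) (at level 40, left associativity).
Implicit Types (s t : irrep A) (U : irrep A -> Prop) (a b : A).

Lemma unitarily_equivalent_ker s t a :
  unitarily_equivalent s t -> rep_ker t a -> rep_ker s a.
Proof.
move=> [f [flin fdot _ frep]] ka x.
have f0 : f 0 = 0.
  by have := flin (-1) 0 0; rewrite scaler0 addr0 scaleN1r addNr.
apply: dot_eq0 => y; rewrite -fdot frep ka; exact: dotr0.
Qed.

Definition rank_one_on U a := [/\ hk_open U, star a = a &
  forall s, U s -> exists2 x : s, rn x = 1 & forall y, rep a y = dot x y *: x].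

Lemma fell_self_adjoint U a : hk_open U ->
  (forall s, U s -> rank_one_projection (fun x : s => rep a x)) ->
  rank_one_on U (star a ** a).
Proof.
move=> oU h; split=> //; first by rewrite starM starK.
move=> s /h[x [x1 hx]]; have rx : rn x = 1 by rewrite /rn x1.
exists x => // y; apply: dot_inj => z.
rewrite repM -{1}(starK a) -rep_star starK !hx dotZ dotZl.
by rewrite -dotC dotZ dot_rn rx expr1n mulr1 mulrC.
Qed.

Definition gram a (us : seq A) : A := \sum_(u <- us) star (a ** u) ** (a ** u).

Lemma gram_star a us : star (gram a us) = gram a us.
Proof. by rewrite star_sum; apply: eq_bigr => u _; rewrite starM starK. Qed.

Section Point.
Hypothesis hH : spectrum_hausdorff A.

(** The ideal generated by a is everything near t. Otherwise the sums of squares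
    from the left ideal generated by a and by the elements that vanish near t
    take small values (bounded_below_inverse), and some irreducible t0 kills
    them. Killing a, it differs from t; killing the elements that vanish near t,
    it cannot be separated from t. *)
Lemma local_unit U a t : rank_one_on U a -> U t ->
  exists U' us v, [/\ hk_open U', U' t, (forall s, U' s -> U s) &
    forall s, U' s -> forall x : s, rep (gram a us ** v) x = x].
Proof.
move=> [oU sa ra] Ut; apply: contrapT => nLL.
(* a and the elements of A that vanish near t *)
pose E k := k = a \/ exists U', [/\ hk_open U', U' t & forall s, U' s -> rep_ker s k].
have split_sos n : sos (left_multiple E) n -> exists us U',
    [/\ hk_open U', U' t & forall s, U' s -> forall x : s, rep n x = rep (gram a us) x].
  elim=> [|y n' [k [b [Ek ->]]] _ [us [U' [oU' U't h]]]].
    by exists [::], U; split=> // s _ x; rewrite /gram big_nil.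
  case: Ek => [->|[W [oW Wt kW]]].
    exists (b :: us), U'; split=> // s Us x.
    by rewrite /gram big_cons !repDl h.
  exists us, (fun s => W s /\ U' s); split=> //; first exact: hk_openI.
  move=> s [Ws Us] x; rewrite repDl h//.
  by rewrite !repM kW// rep0r add0r.
have approx n : sos (left_multiple E) n ->
    exists (pi : representation A) (v : pi), rn v = 1 /\ quad n v <= 1.
  move=> /split_sos[us [U' [oU' U't h]]].
  have [v hv] := bounded_below_inverse (gram_star a us) ltr01.
  apply: contrapT => nv; apply: nLL.
  exists (fun s => U' s /\ U s), us, v; split=> //.
  - exact: hk_openI.
  - by move=> s [].
  - move=> s [U's Us]; apply: hv => x; rewrite mul1r.
    have [->|x0] := eqVneq x 0; first by rewrite rn0 expr0n /quad rep0r dotr0.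
    have xp : 0 < rn x.
      by rewrite lt_def rn_ge0 andbT; apply: contraNneq x0 => /rn_eq0 ->.
    rewrite leNgt; apply/negP => lt; apply: nv.
    exists s, ((rn x)^-1%:C *: x); split.
      by rewrite rnZR gtr0_norm ?invr_gt0// mulVf// gt_eqF.
    rewrite /quad repZr dotZ dotZl conjR h// mulrA -rmorphM ReRM -/(quad _ _).
    by rewrite -invfM mulrC ler_pdivrMr ?mulr_gt0// mul1r -expr2 ltW.
have [t0 kt0] := irrep_killing approx.
have nt : ~ unitarily_equivalent t t0.
  move=> st; have [x x1 hx] := ra _ Ut.
  have := unitarily_equivalent_ker st (kt0 a (or_introl erefl)) x.
  rewrite hx dot_rn x1 expr1n scale1r => x0.
  by move: x1; rewrite x0 rn0 => /eqP; rewrite eq_sym oner_eq0.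
have [W [W' [oW oW' Wt Wt0 disj]]] := hH nt.
have [c [oW'o nko]] := hk_openP oW' Wt0.
apply: nko; apply: kt0; right; exists W; split=> // s Ws.
by apply: oW'o; exact: disj.
Qed.

End Point.

Section Chart.
Variables (U : irrep A -> Prop) (a : A) (us : seq A) (v : A).
Hypotheses (ra : rank_one_on U a)
  (hg : forall s, U s -> forall x : s, rep (gram a us ** v) x = x).
Variables (s : irrep A) (xi : s).
Hypotheses (Us : U s) (xi1 : rn xi = 1) (hxi : forall y, rep a y = dot xi y *: xi).

(** Where gram a us * v acts as 1, the algebra acts by matrices in the frame
    (u^* xi)_u, and <xi, u v x> is the coefficient of x at u. *)
Lemma chart_expand (x : s) :
  x = \sum_(u <- us) dot xi (rep (u ** v) x) *: rep (star u) xi.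
Proof.
have [_ sa _] := ra.
have axi : rep a xi = xi by rewrite hxi dot_rn xi1 expr1n scale1r.
rewrite -{1}(hg Us x) repM rep_suml; apply: eq_bigr => u _.
by rewrite !starM sa !repM (hxi (rep u _)) !repZr axi.
Qed.

Lemma chart_cyclic (x : s) : exists b, x = rep b xi.
Proof.
exists (\sum_(u <- us) dot xi (rep (u ** v) x) *: star u).
by rewrite rep_suml {1}[x]chart_expand; apply: eq_bigr => u _; rewrite repZl.
Qed.

Lemma chart_findim : findim s.
Proof.
apply: (@pframe_exists _ _ (hsip s) (undup [seq rep (star u) xi | u <- us])) => x.
pose c w := \sum_(u <- us | rep (star u) xi == w) dot xi (rep (u ** v) x).
exists c => z /=; rewrite {1}[x]chart_expand dot_sumr.
under [RHS]eq_bigr => w _ do rewrite /c mulr_suml.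
rewrite (exchange_big_dep xpredT)//= ; apply: eq_big_seq => u uus.
rewrite dotZ -big_filter (_ : [seq w <- _ | _] = [:: rep (star u) xi]).
  by rewrite big_seq1.
rewrite (@eq_filter _ _ (pred1 (rep (star u) xi))); last first.
  by move=> w; rewrite /= eq_sym.
apply: filter_pred1_uniq; first exact: undup_uniq.
by rewrite mem_undup; exact: (map_f (fun u => rep (star u) xi)).
Qed.

(** The corner a A a acts by scalars on the range of a. This sum of corner
    elements is the trace, in the frame of chart_expand, as an element of A. *)
Definition chart_trace b := \sum_(u <- us) a ** (u ** v ** b ** star u) ** a.

Lemma chart_traceE b (y : s) : rep (chart_trace b) y = trace s b *: rep a y.
Proof.
have fs := rep_frameP chart_findim.
have axi : rep a xi = xi by rewrite hxi dot_rn xi1 expr1n scale1r.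
have term c (z : s) : rep (a ** c ** a) z = dot xi (rep c xi) *: rep a z.
  by rewrite !repM (hxi z) !repZr (hxi (rep c xi)) scalerA mulrC -scalerA.
rewrite rep_suml (eq_bigr _ (fun u _ => term _ _)) -scaler_suml; congr (_ *: _).
rewrite /trace; under [RHS]eq_bigr => w _ do
  rewrite [X in dot w X]chart_expand dot_sumr.
rewrite exchange_big /=; apply: eq_bigr => u _.
rewrite repM [X in rep _ X](pframe_expand _ fs) rep_sumr dot_sumr.
by apply: eq_bigr => w _; rewrite repZr !dotZ mulrC -!repM.
Qed.

End Chart.
End LocalStructure.

Section ConnectedSpectrum.
Context {R : realType} (A : cstar_algebra R) (hct : continuous_trace A).
Local Notation "a ** b" := (mul a b) (at level 40, left associativity).
Implicit Types (s t : irrep A) (U : irrep A -> Prop) (a b : A).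

Lemma local_chart t : exists U a us v, [/\ rank_one_on U a, U t &
  forall s, U s -> forall x : s, rep (gram a us ** v) x = x].
Proof.
have [hH fell] := hct; have [U [a [oU Ut h]]] := fell t.
have ra := fell_self_adjoint oU h.
have [U' [us [v [oU' U't sub hg]]]] := local_unit hH ra Ut.
exists U', (star a ** a), us, v; split=> //; split=> //; first by case: ra.
by move=> s /sub; case: ra => _ _; apply.
Qed.

Lemma irrep_findim t : findim t.
Proof.
have [U [a [us [v [ra Ut hg]]]]] := local_chart t.
have [_ _ /(_ _ Ut)[xi xi1 hxi]] := ra.
exact: (chart_findim ra hg Ut xi1 hxi).
Qed.

Lemma irrep_cyclic t : exists xi : t, forall x, exists b, x = rep b xi.
Proof.
have [U [a [us [v [ra Ut hg]]]]] := local_chart t.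
have [_ _ /(_ _ Ut)[xi xi1 hxi]] := ra.
by exists xi => x; exact: (chart_cyclic ra hg Ut xi1 hxi).
Qed.

Lemma irrep_dim_gt0 t : (0 < dim t)%N.
Proof.
rewrite lt0n; apply/eqP => /size0nil f0; have [[x /eqP]] := irrepP t.
have := pframe_expand x (rep_frameP (irrep_findim t)).
by rewrite f0 big_nil.
Qed.

(** Near t the function s |-> trace s b is the scalar by which the element
    chart_trace b acts on the range of the rank one projection a; comparing it
    with multiples of a gives open conditions on s, and an integer is determined
    by being strictly between f t - 1/2 and f t + 1/2. *)
Lemma trace_locally_constant (f : irrep A -> nat) b :
  (forall s, trace s b = (f s)%:R) ->
  forall t, exists U, [/\ hk_open U, U t & forall s, U s -> f s = f t].
Proof.
move=> fb t; have [U [a [us [v [ra Ut hg]]]]] := local_chart t.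
have [oU sa ra'] := ra.
pose T := chart_trace a us v b.
(* the self-adjoint part has the same values, the traces being real *)
pose T' := (2^-1)%:C *: (T + star T).
have sT' : star T' = T' by rewrite starZR starD starK addrC.
have aquad s : U s -> exists2 x : s, quad a x = 1 & forall y : s, 0 <= quad a y.
  move=> Us; have [xi xi1 hxi] := ra' _ Us; exists xi.
    by rewrite /quad hxi dotZ !dot_rn xi1 expr1n mulr1.
  move=> y; rewrite /quad hxi dotZ (dotC xi y) mulrC conjM_rn.
  exact: sqr_ge0.
have Tquad s : U s -> forall y : s, quad T' y = (f s)%:R * quad a y.
  move=> Us y; have [xi xi1 hxi] := ra' _ Us.
  have TE : quad T y = (f s)%:R * quad a y.
    rewrite /quad (chart_traceE ra hg Us xi1 hxi) fb dotZ.
    by rewrite -(rmorph_nat (real_complex R)) ReRM.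
  rewrite quadZ {1}/quad repDl dotD ReD -/(quad T y).
  have -> : complex.Re (dot y (rep (star T) y)) = quad T y.
    by rewrite -rep_star (dotC y) ReconjE.
  by rewrite TE; field.
clearbody T'; pose d1 := T' - ((f t)%:R - 2^-1)%:C *: a.
pose d2 := ((f t)%:R + 2^-1)%:C *: a - T'.
have sd1 : star d1 = d1 by rewrite starB sT' starZR sa.
have sd2 : star d2 = d2 by rewrite starB sT' starZR sa.
exists (fun s => U s /\ ((exists y : s, 0 < quad d1 y) /\ (exists y : s, 0 < quad d2 y))).
split.
- apply: hk_openI => //; apply: hk_openI; exact: hk_open_quad.
- split=> //; have [x ax _] := aquad _ Ut.
  by split; exists x; rewrite quadB quadZ Tquad// ax; lra.
move=> s [Us [[y1 h1] [y2 h2]]]; have [_ _ pa] := aquad _ Us.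
move: h1 h2; rewrite !quadB !quadZ !Tquad// -!mulrBl => h1 h2.
have g1 : 0 < (f s)%:R - ((f t)%:R - 2^-1) :> R.
  have := pa y1; rewrite le_eqVlt => /predU1P[a0|ap].
    by move: h1; rewrite -a0 mulr0 ltxx.
  by rewrite -(pmulr_lgt0 _ ap).
have g2 : 0 < (f t)%:R + 2^-1 - (f s)%:R :> R.
  have := pa y2; rewrite le_eqVlt => /predU1P[a0|ap].
    by move: h2; rewrite -a0 mulr0 ltxx.
  by rewrite -(pmulr_lgt0 _ ap).
apply/eqP; rewrite eqn_leq -(ltnS (f s)) -(ltnS (f t)) -!(ltr_nat R) -!natr1.
by apply/andP; split; lra.
Qed.
Hypothesis hconn : spectrum_connected A.

Lemma connected_constant (f : irrep A -> nat) :
  (forall t, exists U, [/\ hk_open U, U t & forall s, U s -> f s = f t]) ->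
  forall s t, f s = f t.
Proof.
move=> lc s t; have [_ conn] := hconn.
have open (P : nat -> Prop) : hk_open (fun r => P (f r)).
  move=> r hr Pr; have [U [oU Ur fU]] := lc r.
  apply: (oU r) => // a ha; apply: hr => q nP; apply: ha => Uq.
  by apply: nP; rewrite (fU _ Uq).
have cl : hk_closed (fun r => f r = f t).
  move=> r hr; apply: contrapT => nr.
  have := @open (fun n => n <> f t) r; apply=> // a ha; apply: hr => q fq.
  by apply: ha => nq; exact: nq fq.
have [//|none] := conn _ (open (fun n => n = f t)) cl.
by have := none t.
Qed.

Lemma dim_constant s t : dim s = dim t.
Proof.
apply: (@connected_constant (fun r => dim r)); apply: (@trace_locally_constant _ one) => r.
by rewrite trace1//; exact: irrep_findim.
Qed.

End ConnectedSpectrum.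

(** * Decomposition of finite dimensional representations *)

Section Decomposition.
Context {R : realType} (A : cstar_algebra R).
Local Notation "a ** b" := (mul a b) (at level 40, left associativity).

(** Expansion in the frame is continuous and is the identity on the dense image
    of P. *)
Lemma complete_pframe (P : prerep A) f : pframe (pr_sip P) f ->
  pframe (hsip (complete_rep P)) (map (@pr_in R A P) f).
Proof.
move=> [f1 fe]; set H := complete_rep P; set e := map _ f.
have e1 u : u \in e -> dot u u = 1 by move=> /mapP[w wf ->]; rewrite dot_pr_in f1.
pose w (v : H) := \sum_(u <- e) dot u v *: u.
have wB (v v' : H) : w (v - v') = w v - w v'.
  by rewrite /w -sumrB; apply: eq_bigr => u _; rewrite dotB scalerBl.
have win x : w (pr_in x) = pr_in x.
  apply: compl_eqP => y; rewrite -!cdot_iotal.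
  have -> : cdot (ciota (pr_sip P) y) (w (pr_in x)) = dot (pr_in y) (w (pr_in x)) by [].
  have -> : cdot (ciota (pr_sip P) y) (pr_in x) = dot (pr_in y) (pr_in x) by [].
  rewrite /w dot_sumr big_map dot_pr_in (fe x y).
  by apply: eq_bigr => u _; rewrite dotZ !dot_pr_in.
have wbound v : rn (w v) <= (size e)%:R * rn v.
  apply: le_trans (rn_sum _ _ _) _; rewrite mulr_natl -iter_addr_0 -(count_predT e) -big_const_seq.
  rewrite big_seq [X in _ <= X]big_seq; apply: ler_sum => u /e1 u1.
  have un : rn u = 1.
    have := dot_rn u; rewrite u1 -(rmorph1 (real_complex R)) => /complexI/esym.
    by move=> h; have := rn_ge0 u; nra.
  by rewrite rnZ un mulr1; apply: le_trans (dot_schwarz _ _) _; rewrite un mul1r.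
have wid v : w v = v.
  apply/eqP; rewrite -subr_eq0; apply/eqP/rn_le0 => d d0.
  have c0 : 0 < (size e)%:R + 1 :> R by rewrite ltr_wpDl.
  have [x hx] := pr_in_dense v (divr_gt0 d0 c0).
  have -> : w v - v = w (v - pr_in x) - (v - pr_in x).
    by rewrite wB win opprB addrA subrK.
  apply: le_trans (crnB _ _) _; have := wbound (v - pr_in x).
  move: hx; rewrite ler_pdivlMr//; lra.
split=> // v z; rewrite (_ : hsip H z v = dot z (w v)); last by rewrite wid.
rewrite dot_sumr.
by apply: eq_bigr => u _; rewrite dotZ.
Qed.

Section Subrep.
Variables (H : representation A) (Q : H -> H).
Hypotheses (Qadj : forall x y, dot (Q x) y = dot x (Q y))
  (QQ : forall x, Q (Q x) = Q x)
  (Qlin : forall (c : R[i]) x y, Q (c *: x + y) = c *: Q x + Q y)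
  (Qrep : forall a x, Q (rep a x) = rep a (Q x)).
Let Q0 : Q 0 = 0.
Proof. by have := Qlin (-1) 0 0; rewrite scaler0 addr0 scaleN1r addNr. Qed.
Let QD x y : Q (x + y) = Q x + Q y.
Proof. by have := Qlin 1 x y; rewrite !scale1r. Qed.
Let QZ (c : R[i]) x : Q (c *: x) = c *: Q x.
Proof. by have := Qlin c x 0; rewrite Q0 !addr0. Qed.

(** The range of the projection Q is presented as all of H with the form
    <x, Q y>, whose null vectors are the kernel of Q. *)
Definition sub_sip : semi_inner H.
Proof.
refine (@SemiInner R H (fun x y => dot x (Q y)) _ _ _ _).
- by move=> x y z; rewrite QD dotD.
- by move=> c x y; rewrite QZ dotZ.
- by move=> x y; rewrite -Qadj dotC.
- by move=> x; rewrite -QQ -Qadj dot_rn ler0c sqr_ge0.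
Defined.

Definition sub_prerep : prerep A.
Proof.
refine (@Prerep R A H sub_sip (@rep R A H) _ _ _ _ _ _ _).
- exact: repDl.
- exact: repZl.
- exact: repDr.
- exact: repZr.
- by move=> a b x y; rewrite repM.
- by move=> x y; rewrite rep1.
- by move=> a x y /=; rewrite rep_star Qrep.
Defined.

Variable e : seq H.
Hypothesis he : pframe (hsip H) e.

Lemma sub_frame_exists : exists g, pframe sub_sip g.
Proof.
apply: (@pframe_exists _ _ sub_sip e) => v; exists (fun w => dot w v) => z /=.
rewrite {1}[v](pframe_expand _ he).
have -> : Q (\sum_(u <- e) dot u v *: u) = \sum_(u <- e) dot u v *: Q u.
  elim: (e) => [|u s IH]; first by rewrite !big_nil.
  by rewrite !big_cons Qlin IH.
by rewrite dot_sumr; apply: eq_bigr => u _; rewrite dotZ.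
Qed.

Lemma sub_trace g b : pframe sub_sip g ->
  \sum_(u <- g) sub_sip u (rep b u) = \sum_(u <- e) dot u (Q (rep b u)).
Proof.
move=> [_ ge].
under [RHS]eq_bigr => w _ do rewrite [dot w _](ge (rep b w) w) /=.
rewrite exchange_big /=; apply: eq_bigr => u _.
have -> : dot u (Q (rep b u)) = dot u (Q (rep b (Q u))) by rewrite -Qrep QQ.
rewrite {1}[Q u](pframe_expand _ he) rep_sumr.
have -> : Q (\sum_(w <- e) rep b (dot w (Q u) *: w)) =
    \sum_(w <- e) dot w (Q u) *: Q (rep b w).
  elim: (e) => [|w s IH]; first by rewrite !big_nil.
  by rewrite !big_cons repZr Qlin IH.
by rewrite dot_sumr; apply: eq_bigr => w _; rewrite dotZ mulrC.
Qed.

End Subrep.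

Section CommutingProjection.
Variables (H : representation A) (K : set H).
Hypotheses (cK : closed K) (K0 : K 0)
  (Klin : forall (z : R[i]) x y, K x -> K y -> K (z *: x + y))
  (Krep : forall a x, K x -> K (rep a x)).

Lemma commuting_projection : exists Q : H -> H,
  [/\ forall x y, dot (Q x) y = dot x (Q y), forall x, Q (Q x) = Q x,
      forall (c : R[i]) x y, Q (c *: x + y) = c *: Q x + Q y,
      forall a x, Q (rep a x) = rep a (Q x) &
      forall x, K x <-> Q x = x].
Proof.
have ex x : exists p, K p /\ forall k, K k -> dot k (x - p) = 0.
  by have [p] := projection_exists cK K0 Klin x; exists p.
have [Q hQ] := choice ex.
have KN x y : K x -> K y -> K (x - y).
  by move=> Kx Ky; rewrite addrC -scaleN1r; exact: Klin.
have uniq x p : K p -> (forall k, K k -> dot k (x - p) = 0) -> Q x = p.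
  move=> Kp hp; have [KQ hq] := hQ x; apply/eqP; rewrite -subr_eq0.
  have : dot (Q x - p) (Q x - p) = 0.
    have Kd : K (Q x - p) by exact: KN.
    have -> : dot (Q x - p) (Q x - p) = dot (Q x - p) (x - p) - dot (Q x - p) (x - Q x).
      by rewrite -dotB; congr (dot _ _); rewrite opprB [RHS]addrC addrA subrK.
    by rewrite hp// hq// subrr.
  rewrite dot_rn => /complexI/eqP; rewrite sqrf_eq0 => /eqP h.
  exact/eqP/rn_eq0.
have Qfix x : K x -> Q x = x by move=> Kx; apply: uniq => // k _; rewrite subrr dotr0.
have QK x : K (Q x) by have [] := hQ x.
have orth x k : K k -> dot k (x - Q x) = 0 by have [_] := hQ x; apply.
have QQ x y : dot (Q x) (Q y) = dot (Q x) y.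
  by apply/eqP; rewrite eq_sym -subr_eq0 -dotB orth.
exists Q; split=> //.
- by move=> x y; rewrite -[LHS]QQ [RHS]dotC -(QQ y x) -dotC.
- by move=> x; exact: Qfix.
- move=> c x y; apply: uniq; first exact: Klin.
  move=> k Kk; rewrite opprD addrACA -scalerBr dotD dotZ !orth// mulr0 addr0//.
- move=> a x; apply: uniq; first exact: Krep.
  by move=> k Kk; rewrite -repBr -{1}[a]starK -rep_star orth//; exact: Krep.
- by move=> x; split; [exact: Qfix|move=> <-].
Qed.

End CommutingProjection.

(** Complete reducibility, on the level of traces: a reducible completion splits
    along a projection that commutes with A, and both halves have smaller frames. *)
Lemma decompose_prerep (P : prerep A) f :
  (forall t : irrep A, findim t) -> pframe (pr_sip P) f ->
  exists ts : seq (irrep A), forall b,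
    \sum_(u <- f) pr_sip P u (pr b u) = \sum_(t <- ts) trace t b.
Proof.
move=> fd; move Dn : (size f) => n; elim/ltn_ind: n => n IH in P f Dn *.
move=> hf; set H := complete_rep P; set e := map (@pr_in R A P) f.
have he : pframe (hsip H) e := complete_pframe hf.
have sum_e b : \sum_(u <- f) pr_sip P u (pr b u) = \sum_(u <- e) dot u (rep b u).
  by rewrite big_map; apply: eq_bigr => u _; rewrite rep_pr_in dot_pr_in.
have [f0|fn0] := eqVneq f [::].
  by exists [::] => b; rewrite f0 !big_nil.
have [irr|nirr] := pselect (irreducible H).
  by exists [:: Irrep irr] => b; rewrite sum_e big_seq1 -(traceE b he).
have nz : exists x : H, x != 0.
  case: f fn0 @e {he sum_e Dn} hf => // u f _ /= [f1 _]; exists (pr_in u).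
  apply/eqP => u0; have := dot_pr_in u u; rewrite (u0 : pr_in u = 0) dotr0 f1 ?mem_head//.
  by move/eqP; rewrite eq_sym oner_eq0.
have [K [cK K0 Klin Krep [nK0 nKT]]] : exists K : set H,
  [/\ closed K, K 0, (forall (z : R[i]) x y, K x -> K y -> K (z *: x + y)),
    (forall a x, K x -> K (rep a x)) & K <> [set 0]%classic /\ K <> setT].
  apply: contrapT => h; apply: nirr; split=> // K cK K0 Klin Krep.
  apply: contrapT => /not_orP h'; apply: h; exists K; split=> //.
have [Q [Qadj QQ Qlin Qrep QK]] := commuting_projection cK K0 Klin Krep.
pose Q' x := x - Q x.
have Qadj' x y : dot (Q' x) y = dot x (Q' y) by rewrite dotBl dotB Qadj.
have Q_0 : Q 0 = 0 by apply/QK.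
have QB x y : Q (x - y) = Q x - Q y.
  by rewrite addrC -scaleN1r Qlin scaleN1r addrC.
have QQ' x : Q' (Q' x) = Q' x by rewrite /Q' QB QQ subrr subr0.
have Qlin' (c : R[i]) x y : Q' (c *: x + y) = c *: Q' x + Q' y.
  by rewrite /Q' Qlin opprD addrACA -scalerBr.
have Qrep' a x : Q' (rep a x) = rep a (Q' x) by rewrite /Q' Qrep repBr.
have [g hg] := sub_frame_exists Qadj QQ Qlin he.
have [g' hg'] := sub_frame_exists Qadj' QQ' Qlin' he.
have tg b := sub_trace Qrep he b hg.
have tg' b := sub_trace Qrep' he b hg'.
have split_e b : \sum_(u <- e) dot u (rep b u) =
    \sum_(u <- g) sub_sip Qadj QQ Qlin u (rep b u) +
    \sum_(u <- g') sub_sip Qadj' QQ' Qlin' u (rep b u).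
  have E (w x : H) : dot w x = dot w (Q x) + dot w (Q' x).
    by rewrite -dotD /Q' [Q x + _]addrC subrK.
  by rewrite tg tg' -big_split /=; apply: eq_bigr => u _; exact: E.
have size_e : size e = (size g + size g')%N.
  apply/eqP; rewrite -(eqr_nat R[i]) natrD -(pframe_size he) -(pframe_size hg).
  rewrite -(pframe_size hg'); apply/eqP; have := split_e one.
  rewrite (eq_bigr (fun u : H => dot u u)) => [->|u _]; last by rewrite rep1.
  by congr (_ + _); apply: eq_bigr => u _; rewrite rep1.
have g_gt0 : (0 < size g)%N.
  rewrite lt0n; apply/eqP => /size0nil g0; apply: nK0; apply/seteqP; split=> [x Kx|x ->//].
  apply: dot_eq0 => z; have [_ /(_ x z)] := hg; rewrite g0 big_nil /=.
  by have /QK -> := Kx.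
have g'_gt0 : (0 < size g')%N.
  rewrite lt0n; apply/eqP => /size0nil g0; apply: nKT; apply/seteqP; split=> // x _.
  apply/QK/esym/eqP; rewrite -subr_eq0; apply/eqP/dot_eq0 => z.
  by have [_ /(_ x z)] := hg'; rewrite g0 big_nil.
have size_f : size e = n by rewrite size_map Dn.
have lg : (size g < n)%N by rewrite -size_f size_e -addn1 leq_add2l.
have lg' : (size g' < n)%N by rewrite -size_f size_e -add1n leq_add2r.
have [ts hts] := IH _ lg (sub_prerep Qadj QQ Qlin Qrep) g erefl hg.
have [ts' hts'] := IH _ lg' (sub_prerep Qadj' QQ' Qlin' Qrep') g' erefl hg'.
exists (ts ++ ts') => b; rewrite sum_e split_e big_cat /=.
by congr (_ + _); [exact: hts|exact: hts'].
Qed.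

End Decomposition.

(** * Hilbert modules with finite frames *)

Section HilbertModule.
Context {R : realType} {A : cstar_algebra R}.
Local Notation "a ** b" := (mul a b) (at level 40, left associativity).

Section Inner.
Variable E : hilbert_module A.
Implicit Types x y z : E.

Lemma inner0r x : inner x 0 = 0.
Proof. by have := innerZ 0 x 0; rewrite !scale0r. Qed.

Lemma inner0l x : inner 0 x = 0.
Proof. by rewrite -inner_star inner0r star0. Qed.

Lemma innerN x y : inner x (- y) = - inner x y.
Proof. by rewrite -(scaleN1r y) innerZ scaleN1r. Qed.

Lemma innerB x y z : inner x (y - z) = inner x y - inner x z.
Proof. by rewrite innerD innerN. Qed.

Lemma innerDl x y z : inner (x + y) z = inner x z + inner y z.
Proof. by rewrite -inner_star innerD starD !inner_star. Qed.

Lemma inner_sum x (I : Type) (s : seq I) (F : I -> E) :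
  inner x (\sum_(i <- s) F i) = \sum_(i <- s) inner x (F i).
Proof.
elim: s => [|i s IH]; first by rewrite !big_nil inner0r.
by rewrite !big_cons innerD IH.
Qed.

Lemma inner_suml x (I : Type) (s : seq I) (F : I -> E) :
  inner (\sum_(i <- s) F i) x = \sum_(i <- s) inner (F i) x.
Proof.
rewrite -inner_star inner_sum star_sum; apply: eq_bigr => i _.
by rewrite inner_star.
Qed.

Lemma inner_ractl x a y : inner (ract x a) y = star a ** inner x y.
Proof. by rewrite -inner_star inner_ract starM inner_star. Qed.

Lemma inner_eq0 x : (forall y, inner y x = 0) -> x = 0.
Proof.
move=> h; apply/eqP; rewrite -normr_eq0 -sqrf_eq0 hm_norm h.
by rewrite normr0.
Qed.

Lemma inner_inj x y : (forall z, inner z x = inner z y) -> x = y.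
Proof.
move=> h; apply/eqP; rewrite -subr_eq0; apply/eqP/inner_eq0 => z.
by rewrite innerB h subrr.
Qed.

Lemma inner_injl x y : (forall z, inner x z = inner y z) -> x = y.
Proof. by move=> h; apply: inner_inj => z; rewrite -inner_star h inner_star. Qed.

Lemma ractBr x (a b : A) : ract x (a - b) = ract x a - ract x b.
Proof. by rewrite ractDr -(scaleN1r b) ractZr scaleN1r. Qed.

Lemma ractBl x y (a : A) : ract (x - y) a = ract x a - ract y a.
Proof. by rewrite ractDl -(scaleN1r y) ractZl scaleN1r. Qed.

Lemma ract0l (a : A) : ract (0 : E) a = 0.
Proof. by have := ractZl 0 (0 : E) a; rewrite !scale0r. Qed.

Lemma ract_suml a (I : Type) (s : seq I) (F : I -> E) :
  ract (\sum_(i <- s) F i) a = \sum_(i <- s) ract (F i) a.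
Proof.
elim: s => [|i s IH]; first by rewrite !big_nil ract0l.
by rewrite !big_cons ractDl IH.
Qed.

End Inner.

Section Adjointable.
Variables (E F : hilbert_module A) (T : E -> F) (S : F -> E).
Hypothesis TS : adjoint_pair T S.

Lemma adjoint_pairC : adjoint_pair S T.
Proof. by move=> x y; rewrite -inner_star -TS inner_star. Qed.

Lemma adjointD x y : T (x + y) = T x + T y.
Proof. by apply: inner_injl => z; rewrite TS !innerDl !TS. Qed.

Lemma adjoint_ract x a : T (ract x a) = ract (T x) a.
Proof. by apply: inner_injl => z; rewrite TS !inner_ractl TS. Qed.

Lemma adjoint0 : T 0 = 0.
Proof.
have := adjointD 0 0; rewrite addr0 => h; apply: (addrI (T 0)).
by rewrite -h addr0.
Qed.

Lemma adjointN x : T (- x) = - T x.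
Proof. by apply: (addrI (T x)); rewrite -adjointD !subrr adjoint0. Qed.

Lemma adjointB x y : T (x - y) = T x - T y.
Proof. by rewrite adjointD adjointN. Qed.

Lemma adjoint_sum (I : Type) (s : seq I) (G : I -> E) :
  T (\sum_(i <- s) G i) = \sum_(i <- s) T (G i).
Proof.
elim: s => [|i s IH]; first by rewrite !big_nil adjoint0.
by rewrite !big_cons adjointD IH.
Qed.

End Adjointable.

(** The coordinates of z in the generators x_i are the <y_i, z>; orthonormal
    bases are the case x = y. *)
Definition dual_frame (E : hilbert_module A) (I : finType) (x y : I -> E) :=
  forall z, z = \sum_i ract (x i) (inner (y i) z).

Lemma dual_frameC (E : hilbert_module A) (I : finType) (x y : I -> E) :
  dual_frame x y -> dual_frame y x.
Proof.
move=> h z; apply: inner_inj => w; rewrite inner_sum {1}[w]h inner_suml.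
by apply: eq_bigr => i _; rewrite inner_ractl inner_ract inner_star.
Qed.

Section Induced.
Variables (E : correspondence A) (I : finType) (x y : I -> E).
Hypothesis xy : dual_frame x y.
Variables (t : representation A) (xi : t).
Hypothesis cyc : forall v, exists b, v = rep b xi.
Local Notation V := (I -> t).
Implicit Types (v w : V) (a b : A).

(** The space I -> t models E (x) t, with v standing for sum_i x_i (x) v_i; its
    inner product is given by the Gram matrix of x. *)
Definition gram_op v : V := fun i => \sum_j rep (inner (x i) (x j)) (v j).

Definition ind_form v w : R[i] := \sum_i dot (v i) (gram_op w i).

Definition ind_act b v : V := fun i => \sum_j rep (inner (y i) (lact b (x j))) (v j).

Lemma gram_opD v w : gram_op (v + w) = gram_op v + gram_op w.
Proof.
apply/funext => i.
change (gram_op (v + w) i = gram_op v i + gram_op w i).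
rewrite /gram_op -big_split /=.
by apply: eq_bigr => j _; rewrite repDr.
Qed.

Lemma gram_opZ (c : R[i]) v : gram_op (c *: v) = c *: gram_op v.
Proof.
apply/funext => i; change (gram_op (c *: v) i = c *: gram_op v i).
rewrite /gram_op scaler_sumr.
by apply: eq_bigr => j _; rewrite repZr.
Qed.

Lemma ind_formD v w w' : ind_form v (w + w') = ind_form v w + ind_form v w'.
Proof.
rewrite /ind_form gram_opD -big_split /=.
by apply: eq_bigr => i _; rewrite dotD.
Qed.

Lemma ind_formZ (c : R[i]) v w : ind_form v (c *: w) = c * ind_form v w.
Proof.
rewrite /ind_form gram_opZ mulr_sumr.
by apply: eq_bigr => i _; rewrite dotZ.
Qed.

Lemma ind_formC v w : ind_form w v = Num.conj (ind_form v w).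
Proof.
rewrite /ind_form rmorph_sum /=.
under eq_bigr => i _ do rewrite dot_sumr.
under [RHS]eq_bigr => i _ do rewrite dot_sumr rmorph_sum /=.
rewrite exchange_big /=; apply: eq_bigr => i _; apply: eq_bigr => j _.
by rewrite -dotC rep_star inner_star.
Qed.

(** As xi is algebraically cyclic, v_i = a_i xi, and the value is that of
    <z, z> >= 0 at xi for z = sum_i x_i a_i. *)
Lemma ind_form_ge0 v : 0 <= ind_form v v.
Proof.
have [a ha] := choice (fun i => cyc (v i)).
have -> : ind_form v v = dot xi (rep (inner (\sum_i ract (x i) (a i))
    (\sum_i ract (x i) (a i))) xi).
  rewrite inner_suml rep_suml dot_sumr; apply: eq_bigr => i _.
  rewrite dot_sumr inner_sum rep_suml dot_sumr; apply: eq_bigr => j _.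
  by rewrite inner_ractl inner_ract !repM -(rep_star (a i)) -!ha.
have [c ->] := inner_ge0 (\sum_i ract (x i) (a i)).
by rewrite repM -{1}(starK c) -rep_star starK dot_rn ler0c sqr_ge0.
Qed.

Definition ind_sip : semi_inner V :=
  SemiInner ind_formD ind_formZ ind_formC ind_form_ge0.

Lemma inner_frame (z w : E) : inner z w = \sum_i inner z (x i) ** inner (y i) w.
Proof.
rewrite {1}[w]xy inner_sum; apply: eq_bigr => i _.
by rewrite inner_ract.
Qed.

Lemma inner_frame' (z w : E) : inner z w = \sum_i inner z (y i) ** inner (x i) w.
Proof.
rewrite {1}[w](dual_frameC xy) inner_sum; apply: eq_bigr => i _.
by rewrite inner_ract.
Qed.

Lemma ind_actM a b v : ind_act (a ** b) v = ind_act a (ind_act b v).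
Proof.
apply/funext => i; rewrite /ind_act.
under [RHS]eq_bigr => j _ do rewrite rep_sumr.
rewrite exchange_big /=; apply: eq_bigr => j _.
rewrite lactM -(starK a) -lact_adj inner_frame rep_suml.
by apply: eq_bigr => k _; rewrite lact_adj repM.
Qed.

Lemma gram_act b v i : gram_op (ind_act b v) i =
  \sum_j rep (inner (x i) (lact b (x j))) (v j).
Proof.
rewrite /gram_op /ind_act.
under eq_bigr => j _ do rewrite rep_sumr.
rewrite exchange_big /=; apply: eq_bigr => j _.
rewrite (inner_frame (x i) (lact b (x j))) rep_suml.
by apply: eq_bigr => k _; rewrite repM.
Qed.

Lemma ind_actD b v w : ind_act b (v + w) = ind_act b v + ind_act b w.
Proof.
apply/funext => i.
change (ind_act b (v + w) i = ind_act b v i + ind_act b w i).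
rewrite /ind_act -big_split /=.
by apply: eq_bigr => j _; rewrite repDr.
Qed.

Lemma ind_actZ b (c : R[i]) v : ind_act b (c *: v) = c *: ind_act b v.
Proof.
apply/funext => i; change (ind_act b (c *: v) i = c *: ind_act b v i).
rewrite /ind_act scaler_sumr.
by apply: eq_bigr => j _; rewrite repZr.
Qed.

Definition ind_prerep : prerep A.
Proof.
refine (@Prerep R A V ind_sip ind_act _ _ _ _ _ _ _).
- move=> a b v; apply/funext => i.
  change (ind_act (a + b) v i = ind_act a v i + ind_act b v i).
  rewrite /ind_act -big_split /=.
  by apply: eq_bigr => j _; rewrite lactDl innerD repDl.
- move=> c a v; apply/funext => i; change (ind_act (c *: a) v i = c *: ind_act a v i).
  rewrite /ind_act scaler_sumr.
  by apply: eq_bigr => j _; rewrite lactZl innerZ repZl.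
- by move=> a v w; exact: ind_actD.
- by move=> a c v; exact: ind_actZ.
- by move=> a b v w; rewrite ind_actM.
- move=> v w; rewrite /= /ind_form; apply: eq_bigr => i _; rewrite gram_act.
  by congr (dot _ _); apply: eq_bigr => j _; rewrite lact1.
- move=> a v w; rewrite /= ind_formC /ind_form rmorph_sum /=.
  under eq_bigr => i _ do rewrite gram_act dot_sumr rmorph_sum /=.
  rewrite exchange_big /=; apply: eq_bigr => i _.
  rewrite gram_act dot_sumr; apply: eq_bigr => j _.
  by rewrite -dotC rep_star inner_star lact_adj.
Defined.

Variable e : seq t.
Hypothesis he : pframe (hsip t) e.

Definition ind_basis (k : I) (u : t) : V := fun i => if i == k then u else 0.

Lemma ind_sumE (J : Type) (s : seq J) (F : J -> V) i :
  (\sum_(j <- s) F j) i = \sum_(j <- s) F j i.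
Proof. by elim: s => [|j s IH]; rewrite ?big_nil// !big_cons -IH. Qed.

Lemma ind_expand v : v = \sum_k \sum_(u <- e) dot u (v k) *: ind_basis k u.
Proof.
apply/funext => i; rewrite ind_sumE (bigD1 i)//= [X in _ + X]big1 ?addr0.
  rewrite ind_sumE {1}[v i](pframe_expand _ he).
  by apply: eq_bigr => u _; rewrite [RHS]/GRing.scale /= /ind_basis eqxx.
move=> k ki; rewrite ind_sumE big1// => u _.
by rewrite /GRing.scale /= /ind_basis eq_sym (negbTE ki) scaler0.
Qed.

Lemma ind_frame : exists f, pframe ind_sip f.
Proof.
pose ws := [seq ind_basis p.1 p.2 | p <- [seq (k, u) | k <- enum I, u <- e]].
apply: (@pframe_exists _ _ ind_sip ws) => v.
exists (fun w => \sum_i dot (w i) (v i)) => z.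
have -> : ind_sip z v = \sum_k \sum_(u <- e) dot u (v k) * ind_sip z (ind_basis k u).
  rewrite [in LHS](ind_expand v) sip_sum; apply: eq_bigr => k _.
  by rewrite sip_sum; apply: eq_bigr => u _; rewrite sipZ.
rewrite /ws big_map big_allpairs_dep /= big_enum /=.
apply: eq_bigr => k _; apply: eq_bigr => u _; congr (_ * _).
rewrite (bigD1 k)//= big1 ?addr0; first by rewrite /ind_basis eqxx.
by move=> i ik; rewrite /ind_basis (negbTE ik) dot0r.
Qed.

(** ind_act one projects onto the coordinates <y_i, sum_j x_j v_j>, which depend
    on the vector of E (x) t only. *)
Lemma ind_null v w : (forall z, ind_sip z v = ind_sip z w) ->
  ind_act one v = ind_act one w.
Proof.
move=> h; have gE : gram_op v = gram_op w.
  apply/funext => k; apply: dot_inj => z.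
  have := h (ind_basis k z); rewrite /= /ind_form.
  have pick (g : V) : \sum_i dot (ind_basis k z i) (g i) = dot z (g k).
    rewrite (bigD1 k)//= big1 ?addr0; first by rewrite /ind_basis eqxx.
    by move=> i ik; rewrite /ind_basis (negbTE ik) dot0r.
  by rewrite !pick.
have actE (u : V) i : ind_act one u i = \sum_k rep (inner (y i) (y k)) (gram_op u k).
  rewrite /ind_act /gram_op.
  under [RHS]eq_bigr => k _ do rewrite rep_sumr.
  rewrite exchange_big /=; apply: eq_bigr => j _.
  rewrite lact1 (inner_frame' (y i)) rep_suml.
  by apply: eq_bigr => k _; rewrite repM.
by apply/funext => i; rewrite !actE gE.
Qed.

(** Both sides are the trace of b on E (x) t, computed in an orthonormal frame and
    in the spanning family x_k (x) u. *)
Lemma ind_trace f b : pframe ind_sip f ->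
  \sum_(g <- f) ind_sip g (ind_act b g) =
  \sum_k trace t (inner (y k) (lact b (x k))).
Proof.
move=> hf; have [_ fe] := hf.
have act_basis k u : ind_act b (ind_basis k u) k = rep (inner (y k) (lact b (x k))) u.
  rewrite /ind_act (bigD1 k)//= big1 ?addr0; first by rewrite /ind_basis eqxx.
  by move=> i ik; rewrite /ind_basis (negbTE ik) rep0r.
have act1 v : ind_act b v = ind_act one (ind_act b v) by rewrite -ind_actM mul1x.
have ind_act_sum (s : seq V) (c : V -> R[i]) (d : A) :
    ind_act d (\sum_(g <- s) c g *: g) = \sum_(g <- s) c g *: ind_act d g.
  elim: s => [|g s IH].
    rewrite !big_nil; apply/funext => i; rewrite /ind_act big1// => j _.
    exact: rep0r.
  by rewrite !big_cons ind_actD ind_actZ IH.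
have one_expand w : ind_act one w = \sum_(g <- f) ind_sip g w *: ind_act one g.
  rewrite -ind_act_sum; apply: ind_null => z; rewrite sip_sum (fe w z).
  by apply: eq_bigr => g _; rewrite sipZ.
under [RHS]eq_bigr => k _ do rewrite (traceE _ he).
have step k u : dot u (rep (inner (y k) (lact b (x k))) u) =
    \sum_(g <- f) dot u (ind_act one g k) * ind_sip g (ind_act b (ind_basis k u)).
  rewrite -act_basis [in LHS]act1 [in LHS]one_expand ind_sumE dot_sumr.
  apply: eq_bigr => g _; rewrite mulrC -dotZ.
  by [].
under [RHS]eq_bigr => k _ do under eq_bigr => u _ do rewrite step.
under [RHS]eq_bigr => k _ do rewrite exchange_big /=.
rewrite [RHS]exchange_big /=; apply: eq_bigr => g _.
have -> : ind_act b g = ind_act b (ind_act one g) by rewrite -ind_actM mulx1.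
have ind_act_sum2 : ind_act b (\sum_k \sum_(u <- e) dot u (ind_act one g k) *: ind_basis k u)
   = \sum_k \sum_(u <- e) dot u (ind_act one g k) *: ind_act b (ind_basis k u).
  have act0 : ind_act b 0 = 0.
    by apply/funext => i; rewrite /ind_act big1// => j _; exact: rep0r.
  rewrite (big_morph _ (ind_actD b) act0); apply: eq_bigr => k _.
  rewrite (big_morph _ (ind_actD b) act0); apply: eq_bigr => u _.
  by rewrite ind_actZ.
rewrite {1}[ind_act one g]ind_expand ind_act_sum2 -[ind_form]/(sip ind_sip) sip_sum.
apply: eq_bigr => k _; rewrite sip_sum; apply: eq_bigr => u _.
by rewrite sipZ.
Qed.

End Induced.

(** The traces on E (x) t, decomposed into irreducible ones. The same ts works for
    all b; at b = 1 it counts dimensions. *)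
Lemma induced_trace (E : correspondence A) (I : finType) (x y : I -> E) (t : irrep A) :
  continuous_trace A -> dual_frame x y -> exists ts : seq (irrep A), forall b,
    \sum_i trace t (inner (y i) (lact b (x i))) = \sum_(s <- ts) trace s b.
Proof.
move=> hct xy; have [xi cyc] := irrep_cyclic hct t.
have he := rep_frameP (irrep_findim hct t).
have [f hf] := ind_frame x cyc he.
have [ts hts] := decompose_prerep (P := ind_prerep xy cyc) (irrep_findim hct) hf.
by exists ts => b; rewrite -hts -(ind_trace xy he b hf).
Qed.

End HilbertModule.

(** * Bounds in Hilbert modules *)

Section ModuleBounds.
Context {R : realType} {A : cstar_algebra R}.
Local Notation "a ** b" := (mul a b) (at level 40, left associativity).

Section Module.
Variable E : hilbert_module A.
Implicit Types x y : E.

Lemma rn_inner_self x : rn (inner x x) = rn x ^+ 2.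
Proof. by apply: complexI; rewrite rmorphXn /= -!rnE hm_norm. Qed.

Lemma rn_sqr_le (r s : R) : 0 <= s -> r ^+ 2 <= s ^+ 2 -> r <= s.
Proof.
by move=> s0 h; rewrite leNgt; apply/negP => lt; nra.
Qed.

Lemma rn_ract x a : rn (ract x a) <= rn x * rn a.
Proof.
apply: rn_sqr_le; first by rewrite mulr_ge0 ?rn_ge0.
rewrite -rn_inner_self inner_ractl inner_ract; apply: le_trans (rn_mul _ _) _.
rewrite rn_star exprMn mulrC (expr2 (rn a)) mulrA ler_wpM2r ?rn_ge0//.
by rewrite -rn_inner_self rn_mul.
Qed.

(** A weak form of the Cauchy-Schwarz inequality, read off the triangle inequality
    for x + y a with a a multiple of <x,y>^*. *)
Lemma rn_inner x y : rn (inner x y) <= 3 * (rn x * rn y).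
Proof.
set b := inner x y.
(* a = l <x,y>^*, where l = rn x / (rn y * rn b) is the best choice *)
have key (l : R) : 0 <= l -> l * rn b ^+ 2 <=
    rn x ^+ 2 + l * (rn x * (rn y * rn b)) + l ^+ 2 * (rn y * rn b) ^+ 2.
  move=> l0; pose a := l%:C *: star b.
  have ya : rn (ract y a) <= l * (rn y * rn b).
    apply: le_trans (rn_ract _ _) _; rewrite rnZR rn_star ger0_norm//.
    by rewrite mulrCA.
  have h1 := crnD x (ract y a).
  have E1 : inner (x + ract y a) (x + ract y a) =
      inner x x + inner (ract y a) (ract y a) + (2 * l)%:C *: (b ** star b).
    rewrite innerD !innerDl (AC (2*2) ((1*4)*(2*3))) /=; congr (_ + _).
    rewrite inner_ractl inner_ract -(inner_star x y) -/b /a starZR starK mulZl mulZr.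
    by rewrite -scalerDl -rmorphD mulr_natl mulr2n.
  have h2 : 2 * l * rn b ^+ 2 <= rn (x + ract y a) ^+ 2 + rn x ^+ 2 + rn (ract y a) ^+ 2.
    have -> : 2 * l * rn b ^+ 2 = rn ((2 * l)%:C *: (b ** star b)).
      have bb : rn (b ** star b) = rn b ^+ 2.
        by rewrite -{1}(starK b) rn_starM rn_star.
      by rewrite rnZR ger0_norm ?mulr_ge0// bb.
    have -> : (2 * l)%:C *: (b ** star b) = inner (x + ract y a) (x + ract y a) -
        inner x x - inner (ract y a) (ract y a).
      by rewrite E1 -addrA -opprD addrC addKr.
    apply: le_trans (crnB _ _) _; rewrite rn_inner_self lerD2r.
    by apply: le_trans (crnB _ _) _; rewrite !rn_inner_self.
  have X0 := rn_ge0 x; have Z0 := rn_ge0 (ract y a).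
  have h3 : rn (x + ract y a) ^+ 2 <= (rn x + rn (ract y a)) ^+ 2.
    by rewrite ler_pXn2r ?nnegrE ?rn_ge0 ?addr_ge0.
  have h4 : rn (ract y a) ^+ 2 <= (l * (rn y * rn b)) ^+ 2.
    by rewrite ler_pXn2r ?nnegrE ?rn_ge0 ?mulr_ge0 ?rn_ge0.
  have h5 : rn x * rn (ract y a) <= rn x * (l * (rn y * rn b)) by rewrite ler_wpM2l.
  move: h2 h3 h4 h5; rewrite sqrrD !exprMn mulrnAl -mulr_natl; lra.
have [x0|xn0] := eqVneq (rn x) 0.
  by rewrite /b (rn_eq0 x0) inner0l !rn0 !mul0r mulr0.
have [y0|yn0] := eqVneq (rn y) 0.
  by rewrite /b (rn_eq0 y0) inner0r !rn0 !mulr0.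
have Xp : 0 < rn x by rewrite lt_def xn0 rn_ge0.
have Yp : 0 < rn y by rewrite lt_def yn0 rn_ge0.
have c0 := rn_ge0 b.
move: (rn x) (rn y) (rn b) Xp Yp c0 {xn0 yn0} key => X Y c Xp Yp c0 key.
have [->|cn0] := eqVneq c 0; first by rewrite !mulr_ge0// ltW.
have cp : 0 < c by rewrite lt_def cn0.
pose l := X / (Y * c); have l0 : 0 < l by rewrite divr_gt0// mulr_gt0.
have := key l (ltW l0).
have -> : l * c ^+ 2 = X * c / Y by rewrite /l; field; rewrite !gt_eqF.
have -> : X ^+ 2 + l * (X * (Y * c)) + l ^+ 2 * (Y * c) ^+ 2 = 3 * X ^+ 2.
  by rewrite /l; field; rewrite !gt_eqF.
rewrite ler_pdivrMr// => h; rewrite -(ler_pM2l Xp); lra.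
Qed.

Lemma tends_inner (u : nat -> E) l x : tends u l ->
  tends (fun n => inner x (u n)) (inner x l).
Proof.
move=> h; apply: (@tends_le _ _ _ (3 * rn x) _ _ _ _ _ _ h).
  by rewrite mulr_ge0 ?rn_ge0.
by move=> n; rewrite -innerB -mulrA; exact: rn_inner.
Qed.

Lemma tends_ract_inner (u : nat -> E) l (x y : E) : tends u l ->
  tends (fun n => ract x (inner y (u n))) (ract x (inner y l)).
Proof.
move=> h; apply: (tends_le (rn_ge0 x) _ (tends_inner y h)) => n.
by rewrite -ractBr; exact: rn_ract.
Qed.

Lemma tends_ract (u : nat -> E) l a : tends u l ->
  tends (fun n => ract (u n) a) (ract l a).
Proof.
move=> h; apply: (tends_le (rn_ge0 a) _ h) => n.
by rewrite -ractBl mulrC; exact: rn_ract.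
Qed.

End Module.

(** A self-adjoint contraction d is the real part of the unitary
    d + i (1 - d^2)^(1/2), and unitaries act isometrically. *)
Lemma rn_lact_sa (E : correspondence A) (b : A) (x : E) :
  star b = b -> rn (lact b x) <= rn b * rn x.
Proof.
move=> sb; have [b0|bn0] := eqVneq (rn b) 0.
  have -> : b = 0 by exact: rn_eq0.
  have -> : lact 0 x = 0 by have := lactZl 0 0 x; rewrite !scale0r.
  by rewrite !rn0 mul0r.
have bp : 0 < rn b by rewrite lt_def bn0 rn_ge0.
pose d := (rn b)^-1%:C *: b.
have sd : star d = d by rewrite starZR sb.
have nd : rn d <= 1 by rewrite rnZR gtr0_norm ?invr_gt0// mulVf.
have bE : b = (rn b)%:C *: d by rewrite scalerA -rmorphM mulfV// rmorph1 scale1r.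
have [||z [sz _ zz zc]] := @sqrt_exists _ A (d ** d).
- by rewrite starM sd.
- by apply: le_trans (rn_mul _ _) _; rewrite mulr_ile1 ?rn_ge0.
have [i [conji ii]] := imaginary_unit (R := R).
pose w := one - z; have sw : star w = w by rewrite starB star1 sz.
have ww : w ** w = one - d ** d by rewrite zz.
have dw : d ** w = w ** d.
  by rewrite mulBr mulBl mulx1 mul1x (zc d) ?mulA.
clearbody w d.
have isom (c : R[i]) : c * c = -1 -> Num.conj c = - c ->
    rn (lact (d + c *: w) x) = rn x.
  move=> cc cc'; apply/eqP; rewrite -(@eqrXn2 _ 2)// ?rn_ge0// -!rn_inner_self.
  rewrite lact_adj -lactM starD starZ sd sw cc' mulDl !mulDr !mulZr !mulZl scalerA.
  by rewrite dw mulrN cc opprK scale1r scaleNr addrA addrK ww addrC subrK lact1.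
have -> : lact b x = (rn b / 2)%:C *: (lact (d + i *: w) x + lact (d + (- i) *: w) x).
  rewrite {1}bE lactZl -lactDl scaleNr addrACA subrr addr0.
  rewrite rmorphM -scalerA; congr (_ *: _).
  rewrite lactDl -[X in X + X]scale1r -scalerDl scalerA.
  rewrite (_ : _ * _ = 1) ?scale1r// -(rmorph1 (real_complex R)) -rmorphD -rmorphM.
  by congr (_%:C); field.
rewrite rnZR ger0_norm ?divr_ge0 ?rn_ge0//.
have h1 := crnD (lact (d + i *: w) x) (lact (d + (- i) *: w) x).
have i1 := isom i ii conji.
have i2 : rn (lact (d + (- i) *: w) x) = rn x.
  by apply: isom; [rewrite mulrNN|rewrite rmorphN /= conji].
rewrite i1 i2 in h1; rewrite -mulrA ler_wpM2l ?rn_ge0//; lra.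
Qed.

Lemma rn_tens (E F : correspondence A) (B : interior_tensor E F) (x : E) (y : F) :
  rn (tens B x y) <= 2 * (rn x * rn y).
Proof.
apply: rn_sqr_le; first by rewrite !mulr_ge0 ?rn_ge0.
rewrite -rn_inner_self tens_inner; apply: le_trans (rn_inner _ _) _.
have h := rn_lact_sa y (inner_star x x); rewrite rn_inner_self in h.
have h2 : rn y * rn (lact (inner x x) y) <= rn y * (rn x ^+ 2 * rn y).
  by rewrite ler_wpM2l ?rn_ge0.
have h3 : 0 <= rn x ^+ 2 * rn y ^+ 2 by rewrite mulr_ge0 ?sqr_ge0.
rewrite !exprMn; move: h2 h3; lra.
Qed.

(** |T x|^2 = <x, S (T x)>, where the norm of S (T x) is known from T S = z. *)
Lemma rn_coisometric (E F : hilbert_module A) (T : E -> F) (S : F -> E) (z : R[i]) x :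
  adjoint_pair T S -> (forall y, T (S y) = z *: y) -> rn (T x) <= 3 * Num.sqrt (rn z) * rn x.
Proof.
move=> TS Tz; have r0 : 0 <= 3 * Num.sqrt (rn z) * rn x.
  by rewrite !mulr_ge0 ?sqrtr_ge0 ?rn_ge0.
have [->//|t0] := eqVneq (rn (T x)) 0.
have tp : 0 < rn (T x) by rewrite lt_def t0 rn_ge0.
have nS : rn (S (T x)) = Num.sqrt (rn z) * rn (T x).
  apply/eqP; rewrite -(@eqrXn2 _ 2)// ?mulr_ge0 ?sqrtr_ge0 ?rn_ge0//.
  rewrite -rn_inner_self (adjoint_pairC TS) Tz innerZ rnZ rn_inner_self.
  by rewrite exprMn sqr_sqrtr// rn_ge0.
have := rn_inner x (S (T x)); rewrite -TS rn_inner_self nS => h.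
rewrite -(ler_pM2r tp) -expr2; apply: le_trans h _; lra.
Qed.

Lemma rn_unitary (E F : correspondence A) (U : intertwiner E F) x :
  unitary_intertwiner U -> rn (U x) = rn x.
Proof.
move=> [h _]; apply/eqP; rewrite -(@eqrXn2 _ 2)// ?rn_ge0//.
by rewrite -!rn_inner_self (ifun_adj U) h.
Qed.

Lemma tens_approx (E F : correspondence A) (B : interior_tensor E F) (z : B) (e : R) :
  0 < e -> exists s : seq (E * F), rn (z - \sum_(p <- s) tens B p.1 p.2) <= e.
Proof.
move=> e0; have e1 : 0 < e%:C :> R[i] by rewrite ltcR.
have : (setT : set B) z by []; rewrite -(tens_dense B).
move=> /(_ _ (nbhsx_ballx z _ e1))[t [[s ->] /ball_rn h]].
by exists s; rewrite ltW.
Qed.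

End ModuleBounds.

(** * Dual frames *)

Section ApproximateFrames.
Context {R : realType} {A : cstar_algebra R} (E : hilbert_module A).
Variables (I : finType) (p y : I -> E).

(** The right A-linear contraction N = 1 - sum_i p_i <y_i, -> has a convergent
    Neumann series, which carries p to a dual partner x of y. *)
Lemma approximate_frame :
  (forall z, rn (z - \sum_i ract (p i) (inner (y i) z)) <= 2^-1 * rn z) ->
  exists x : I -> E, dual_frame x y.
Proof.
pose N z := z - \sum_i ract (p i) (inner (y i) z) => small.
have ND z w : N (z + w) = N z + N w.
  rewrite /N addrACA -opprD -big_split /=; congr (_ - _).
  by apply: eq_bigr => i _; rewrite innerD ractDr.
have Nr z a : N (ract z a) = ract (N z) a.
  rewrite /N ractBl ract_suml.
  by congr (_ - _); apply: eq_bigr => i _; rewrite inner_ract ractM.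
have N0 : N 0 = 0.
  by apply: (addrI (N 0)); rewrite -ND !addr0.
have Nsum (s : seq I) (F : I -> E) : N (\sum_(i <- s) F i) = \sum_(i <- s) N (F i).
  by rewrite (big_morph N ND N0).
(* partial sums of the Neumann series; x i is the limit of S k (p i) *)
pose S k z := \sum_(j < k) iter j N z.
have iN k z : rn (iter k N z) <= (2^-1) ^+ k * rn z.
  elim: k => [|k IH]; first by rewrite expr0 mul1r.
  by rewrite iterS exprS -mulrA; apply: le_trans (small _) _; rewrite ler_wpM2l// invr_ge0.
have S_step k z : S k.+1 z = S k z + iter k N z by rewrite /S big_ord_recr.
have Scvg z : exists l, tends (S^~ z) l.
  have q0 : 0 <= 2^-1 :> R by rewrite invr_ge0.
  have q1 : 2^-1 < 1 :> R by lra.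
  apply: (geometric_tends q0 q1 (rn_ge0 z)) => k.
  by rewrite S_step addrAC subrr add0r.
have [x hx] := choice (fun i => Scvg (p i)); exists x => z.
have Sr k w a : S k (ract w a) = ract (S k w) a.
  rewrite /S ract_suml; apply: eq_bigr => j _.
  by elim: (nat_of_ord j) => // m IH; rewrite !iterS IH Nr.
have SSum k (F : I -> E) : S k (\sum_i F i) = \sum_i S k (F i).
  rewrite /S exchange_big /=; apply: eq_bigr => j _.
  by elim: (nat_of_ord j) => // m IH; rewrite iterS IH Nsum.
have tele k : \sum_i ract (S k (p i)) (inner (y i) z) = z - iter k N z.
  under eq_bigr => i _ do rewrite -Sr.
  rewrite -SSum; elim: k => [|k IH]; first by rewrite /S big_ord0 subrr.
  rewrite S_step IH.
  have -> : iter k N (\sum_i ract (p i) (inner (y i) z)) = iter k N z - iter k.+1 N z.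
    have itD m a b : iter m N (a + b) = iter m N a + iter m N b.
      by elim: m => // m' IHm; rewrite !iterS IHm ND.
    apply/eqP; rewrite eq_sym subr_eq iterSr -itD /N addrC subrK.
    by [].
  by rewrite addrA subrK.
have lim1 : tends (fun k => \sum_i ract (S k (p i)) (inner (y i) z))
    (\sum_i ract (x i) (inner (y i) z)).
  suff h : forall s : seq I, tends (fun k => \sum_(i <- s) ract (S k (p i)) (inner (y i) z))
      (\sum_(i <- s) ract (x i) (inner (y i) z)) by exact: h.
  elim=> [|i s IH].
    by rewrite big_nil; apply: eq_tends (@tends_cst _ _ 0) => k; rewrite big_nil.
  rewrite big_cons; apply: eq_tends (tendsD (tends_ract (inner (y i) z) (hx i)) IH) => k.
  by rewrite big_cons.
apply/esym/(tends_uniq lim1); move=> e e0.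
have c0 : 0 < rn z + 1 by have := rn_ge0 z; lra.
have [|M hM] := @expr_null R 2^-1 (e / (rn z + 1)) _ (divr_gt0 e0 c0).
  by rewrite invr_ge0 ler0n invf_lt1// ltr1n.
exists M => k /hM; rewrite tele addrAC subrr add0r rnN ler_pdivlMr// => h.
apply: le_trans (iN _ _) _; move: h.
have : 0 <= (2^-1 : R) ^+ k by rewrite exprn_ge0// invr_ge0.
lra.
Qed.

End ApproximateFrames.

Lemma dag_idm (R : realType) (C : cstar_category R) (X : C) : dag (idm X) = idm X.
Proof.
have h : dag (comp (dag (idm X)) (idm X)) = comp (dag (idm X)) (idm X).
  by rewrite dagM dagK.
by move: h; rewrite !compm1 dagK => <-.
Qed.

Section FrameOfDual.
Context {R : realType} {C : unitary_fusion_category R} {A : cstar_algebra R}.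
Variable a : action C A.
Local Notation "b ** c" := (mul b c) (at level 40, left associativity).
Local Notation F := (act_obj a).
Local Notation m := (act_mor a).
Local Notation J := (act_J a).
Local Notation J0 := (act_J0 a).
Local Notation box := (act_box a).

Lemma act_adj X Y (f : hom X Y) : adjoint_pair (m f) (m (dag f)).
Proof. by move=> x y; rewrite (ifun_adj (m f)) act_mor_dag. Qed.

Lemma act_unitaryK X Y (u : hom X Y) : isometry u -> forall x, m (dag u) (m u x) = x.
Proof. by move=> iu x; rewrite -act_morM iu act_mor1. Qed.

Lemma act_isometry_rn X Y (u : hom X Y) x : isometry u -> rn (m u x) = rn x.
Proof.
move=> iu; apply/eqP; rewrite -(@eqrXn2 _ 2)// ?rn_ge0//.
by rewrite -!rn_inner_self act_adj act_unitaryK.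
Qed.

Lemma act_J_sum X Y (s : seq (F X * F Y)) :
  J X Y (\sum_(p <- s) tens (box X Y) p.1 p.2) =
  \sum_(p <- s) J X Y (tens (box X Y) p.1 p.2).
Proof. exact: adjoint_sum (ifun_adj (J X Y)) _ _ _. Qed.

(** The action of f^* is adjoint to that of f, so this bounds the action of f
    (rn_coisometric). *)
Lemma to_unit_scalar (X : C) (f : hom X (un : C)) :
  exists z : R[i], comp f (dag f) = z *: idm (un : C).
Proof. by have [_ h] := ufc_unit C; have [z hz] := h (comp f (dag f)); exists z. Qed.

(** Evaluate the zigzag identity at x: with coev(1) = sum_i p_i (x) q_i it reads
    x = sum_i p_i ev(q_i (x) x), and ev(q_i (x) x) has the form <y_i, x>. The sum
    representing coev(1) and the vector representing ev are limits of finite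
    sums only, so that one gets an approximate frame. *)
Lemma dual_pair_frame (X X' : C) : dual_pair X' X ->
  exists n (x y : 'I_n -> F X), dual_frame x y.
Proof.
move=> [ev [coev [zigzag _]]].
have [z evz] := to_unit_scalar ev.
pose K := Num.sqrt (rn z); have K0 : 0 <= K by exact: sqrtr_ge0.
(* ev, with the object un mapped to A itself *)
pose G (t : box X' X) : A := iadj J0 (m ev (J X' X t)).
have J0V w : J0 (iadj J0 w) = w by have [_ h] := act_J0_unitary a; exact: h.
(* the vector representing ev *)
pose eta : box X' X := iadj (J X' X) (m (dag ev) (J0 one)).
have GE t : G t = inner eta t.
  rewrite /eta (adjoint_pairC (ifun_adj (J X' X))) (adjoint_pairC (act_adj ev)).
  by rewrite (ifun_adj J0) /= star1 mul1x.
(* the zigzag with coev(1) replaced by w *)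
pose L (w : F (ot X X')) (x : F X) : F X :=
  m (run X) (m (otm (idm X) ev) (m (assoc X X' X) (J _ _ (tens (box _ X) w x)))).
have Ltens p q x : L (J X X' (tens (box X X') p q)) x = ract p (G (tens (box X' X) q x)).
  by rewrite /L act_assoc act_J_nat act_mor1 -[m ev _]J0V act_run.
pose c := m coev (J0 one).
have Lc x : L c x = x.
  have lx : m (dag (lun X)) x = J un X (tens (box un X) (J0 one) x).
    have [il _] := lun_unitary X.
    by rewrite -[RHS](act_unitaryK il) act_lun lact1.
  have := @act_mor1 _ _ _ a X x; rewrite -zigzag !act_morM lx act_J_nat act_mor1.
  by [].
have LD w w' x : L (w + w') x = L w x + L w' x.
  by rewrite /L tensDl (adjointD (ifun_adj (J _ _))) !(adjointD (act_adj _)).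
have L0 x : L 0 x = 0.
  by apply: (addrI (L 0 x)); rewrite -LD !addr0.
have Lbound w x : rn (L w x) <= 6 * K * (rn w * rn x).
  have [ir _] := run_unitary X; have [ia _] := assoc_unitary X X' X.
  rewrite /L act_isometry_rn//.
  have coi y : m (otm (idm X) ev) (m (dag (otm (idm X) ev)) y) = z *: y.
    rewrite -act_morM otm_dag -otmM evz otmZr act_morZ.
    rewrite dag_idm.
    by rewrite comp1m otm1 act_mor1.
  apply: le_trans (rn_coisometric _ (act_adj _) coi) _.
  rewrite act_isometry_rn// rn_unitary; last exact: act_J_unitary.
  have := rn_tens (box (ot X X') X) w x.
  have : 0 <= 3 * K by rewrite mulr_ge0.
  by rewrite -/K => k0 h; have := ler_wpM2l k0 h; lra.
(* an error of 1/4 in each of two approximations gives 1/2 in total *)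
have d0 : 0 < (4 * (6 * K + 1))^-1 by rewrite invr_gt0; lra.
have [s hs] := tens_approx (iadj (J X X') c) d0.
pose c' := \sum_(p <- s) tens (box X X') p.1 p.2.
have cE : rn (c - J X X' c') <= (4 * (6 * K + 1))^-1.
  have [_ JV] := act_J_unitary a X X'.
  rewrite -{1}[c]JV -(adjointB (ifun_adj (J X X'))) rn_unitary//.
  exact: act_J_unitary.
pose S : R := \sum_(p <- s) rn p.1 * rn p.2.
have S0 : 0 <= S by apply: sumr_ge0 => p _; rewrite mulr_ge0 ?rn_ge0.
have d1 : 0 < (4 * (6 * S + 1))^-1 by rewrite invr_gt0; lra.
have [s' hs'] := tens_approx eta d1.
pose eta' := \sum_(p <- s') tens (box X' X) p.1 p.2.
pose yq (q : F X') : F X := \sum_(p <- s') lact (inner q p.1) p.2.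
have Gapprox q x : rn (G (tens (box X' X) q x) - inner (yq q) x) <=
    6 * (4 * (6 * S + 1))^-1 * (rn q * rn x).
  have -> : inner (yq q) x = inner eta' (tens (box X' X) q x).
    rewrite /yq !inner_suml; apply: eq_bigr => p _.
    by rewrite tens_inner (lact_adj (inner q p.1)) inner_star.
  rewrite GE.
  have -> : inner eta (tens _ q x) - inner eta' (tens _ q x) = inner (eta - eta') (tens _ q x).
    by rewrite innerDl -[inner (- eta') _]inner_star innerN starN inner_star.
  apply: le_trans (rn_inner _ _) _.
  have h1 := rn_tens (box X' X) q x.
  have := ler_pM (rn_ge0 _) (rn_ge0 _) hs' h1.
  lra.
have main x : rn (x - \sum_(p <- s) ract p.1 (inner (yq p.2) x)) <= 2^-1 * rn x.
  have Lc' : L (J X X' c') x = \sum_(p <- s) ract p.1 (G (tens (box X' X) p.2 x)).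
    rewrite /c' act_J_sum (big_morph (L^~ x) (fun w w' => LD w w' x) (L0 x)).
    by apply: eq_bigr => p _; rewrite Ltens.
  have Ldiff : x - L (J X X' c') x = L (c - J X X' c') x.
    apply/eqP; rewrite subr_eq -LD subrK Lc; exact: eqxx.
  apply: le_trans (crn_tri _ (L (J X X' c') x) _) _.
  have h1 : rn (x - L (J X X' c') x) <= 4^-1 * rn x.
    rewrite Ldiff; apply: le_trans (Lbound _ _) _.
    have k0 : 0 <= 6 * K by rewrite mulr_ge0.
    have h := ler_wpM2r (rn_ge0 x) cE; have := ler_wpM2l k0 h.
    move=> h'; apply: le_trans h' _; rewrite mulrA ler_wpM2r ?rn_ge0//.
    rewrite ler_pdivrMr; last by lra.
    by rewrite mulrA mulVf ?pnatr_eq0// mul1r; lra.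
  have h2 : rn (L (J X X' c') x - \sum_(p <- s) ract p.1 (inner (yq p.2) x)) <= 4^-1 * rn x.
    rewrite Lc' -sumrB; apply: le_trans (rn_sum _ _ _) _.
    have term p : rn (ract p.1 (G (tens (box X' X) p.2 x)) - ract p.1 (inner (yq p.2) x)) <=
       6 * (4 * (6 * S + 1))^-1 * rn x * (rn p.1 * rn p.2).
      rewrite -ractBr; apply: le_trans (rn_ract _ _) _.
      have := ler_wpM2l (rn_ge0 p.1) (Gapprox p.2 x).
      by move=> h'; apply: le_trans h' _; rewrite le_eqVlt; apply/orP; left; apply/eqP; ring.
    apply: (@le_trans _ _ (\sum_(p <- s) 6 * (4 * (6 * S + 1))^-1 * rn x * (rn p.1 * rn p.2))).
      by apply: ler_sum => p _; exact: term.
    rewrite -mulr_sumr -/S mulrAC ler_wpM2r ?rn_ge0//.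
    rewrite -mulrA mulrCA -ler_pdivlMl ?invr_gt0; last by lra.
    by rewrite invrK; lra.
  lra.
exists (size s); pose p0 : F X * F X' := (0, 0).
pose p (i : 'I_(size s)) := (nth p0 s i).1.
pose y (i : 'I_(size s)) := yq (nth p0 s i).2.
have [|x xy] := @approximate_frame _ _ (F X) 'I_(size s) p y.
  move=> x; apply: le_trans (main x).
  by rewrite (big_nth p0) big_mkord.
by exists x, y.
Qed.

Lemma act_frame X : exists n (x y : 'I_n -> F X), dual_frame x y.
Proof. by have [[X' /dual_pair_frame]] := ufc_rigid X. Qed.

End FrameOfDual.

(** * The rank of the bimodule of an object *)

Section FrameOperations.
Context {R : realType} {A : cstar_algebra R}.
Local Notation "a ** b" := (mul a b) (at level 40, left associativity).

(** Expand each frame in the other and use that tr (a b) = tr (b a). *)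
Lemma frame_trace_indep (E : correspondence A) (I I' : finType) (x y : I -> E)
    (x' y' : I' -> E) (t : representation A) :
  findim t -> dual_frame x y -> dual_frame x' y' ->
  \sum_i trace t (inner (y i) (x i)) = \sum_i trace t (inner (y' i) (x' i)).
Proof.
move=> ft xy xy'.
under eq_bigr => i _ do rewrite [x i]xy' inner_sum trace_sum.
rewrite exchange_big /=; apply: eq_bigr => j _.
rewrite [in RHS](xy (x' j)) inner_sum trace_sum; apply: eq_bigr => i _.
by rewrite !inner_ract traceC.
Qed.

Lemma dual_frame_unitary (E F : hilbert_module A) (U : E -> F) (V : F -> E)
    (I : finType) (x y : I -> E) :
  adjoint_pair U V -> cancel V U -> dual_frame x y ->
  dual_frame (fun i => U (x i)) (fun i => U (y i)).
Proof.
move=> UV VU xy z; rewrite -{1}(VU z) {1}[V z]xy (adjoint_sum UV).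
by apply: eq_bigr => i _; rewrite (adjoint_ract UV) -UV.
Qed.

(** The expansion holds on elementary tensors by balancing, and both sides are
    continuous. *)
Lemma dual_frame_tens (E F : correspondence A) (B : interior_tensor E F)
    (I I' : finType) (x y : I -> E) (x' y' : I' -> F) :
  dual_frame x y -> dual_frame x' y' ->
  dual_frame (fun p : I * I' => tens B (x p.1) (x' p.2) : B)
             (fun p => tens B (y p.1) (y' p.2)).
Proof.
move=> xy xy' z.
(* frame expansion, compared with the identity on a dense set *)
pose T (w : B) := \sum_(p : I * I') ract (tens B (x p.1) (x' p.2) : B)
  (inner (tens B (y p.1) (y' p.2)) w).
have TD w w' : T (w + w') = T w + T w'.
  by rewrite /T -big_split /=; apply: eq_bigr => p _; rewrite innerD ractDr.
have T0 : T 0 = 0 by apply: (addrI (T 0)); rewrite -TD !addr0.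
have tens0l v : tens B 0 v = 0 by apply: (addrI (tens B 0 v)); rewrite -tensDl !addr0.
have tens0r u : tens B u 0 = 0 by apply: (addrI (tens B u 0)); rewrite -tensDr !addr0.
have tens_suml v (G : I -> E) : tens B (\sum_i G i) v = \sum_i tens B (G i) v.
  exact: (big_morph (fun u => tens B u v) (fun u u' => tensDl B u u' v) (tens0l v)).
have tens_sumr u (G : I' -> F) : tens B u (\sum_i G i) = \sum_i tens B u (G i).
  exact: (big_morph (tens B u) (fun v v' => tensDr B u v v') (tens0r u)).
have Ttens u v : T (tens B u v) = tens B u v.
  rewrite [in RHS](xy u) tens_suml /T.
  rewrite -(pair_big xpredT xpredT (fun i j => ract (tens B (x i) (x' j) : B)
    (inner (tens B (y i) (y' j)) (tens B u v)))) /=; apply: eq_bigr => i _.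
  rewrite tens_balanced {1}[lact (inner (y i) u) v]xy' tens_sumr.
  by apply: eq_bigr => j _; rewrite tens_inner tens_ract.
have Tsum (s : seq (E * F)) : T (\sum_(p <- s) tens B p.1 p.2) = \sum_(p <- s) tens B p.1 p.2.
  rewrite (big_morph T TD T0); apply: eq_bigr => p _; exact: Ttens.
have [s hs] := choice (fun n => @tens_approx _ _ _ _ B z _ (invS_gt0 n)).
pose u n := \sum_(p <- s n) tens B p.1 p.2.
have uz : tends u z.
  by move=> e /invS_null[N hN]; exists N => n /hN h; rewrite crnBC; apply: le_trans (hs n) h.
have Tlim : tends (fun n => T (u n)) (T z).
  rewrite /T; elim: (index_enum _) => [|p r IH].
    by rewrite big_nil; apply: eq_tends (@tends_cst _ _ 0) => n; rewrite big_nil.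
  rewrite big_cons; apply: eq_tends (tendsD (tends_ract_inner _ _ uz) IH) => n.
  by rewrite big_cons.
by apply: (tends_uniq uz); apply: eq_tends Tlim => n; rewrite Tsum.
Qed.

End FrameOperations.

Section Rank.
Context {R : realType} {C : unitary_fusion_category R} {A : cstar_algebra R}.
Hypotheses (hct : continuous_trace A) (hconn : spectrum_connected A).
Variable a : action C A.
Local Notation F := (act_obj a).

(** The left side is the dimension of F X (x) t, the trace of the identity. *)
Definition has_rank (X : C) (r : nat) := forall (I : finType) (x y : I -> F X),
  dual_frame x y -> forall t : irrep A,
  \sum_i trace t (inner (y i) (x i)) = (r * dim t)%:R.

Lemma trace_count (t : irrep A) (ts : seq (irrep A)) :
  \sum_(s <- ts) trace s one = (size ts * dim t)%:R.
Proof.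
elim: ts => [|s ts IH]; first by rewrite big_nil.
rewrite big_cons IH trace1; last exact: irrep_findim.
by rewrite (dim_constant hct hconn s t) -natrD mulSn.
Qed.

(** Let r t be the number of constituents of F X (x) t. The element
    b = sum_i <y_i, x_i> has the integral traces r t * dim t, which are therefore
    constant; so is dim. *)
Lemma has_rank_exists X : exists r, has_rank X r.
Proof.
have [n [x [y xy]]] := act_frame a X.
have [ts hts] := choice (fun t => induced_trace t hct xy).
pose b := \sum_i inner (y i) (x i).
have tb (t : irrep A) : trace t b = (size (ts t) * dim t)%:R.
  rewrite trace_sum -trace_count -hts; apply: eq_bigr => i _.
  by rewrite lact1.
have const := connected_constant hconn (trace_locally_constant hct tb).
have [t0] := hconn.1; exists (size (ts t0)) => I x' y' xy' t.
rewrite (frame_trace_indep (irrep_findim hct t) xy' xy) -trace_sum -/b tb.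
by rewrite (const t t0) (dim_constant hct hconn t0 t).
Qed.

Definition rk X : nat := sval (cid (has_rank_exists X)).

Lemma rkP X : has_rank X (rk X).
Proof. exact: svalP (cid (has_rank_exists X)). Qed.

Lemma rk_uniq X r (I : finType) (x y : I -> F X) (t : irrep A) : dual_frame x y ->
  \sum_i trace t (inner (y i) (x i)) = (r * dim t)%:R -> rk X = r.
Proof.
move=> xy; rewrite (rkP xy) => /eqP; rewrite eqr_nat eqn_pmul2r ?irrep_dim_gt0//.
by move/eqP.
Qed.

Lemma rk_un : rk (un : C) = 1%N.
Proof.
have [t] := hconn.1.
have [h1 h2] := act_J0_unitary a.
pose x (_ : 'I_1) := act_J0 a (one : trivial_correspondence A).
have xx : dual_frame x x.
  have triv : dual_frame (fun _ : 'I_1 => one : trivial_hilbert_module A) (fun=> one).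
    by move=> z; rewrite big_ord1 /= star1 !mul1x.
  exact: (dual_frame_unitary (ifun_adj (act_J0 a)) h2 triv).
apply: (rk_uniq (t := t) xx); rewrite big_ord1 /x (ifun_adj (act_J0 a)) h1 /=.
by rewrite star1 mul1x trace1 ?mul1n//; exact: irrep_findim.
Qed.

(** By induced_trace the action of A on F Y (x) t has rk Y irreducible
    constituents, each of which contributes rk X to F X (x) (F Y (x) t). *)
Lemma rk_tensor X Y : rk (ot X Y) = (rk X * rk Y)%N.
Proof.
have [t] := hconn.1.
have [n [x [y xy]]] := act_frame a X; have [n' [x' [y' xy']]] := act_frame a Y.
have [h1 h2] := act_J_unitary a X Y.
have xyT := dual_frame_tens (B := act_box a X Y) xy xy'.
have xyJ := dual_frame_unitary (ifun_adj (act_J a X Y)) h2 xyT.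
apply: (rk_uniq (t := t) xyJ).
have [ts hts] := induced_trace t hct xy'.
have sts : size ts = rk Y.
  apply/eqP; rewrite -(eqn_pmul2r (irrep_dim_gt0 hct t)) -(eqr_nat R[i]).
  rewrite -(rkP xy') -trace_count -hts; apply/eqP/eq_bigr => j _.
  by rewrite lact1.
pose b := \sum_i inner (y i) (x i).
have -> : \sum_p trace t (inner (act_J a X Y (tens (act_box a X Y) (y p.1) (y' p.2)))
    (act_J a X Y (tens (act_box a X Y) (x p.1) (x' p.2)))) =
    \sum_j trace t (inner (y' j) (lact b (x' j))).
  under [RHS]eq_bigr => j _.
    have -> : lact b (x' j) = \sum_i lact (inner (y i) (x i)) (x' j).
      have l0 : lact 0 (x' j) = 0 by have := lactZl 0 0 (x' j); rewrite !scale0r.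
      exact: (big_morph (fun c => lact c (x' j)) (fun c d => lactDl c d (x' j)) l0).
    rewrite inner_sum trace_sum; over.
  rewrite [RHS]exchange_big [RHS]pair_big /=. apply: eq_bigr => p _.
  by rewrite (ifun_adj (act_J a X Y)) h1 tens_inner.
rewrite hts -sts; have tb (s : irrep A) : trace s b = (rk X * dim t)%:R.
  by rewrite trace_sum (rkP xy) (dim_constant hct hconn s t).
under eq_bigr => s _ do rewrite tb.
rewrite big_const_seq count_predT iter_addr_0 -mulrnA.
by rewrite mulnAC.
Qed.

Lemma rk_direct_sum n (S : 'I_n -> C) X : is_direct_sum S X ->
  rk X = (\sum_i rk (S i))%N.
Proof.
move=> [v [viso [_ vsum]]]; have [t] := hconn.1.
have ex i : exists k (xy : ('I_k -> F (S i)) * ('I_k -> F (S i))), dual_frame xy.1 xy.2.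
  by have [k [x [y xy]]] := act_frame a (S i); exists k, (x, y).
have [k hk] := choice ex.
pose fr i := cid (hk i).
pose I := {i : 'I_n & 'I_(k i)}.
pose x (p : I) := act_mor a (v (tag p)) ((sval (fr (tag p))).1 (tagged p)).
pose y (p : I) := act_mor a (v (tag p)) ((sval (fr (tag p))).2 (tagged p)).
have frP i : dual_frame (sval (fr i)).1 (sval (fr i)).2 := svalP (fr i).
have xy : dual_frame x y.
  move=> z; rewrite -{1}[z](@act_mor1 _ _ _ a X z) -vsum.
  have -> : act_mor a (\sum_i comp (v i) (dag (v i))) z =
      \sum_i act_mor a (comp (v i) (dag (v i))) z.
    have m0 : act_mor a (0 : hom X X) z = 0.
      by have := @act_morZ _ _ _ a X X 0 0 z; rewrite !scale0r.
    exact: (big_morph (fun f => act_mor a f z) (fun f g => @act_morD _ _ _ a X X f g z) m0).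
  have -> : \sum_(p : I) ract (x p) (inner (y p) z) =
      \sum_i \sum_(j < k i) ract (act_mor a (v i) ((sval (fr i)).1 j))
        (inner (act_mor a (v i) ((sval (fr i)).2 j)) z).
    by rewrite (sig_big_dep xpredT (fun _ => xpredT) (fun i j =>
      ract (act_mor a (v i) ((sval (fr i)).1 j))
        (inner (act_mor a (v i) ((sval (fr i)).2 j)) z))).
  apply: eq_bigr => i _; rewrite act_morM {1}[act_mor a (dag (v i)) z](frP i).
  rewrite (adjoint_sum (@act_adj _ _ _ a _ _ (v i))); apply: eq_bigr => j _.
  by rewrite (adjoint_ract (@act_adj _ _ _ a _ _ (v i))) (@act_adj _ _ _ a _ _ (v i)).
apply: (rk_uniq (t := t) xy).
have -> : \sum_(p : I) trace t (inner (y p) (x p)) =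
    \sum_i \sum_(j < k i) trace t (inner ((sval (fr i)).2 j) ((sval (fr i)).1 j)).
  rewrite (sig_big_dep xpredT (fun _ => xpredT) (fun i j =>
    trace t (inner ((sval (fr i)).2 j) ((sval (fr i)).1 j)))) /=.
  apply: eq_bigr => p _.
  by rewrite /x /y (@act_adj _ _ _ a _ _ (v (tag p))) (@act_unitaryK _ _ _ a _ _ _ (viso (tag p))).
transitivity (\sum_i (rk (S i) * dim t)%:R : R[i]).
  by apply: eq_bigr => i _; exact: (rkP (frP i)).
by rewrite -natr_sum big_distrl.
Qed.

End Rank.

(** * Integral characters of the fusion ring *)

Section Dimension.
Context {K : fieldType} (V : lmodType K).

(** Base changes give matrices P Q = 1, and a matrix with a right inverse has at
    least as many columns as rows. *)
Lemma basis_size n m (e : 'I_n -> V) (e' : 'I_m -> V) :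
  is_basis e -> is_basis e' -> n = m.
Proof.
suff h n' m' (f : 'I_n' -> V) (f' : 'I_m' -> V) : is_basis f -> is_basis f' -> (n' <= m')%N.
  by move=> he he'; apply/eqP; rewrite eqn_leq (h _ _ _ _ he he') (h _ _ _ _ he' he).
move=> hf hf'.
have [P hP] := choice (fun i => ex_intro (fun c : {ffun 'I_m' -> K} =>
  f i = \sum_(j < m') c j *: f' j) _ (proj1 (svalP (cid (hf' (f i)))))).
have [Q hQ] := choice (fun j => ex_intro (fun c : {ffun 'I_n' -> K} =>
  f' j = \sum_(i < n') c i *: f i) _ (proj1 (svalP (cid (hf (f' j)))))).
pose MP : 'M[K]_(n', m') := \matrix_(i, j) P i j.
pose MQ : 'M[K]_(m', n') := \matrix_(j, i) Q j i.
apply: (@mulmx1_min _ _ _ MP MQ); apply/matrixP => i i'.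
have [c [hc uc]] := hf (f i).
have e1 : f i = \sum_(l < n') [ffun l => (i == l)%:R : K] l *: f l.
  rewrite (bigD1 i)//= ffunE eqxx scale1r big1 ?addr0// => l li.
  by rewrite ffunE eq_sym (negbTE li) scale0r.
have e2 : f i = \sum_(l < n') [ffun l => (MP *m MQ) i l] l *: f l.
  rewrite {1}hP; under eq_bigr => j _ do rewrite hQ scaler_sumr.
  rewrite exchange_big /=; apply: eq_bigr => l _.
  rewrite ffunE mxE scaler_suml; apply: eq_bigr => j _.
  by rewrite !mxE scalerA.
have := uc _ e1; rewrite (uc _ e2) => /ffunP/(_ i').
by rewrite !ffunE => ->; rewrite mxE.
Qed.

Lemma dimensionE n (e : 'I_n -> V) : is_basis e -> dimension V = n.
Proof.
move=> he; have [e' he'] : exists e' : 'I_(dimension V) -> V, is_basis e'.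
  rewrite /dimension; case: xgetP => [m -> [e' he']|/(_ n)]; first by exists e'.
  by case; exists e.
exact: basis_size he' he.
Qed.

End Dimension.

Section Schur.
Context {R : realType} {C : cstar_category R}.
Implicit Types X Y : C.

Lemma comp0m X Y Z (f : hom X Y) : comp (0 : hom Y Z) f = 0.
Proof. by have := compZl 0 (0 : hom Y Z) f; rewrite !scale0r. Qed.

Lemma compm0 X Y Z (g : hom Y Z) : comp g (0 : hom X Y) = 0.
Proof. by have := compZr 0 g (0 : hom X Y); rewrite !scale0r. Qed.

Lemma comp_suml X Y Z (I : Type) (s : seq I) (F : I -> hom Y Z) (f : hom X Y) :
  comp (\sum_(i <- s) F i) f = \sum_(i <- s) comp (F i) f.
Proof.
elim: s => [|i s IH]; first by rewrite !big_nil comp0m.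
by rewrite !big_cons compDl IH.
Qed.

Lemma comp_sumr X Y Z (I : Type) (s : seq I) (g : hom Y Z) (F : I -> hom X Y) :
  comp g (\sum_(i <- s) F i) = \sum_(i <- s) comp g (F i).
Proof.
elim: s => [|i s IH]; first by rewrite !big_nil compm0.
by rewrite !big_cons compDr IH.
Qed.

Lemma isomorphic_sym X Y : isomorphic X Y -> isomorphic Y X.
Proof. by move=> [f [g [gf fg]]]; exists g, f. Qed.

Lemma isomorphic_trans X Y Z : isomorphic X Y -> isomorphic Y Z -> isomorphic X Z.
Proof.
move=> [f [g [gf fg]]] [f' [g' [gf' fg']]]; exists (comp f' f), (comp g g'); split.
  by rewrite -compA (compA g') gf' comp1m gf.
by rewrite -compA (compA f) fg comp1m fg'.
Qed.

(** f^* f and f f^* are scalars, and the first is positive, so that f is a multiple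
    of a unitary. *)
Lemma schur X Y (f : hom X Y) : simple X -> simple Y -> f <> 0 ->
  exists u : hom X Y, unitary u.
Proof.
move=> [X1 sX] [Y1 sY] f0.
have [g hg] := hom_dag_ge0 f; have [c gE] := sX g.
have ff : comp (dag f) f = (rn c ^+ 2)%:C *: idm X.
  by rewrite hg gE dagZ compZl compZr scalerA conjM_rn dag_idm comp1m.
have c0 : rn c != 0.
  apply/eqP => c0; apply: f0; apply/eqP; rewrite -normr_eq0 -sqrf_eq0 -hom_norm_dag.
  by rewrite ff c0 expr0n scale0r normr0.
have cp : 0 < rn c by rewrite lt_def c0 rn_ge0.
have [w hw] := sY (comp f (dag f)).
have wE : w = (rn c ^+ 2)%:C.
  have : w *: f = (rn c ^+ 2)%:C *: f.
    by rewrite -{1}[f]comp1m -compZl -hw -compA ff compZr compm1.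
  move=> /eqP; rewrite -subr_eq0 -scalerBl scaler_eq0 => /orP[|/eqP//].
  by rewrite subr_eq0 => /eqP.
exists ((rn c)^-1%:C *: f).
have cc : (rn c)^-1%:C * (rn c)^-1%:C * (rn c ^+ 2)%:C = 1 :> R[i].
  by rewrite -!rmorphM -(rmorph1 (real_complex R)); congr (_%:C); field.
split; rewrite /isometry ?dagK dagZ conjR compZl compZr scalerA.
  by rewrite ff scalerA cc scale1r.
by rewrite hw wE scalerA cc scale1r.
Qed.

Lemma unitary_isomorphic X Y (u : hom X Y) : unitary u -> isomorphic X Y.
Proof. by move=> [h1 h2]; exists u, (dag u); split=> //; rewrite -{1}[u]dagK. Qed.

Lemma isomorphic_neq0 X Y : simple X -> isomorphic X Y -> exists f : hom X Y, f <> 0.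
Proof.
move=> [X1 _] [f [g [gf _]]]; exists f => f0; apply: X1.
by rewrite -gf f0 compm0.
Qed.

Lemma simple_isomorphicP X Y : simple X -> simple Y ->
  (isomorphic X Y <-> exists f : hom X Y, f <> 0).
Proof.
move=> sX sY; split; first exact: isomorphic_neq0.
by move=> [f /(schur sX sY)[u /unitary_isomorphic]].
Qed.

Lemma hom_simple_line X Y (f g : hom X Y) : simple X -> simple Y -> f <> 0 ->
  exists c : R[i], g = c *: f.
Proof.
move=> sX sY f0; have [u [u1 u2]] := schur sX sY f0; rewrite /isometry dagK in u2.
have [c hc] := sX.2 (comp (dag u) f); have [d hd] := sX.2 (comp (dag u) g).
have fE : f = c *: u by rewrite -[f]comp1m -u2 -compA hc compZr compm1.
have c0 : c != 0 by apply/eqP => c0; apply: f0; rewrite fE c0 scale0r.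
exists (d / c); rewrite {1}fE scalerA divfK//.
by rewrite -[g]comp1m -u2 -compA hd compZr compm1.
Qed.

End Schur.

Section FusionCharacter.
Context {R : realType} {C : unitary_fusion_category R} (r : C -> nat).
Hypotheses (r_un : r un = 1%N) (r_tensor : forall X Y, r (ot X Y) = (r X * r Y)%N)
  (r_sum : forall n (S : 'I_n -> C) X, is_direct_sum S X -> r X = (\sum_i r (S i))%N).

Lemma r_simple_iso (X Y : C) : simple X -> simple Y -> isomorphic X Y -> r X = r Y.
Proof.
move=> sX sY iXY; have [f f0] := isomorphic_neq0 sX iXY.
have [u [u1 u2]] := schur sX sY f0.
have ds : is_direct_sum (fun _ : 'I_1 => X) Y.
  exists (fun=> u); split=> //; split; first by move=> i j; rewrite !ord1.
  by rewrite big_ord1; rewrite /isometry dagK in u2.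
by rewrite (r_sum ds) big_ord1.
Qed.

(** The evaluation of X' (x) X is nonzero, so the unit is a summand, and
    r X' * r X is at least 1. *)
Lemma r_simple_gt0 (X : C) : simple X -> (0 < r X)%N.
Proof.
move=> sX; have [[X' [ev [coev [zz _]]]] _] := ufc_rigid X.
have ev0 : ev <> 0.
  move=> ev0; apply: sX.1; rewrite -zz ev0.
  have -> : otm (idm X) (0 : hom (ot X' X) un) = 0.
    by have := otmZr 0 (idm X) (0 : hom (ot X' X) un); rewrite !scale0r.
  by rewrite comp0m compm0.
have [n [S [sS dS]]] := decomposes (ufc_semisimple C) (ot X' X).
have [i evi] : exists i, isomorphic (S i) un.
  have [v [_ [_ vsum]]] := dS; apply: contrapT => h; apply: ev0.
  rewrite -[ev]compm1 -vsum comp_sumr big1// => i _.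
  have [fi0|fi0] := eqVneq (comp ev (v i)) 0; first by rewrite compA fi0 comp0m.
  exfalso; apply: h; exists i; apply/(simple_isomorphicP (sS i) (ufc_unit C)).
  by exists (comp ev (v i)); exact/eqP.
have : (0 < r (ot X' X))%N.
  rewrite (r_sum dS) (bigD1 i)//= (r_simple_iso (sS i) (ufc_unit C) evi) r_un.
  by rewrite add1n.
by rewrite r_tensor muln_gt0 => /andP[].
Qed.

(** By Schur's lemma, one nonzero morphism from irr k to each summand isomorphic
    to it makes a basis of hom (irr k) X. *)
Lemma mult_count n (S : 'I_n -> C) (X : C) (sigma : 'I_n -> 'I_(irr_rank C)) k :
  (forall i, simple (S i)) -> (forall i, isomorphic (irr (sigma i)) (S i)) ->
  is_direct_sum S X -> mult k X = #|[set i | sigma i == k]|.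
Proof.
move=> sS iS [v [viso [vorth vsum]]].
have sk := irr_simple (u := C) k.
have ex i : exists f : hom (irr k) (S i), sigma i = k -> f <> 0.
  have [sik|sik] := eqVneq (sigma i) k; last by exists 0 => e; rewrite e eqxx in sik.
  have [f f0] := isomorphic_neq0 (irr_simple (sigma i)) (iS i).
  by subst k; exists f.
pose f i := sval (cid (ex i)).
have hf i : sigma i = k -> f i <> 0 := svalP (cid (ex i)).
have zero i (h : hom (irr k) (S i)) : sigma i <> k -> h = 0.
  move=> sik; apply: contrapT => h0; apply: sik; apply/esym/irr_inj.
  apply: isomorphic_trans (isomorphic_sym (iS i)).
  by apply/(simple_isomorphicP sk (sS i)); exists h.
pose D := [set i | sigma i == k].
have Dk (j : 'I_#|D|) : sigma (enum_val j) = k.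
  by have := enum_valP j; rewrite inE => /eqP.
apply: (@dimensionE _ _ #|D| (fun j => comp (v (enum_val j)) (f (enum_val j)))) => h.
have ex' i : exists c : R[i], sigma i = k -> comp (dag (v i)) h = c *: f i.
  have [sik|sik] := eqVneq (sigma i) k; last by exists 0 => e; rewrite e eqxx in sik.
  by have [c hc] := hom_simple_line (comp (dag (v i)) h) sk (sS i) (hf i sik); exists c.
have [c hc] := choice ex'.
exists [ffun j => c (enum_val j)]; split.
  rewrite -{1}[h]comp1m -vsum comp_suml (bigID (mem D))/= [X in _ + X]big1 ?addr0.
    rewrite big_enum_val /=; apply: eq_bigr => j _.
    by rewrite ffunE -compA (hc _ (Dk j)) compZr.
  move=> i; rewrite inE => /eqP sik; rewrite -compA.
  by rewrite (zero _ (comp (dag (v i)) h) sik) compm0.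
move=> c' hc'; apply/ffunP => j; rewrite ffunE.
have fj := hf _ (Dk j).
have e1 := hc _ (Dk j).
have e2 : comp (dag (v (enum_val j))) h = c' j *: f (enum_val j).
  rewrite hc' comp_sumr (bigD1 j)//= big1 ?addr0.
    by rewrite compZr compA (viso (enum_val j)) comp1m.
  move=> l lj; rewrite compZr compA vorth ?comp0m ?scaler0//.
  by move=> /enum_val_inj e; move: lj; rewrite e eqxx.
move: e1; rewrite e2 => /eqP; rewrite eq_sym -subr_eq0 -scalerBl scaler_eq0.
by move=> /orP[|/eqP//]; rewrite subr_eq0 => /eqP.
Qed.

Lemma r_mult X : r X = (\sum_(k < irr_rank C) mult k X * r (irr k))%N.
Proof.
have [n [S [sS dS]]] := decomposes (ufc_semisimple C) X.
have [sigma hs] := choice (fun i => irr_all (sS i)).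
rewrite (r_sum dS) (partition_big sigma xpredT)//=; apply: eq_bigr => k _.
rewrite (mult_count k sS hs dS) -sum_nat_const.
apply: eq_big => [i|i /eqP sik]; first by rewrite inE.
by rewrite -sik; apply/esym/r_simple_iso => //; exact: irr_simple.
Qed.

(** The positive vector (r (irr l))_l is an eigenvector of the fusion matrix of X
    for r X; pairing it with the absolute values of any other eigenvector bounds
    the other eigenvalues. *)
Lemma perron_eigenvalue_character X :
  (0 < irr_rank C)%N -> perron_eigenvalue (fusion_matrix X) = (r X)%:R.
Proof.
move=> rk0; set M := fusion_matrix X.
pose D : 'cV[R]_(irr_rank C) := \col_l (r (irr l))%:R.
have D0 l : 0 < D l 0 by rewrite mxE ltr0n r_simple_gt0//; exact: irr_simple.
have MD : M *m D = (r X)%:R *: D.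
  apply/matrixP => j o; rewrite ord1 !mxE -natrM -r_tensor r_mult natr_sum.
  by apply: eq_bigr => l _; rewrite !mxE natrM.
have M0 j l : 0 <= M j l by rewrite mxE ler0n.
(* eigenvalue refers to row eigenvectors, while D is a column *)
have ev : eigenvalue M (r X)%:R.
  have : eigenvalue M^T (r X)%:R.
    apply/eigenvalueP; exists D^T; first by rewrite -trmx_mul MD linearZ.
    apply/eqP => /matrixP/(_ 0 (Ordinal rk0)); rewrite [LHS]mxE [RHS]mxE => d0.
    by have := D0 (Ordinal rk0); rewrite d0 ltxx.
  rewrite !eigenvalue_root_char (_ : char_poly M^T = char_poly M)//.
  rewrite /char_poly -[LHS]det_tr /char_poly_mx linearB /= tr_scalar_mx.
  by rewrite map_trmx trmxK.
have ub x : 0 <= x -> eigenvalue M x -> x <= (r X)%:R.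
  move=> x0 /eigenvalueP[v vM vn0].
  pose s := \sum_l `|v 0 l| * D l 0.
  have term l : 0 <= `|v 0 l| * D l 0 by rewrite mulr_ge0// ltW.
  have s0 : 0 < s.
    have [l vl] : exists l, v 0 l != 0.
      apply: contrapT => h; move/eqP: vn0; apply; apply/matrixP => i j.
      rewrite ord1 [RHS]mxE; apply/eqP/negPn/negP => vj; apply: h.
      by exists j.
    rewrite /s (bigD1 l)//=; apply: ltr_pwDl.
      by rewrite mulr_gt0// normr_gt0.
    by apply: sumr_ge0.
  rewrite -(ler_pM2r s0) /s mulr_sumr.
  have -> : (r X)%:R * s = \sum_j `|v 0 j| * (M *m D) j 0.
    rewrite MD mulr_sumr; apply: eq_bigr => j _.
    by rewrite [in RHS]mxE mulrCA.
  have -> : \sum_j `|v 0 j| * (M *m D) j 0 = \sum_l (\sum_j `|v 0 j| * M j l) * D l 0.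
    under [RHS]eq_bigr => l _ do rewrite mulr_suml.
    rewrite exchange_big /=; apply: eq_bigr => j _.
    by rewrite mxE mulr_sumr; apply: eq_bigr => l _; rewrite mulrA.
  apply: ler_sum => l _; rewrite mulrA ler_wpM2r//; first exact: ltW.
  have := congr1 (fun w : 'rV_(irr_rank C) => `|w 0 l|) vM.
  rewrite /= [in RHS]mxE normrM ger0_norm// => <-.
  rewrite mxE; apply: le_trans (ler_norm_sum _ _ _) _.
  by apply: ler_sum => j _; rewrite normrM (ger0_norm (M0 j l)).
apply/eqP; rewrite eq_le; apply/andP; split.
  apply: ge_sup; first by exists (r X)%:R; split=> //; exact: ler0n.
  by move=> x [x0 hx]; exact: ub.
apply: ub_le_sup; last by split=> //; exact: ler0n.
by exists (r X)%:R => x [x0 hx]; exact: ub.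
Qed.

Lemma FPdim_character X : FPdim X = (r X)%:R.
Proof.
rewrite /FPdim (r_mult X) natr_sum; apply: eq_bigr => k _.
rewrite natrM perron_eigenvalue_character//.
exact: leq_ltn_trans (leq0n _) (ltn_ord k).
Qed.

End FusionCharacter.

Theorem corollary5p3 (R : realType) (C : unitary_fusion_category R)
  (hdim : exists X : C, FPdim X \isn't a Num.int)
  (A : cstar_algebra R) (hct : continuous_trace A)
  (hconn : spectrum_connected A) :
  ~ inhabited (action C A).
Proof.
move=> [a]; have [X] := hdim; apply/negP; rewrite negbK.
rewrite (FPdim_character (rk_un hct hconn a) (rk_tensor hct hconn a)
  (fun n S X => @rk_direct_sum _ _ _ hct hconn a n S X)).
exact: natr_int.
Qed.
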